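(* The operator $\mathcal B_c=\mathcal A_c-\mathcal A$ is $\mathcal A$-bounded in $H^1\times L^2$ with coefficients $a(c)$ and $b(c)$ that are continuous, increasing functions of $|c|$ (for $|c|$ small) and tend to zero as $c$ does. That is, for all sufficiently small $|c|$, $$\|\mathcal B_cU\|_{H^1\times L^2}\le a(c)\,\|U\|_{H^1\times L^2}+b(c)\,\|\mathcal A U\|_{H^1\times L^2}\qquad\text{for all } U\in H^2\times H^1,$$ with $a(c),b(c)\ge0$ continuous and increasing in $|c|$ and $a(c),b(c)\to0$ as $c\to0$.
   Context: Spaces $L^2,H^k$ consist of complex-valued functions on $\mathbb R$. $(-\Delta)^{1/2}$ is the Fourier multiplier $|\xi|$ and $\mathcal T:=1+(-\Delta)^{1/2}$. For a real function $\phi$, $s_\phi:=\sin\phi$ and $c_\phi:=\cos\phi\,\mathcal T(\cos\phi)$. The energy is $\mathcal E(\theta)=\frac12\big(\|\theta'\|_{L^2}^2+\|\cos\theta\|_{\dot H^{1/2}}^2+\|\cos\theta\|_{L^2}^2\big)$, with $L^2$-gradient $\nabla\mathcal E(\theta)=-\theta''-\sin\theta\,\mathcal T(\cos\theta)$. The static Néel wall phase $\bar\theta$ is the unique odd, monotone increasing, smooth solution of $\nabla\mathcal E(\bar\theta)=0$ with $\bar\theta(\pm\infty)=\pm\pi/2$; $\bar\theta'\in H^k$ for all $k\ge0$. Fix $\nu>0$. Static operators: $\mathcal L u=-u''+s_{\bar\theta}\mathcal T(s_{\bar\theta}u)-c_{\bar\theta}u$ for $u\in H^2$, and $\mathcal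 A:H^1\times L^2\to H^1\times L^2$, with domain $H^2\times H^1$, $\mathcal A(u,v)=(v,-\mathcal L u-\nu v)$. Moving walls (known existence): for $|H|<\widetilde\delta$ there are $\psi=\psi_H$ and a speed $c=c(H)\in\mathbb R$ with $\psi-\bar\theta\in H^2(\mathbb R)$, $c^2\psi''-\nu c\psi'+\nabla\mathcal E(\psi)=H\cos\psi$, $\psi(\pm\infty)=\pm\pi/2$. The map $H\mapsto(\psi_H-\bar\theta,c(H))\in H^2\times\mathbb R$ comes from the implicit function theorem, is differentiable, and vanishes at $H=0$; moreover $c=O(|H|)$, $H=O(|c|)$, $\|\psi-\bar\theta\|_{H^1}=O(|c|)$, and for small values the correspondence between $H$ and $c$ is one-to-one. Hence $c$ is used as the parameter instead of $H$, with $\psi$ and $H$ those associated with $c$ (always with $|c|<1$ small enough that the wall exists). Moving operators: for $u\in H^2$, $\mathcal L_cu=-(1-c^2)u''+s_\psi\mathcal T(s_\psi u)-c\nu u'-(c_\psi-Hs_\psi)u$, and $\mathcal A_c:H^1\times L^2\to H^1\times L^2$, with domain $H^2\times H^1$, $\mathcal A_c(u,v)=(v,-\mathcal L_cu+2cv'-\nu v)$. One has $\mathcal A_0=\mathcal A$. Given linear operators $\mathcal P,\mathcal S$ on a Banach space, $\mathcal S$ is $\mathcal P$-bounded with coefficients $a,b\ge0$ if $D(\mathcal P)\subset D(\mathcal S)$ and $\|\mathcal S u\|\le a\|u\|+b\|\mathcal P u\|$ for all $u\in D(\mathcal P)$. *)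

(* Defs.v *)
From HB Require Import structures.
From mathcomp Require Import all_boot all_order all_algebra.
From mathcomp Require Import all_classical all_reals all_analysis.
From mathcomp Require Import complex.

Set Implicit Arguments.
Unset Strict Implicit.
Unset Printing Implicit Defensive.
Import Order.TTheory GRing.Theory Num.Theory.
Import numFieldNormedType.Exports.

Local Open Scope classical_set_scope.
Local Open Scope ring_scope.
Local Open Scope complex_scope.

(* Elements of L^2 and H^k are represented by Borel functions R -> R[i];
   identities between them are understood almost everywhere. *)
Definition cfun (R : realType) : Type := R -> R[i].

Definition of_real (R : realType) (f : R -> R) : cfun R := fun x => (f x)%:C.

Definition aeeq (R : realType) (f g : cfun R) : Prop :=
  {ae @lebesgue_measure R, forall x, f x = g x}.

Definition cintegral (R : realType) (D : set R) (f : cfun R) : R[i] :=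
  (\int[@lebesgue_measure R]_(x in D) complex.Re (f x))
  +i* (\int[@lebesgue_measure R]_(x in D) complex.Im (f x)).

Definition L2enorm (R : realType) (f : cfun R) : \bar R :=
  Lnorm (@lebesgue_measure R) 2%:E (fun x => (Normc.normc (f x))%:E).

Definition L2norm (R : realType) (f : cfun R) : R := fine (L2enorm f).

Definition L2 (R : realType) : set (cfun R) := [set f |
  [/\ measurable_fun setT (fun x => complex.Re (f x)),
      measurable_fun setT (fun x => complex.Im (f x)) &
      (L2enorm f < +oo)%E]].

Definition test_fun (R : realType) (phi : R -> R) : Prop :=
  [/\ forall x, derivable phi x 1,
      continuous (derive1 phi) &
      exists M : R, forall x, M < `|x| -> phi x = 0].

Definition cloc_integrable (R : realType) (f : cfun R) : Prop :=
  locally_integrable setT (fun x => complex.Re (f x)) /\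
  locally_integrable setT (fun x => complex.Im (f x)).

Definition weak_deriv (R : realType) (f g : cfun R) : Prop :=
  [/\ cloc_integrable f, cloc_integrable g &
      forall phi : R -> R, test_fun phi ->
        cintegral setT (fun x => f x * (derive1 phi x)%:C) =
        - cintegral setT (fun x => g x * (phi x)%:C)].

(* The weak derivative of f, when it exists in L^2 (and an irrelevant value
   otherwise); f itself need not be in L^2, as for a wall phase. *)
Definition wD (R : realType) (f : cfun R) : cfun R :=
  xget (fun=> 0) [set g | L2 g /\ weak_deriv f g].

Fixpoint sobolev (R : realType) (k : nat) (f : cfun R) : Prop :=
  if k is k'.+1 then L2 f /\ exists g, weak_deriv f g /\ sobolev k' g
  else L2 f.

Definition sobolev_norm (R : realType) (k : nat) (f : cfun R) : R :=
  Num.sqrt (\sum_(j < k.+1) L2norm (iter j (@wD R) f) ^+ 2).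

Definition expi (R : realType) (t : R) : R[i] := cos t +i* sin t.

Definition truncated_fourier (R : realType) (f : cfun R) (n : nat) : cfun R :=
  fun xi => cintegral `[- n%:R, n%:R] (fun x => f x * expi (- (x * xi))).

(* Plancherel's definition: g is the limit in mean of the Fourier integrals of
   f over [-n, n].  The transform is not normalized, which does not affect
   Fourier multipliers. *)
Definition is_fourier (R : realType) (f g : cfun R) : Prop :=
  [/\ L2 f, L2 g &
      L2enorm (fun xi => truncated_fourier f n xi - g xi)
        @[n --> \oo] --> (0 : \bar R)%E].

Definition is_multiplier (R : realType) (m : R -> R) (f w : cfun R) : Prop :=
  exists fh wh, [/\ is_fourier f fh, is_fourier w wh &
    aeeq wh (fun xi => (m xi)%:C * fh xi)].

Definition half_laplacian (R : realType) (f : cfun R) : cfun R :=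
  xget (fun=> 0) [set w | is_multiplier (fun xi => `|xi|) f w].

Definition calT (R : realType) (f : cfun R) : cfun R :=
  fun x => f x + half_laplacian f x.

Definition s_ (R : realType) (phi : R -> R) : cfun R :=
  of_real (fun x => sin (phi x)).

Definition cos_ (R : realType) (phi : R -> R) : cfun R :=
  of_real (fun x => cos (phi x)).

Definition c_ (R : realType) (phi : R -> R) : cfun R :=
  fun x => cos_ phi x * calT (cos_ phi) x.

Definition gradE (R : realType) (theta : R -> R) : cfun R :=
  fun x => - wD (wD (of_real theta)) x - s_ theta x * calT (cos_ theta) x.

(* cos theta in H^1 is what makes calT (cos theta) an element of L^2. *)
Record static_neel_wall (R : realType) (theta : R -> R) : Prop :=
  StaticNeelWall {
    wall_smooth : forall n x, derivable (derive1n n theta) x 1;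
    wall_odd : forall x, theta (- x) = - theta x;
    wall_increasing : {homo theta : x y / x <= y};
    wall_pinfty : theta x @[x --> +oo] --> pi / 2;
    wall_ninfty : theta x @[x --> -oo] --> - (pi / 2);
    wall_deriv_sobolev : forall k, sobolev k (of_real (derive1 theta));
    wall_cos_sobolev : sobolev 1 (cos_ theta);
    wall_critical : aeeq (gradE theta) (fun=> 0)
  }.

Definition moving_wall (R : realType) (nu : R) (theta : R -> R) (H c : R)
    (psi : R -> R) : Prop :=
  [/\ sobolev 2 (of_real (psi \- theta)),
      psi x @[x --> +oo] --> pi / 2,
      psi x @[x --> -oo] --> - (pi / 2) &
      aeeq (fun x => (c ^+ 2)%:C * wD (wD (of_real psi)) x
                     - (nu * c)%:C * wD (of_real psi) x + gradE psi x)
           (fun x => H%:C * cos_ psi x)].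

(* psi H and speed H are the wall and its speed for |H| < delta; field is the
   local inverse of speed, giving the H associated with c. *)
Record moving_wall_family (R : realType) (nu : R) (theta : R -> R) (delta : R)
    (psi : R -> R -> R) (speed field : R -> R) : Prop := MovingWallFamily {
  mw_delta_gt0 : 0 < delta;
  mw_wall : forall H, `|H| < delta ->
    moving_wall nu theta H (speed H) (psi H);
  mw_psi_diff : forall H, `|H| < delta -> exists eta : R -> R,
    sobolev 2 (of_real eta) /\
    h^-1 * sobolev_norm 2
      (of_real (fun x => psi (H + h) x - psi H x - h * eta x))
      @[h --> (0 : R)^'] --> (0 : R);
  mw_speed_diff : forall H, `|H| < delta -> derivable speed H 1;
  mw_psi0 : aeeq (of_real (psi 0)) (of_real theta);
  mw_speed0 : speed 0 = 0;
  mw_fieldK : \forall c \near (0 : R),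
    `|field c| < delta /\ speed (field c) = c;
  mw_speedK : \forall H \near (0 : R), field (speed H) = H;
  mw_speed_bigO : exists K : R, \forall H \near (0 : R),
    `|speed H| <= K * `|H|;
  mw_field_bigO : exists K : R, \forall c \near (0 : R),
    `|field c| <= K * `|c|;
  mw_psi_bigO : exists K : R, \forall c \near (0 : R),
    sobolev_norm 1 (of_real (psi (field c) \- theta)) <= K * `|c|
}.

Definition state (R : realType) : Type := (cfun R * cfun R)%type.

Definition H1L2 (R : realType) : set (state R) :=
  [set U | sobolev 1 U.1 /\ L2 U.2].

Definition H1L2norm (R : realType) (U : state R) : R :=
  Num.sqrt (sobolev_norm 1 U.1 ^+ 2 + L2norm U.2 ^+ 2).

Definition state_aeeq (R : realType) (U V : state R) : Prop :=
  aeeq U.1 V.1 /\ aeeq U.2 V.2.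

Definition state_lin (R : realType) (a : R[i]) (U V : state R) : state R :=
  (fun x => a * U.1 x + V.1 x, fun x => a * U.2 x + V.2 x).

Record unbounded_op (R : realType) := UnboundedOp {
  op_dom : set (state R);
  op_fun : state R -> state R
}.

Definition op_sub (R : realType) (P S : unbounded_op R) : unbounded_op R :=
  UnboundedOp (op_dom P `&` op_dom S)
    (fun U => state_lin (-1) (op_fun S U) (op_fun P U)).

(* P is a linear operator in the space H^1 x L^2 of almost-everywhere classes. *)
Definition linear_op (R : realType) (P : unbounded_op R) : Prop :=
  [/\ op_dom P `<=` @H1L2 R,
      forall U, op_dom P U -> H1L2 (op_fun P U),
      forall U V, op_dom P U -> op_dom P V -> state_aeeq U V ->
        state_aeeq (op_fun P U) (op_fun P V) &
      forall a U V, op_dom P U -> op_dom P V ->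
        op_dom P (state_lin a U V) /\
        state_aeeq (op_fun P (state_lin a U V))
                   (state_lin a (op_fun P U) (op_fun P V))].

Definition rel_bounded (R : realType) (P S : unbounded_op R) (a b : R) : Prop :=
  [/\ linear_op P, linear_op S, 0 <= a /\ 0 <= b, op_dom P `<=` op_dom S &
      forall U, op_dom P U ->
        H1L2norm (op_fun S U) <= a * H1L2norm U + b * H1L2norm (op_fun P U)].

Definition H2H1 (R : realType) : set (state R) :=
  [set U | sobolev 2 U.1 /\ sobolev 1 U.2].

Definition opL (R : realType) (theta : R -> R) (u : cfun R) : cfun R :=
  fun x => - wD (wD u) x + s_ theta x * calT (fun y => s_ theta y * u y) x
           - c_ theta x * u x.

Definition opA (R : realType) (nu : R) (theta : R -> R) : unbounded_op R :=
  UnboundedOp (@H2H1 R)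
    (fun U => (U.2, fun x => - opL theta U.1 x - nu%:C * U.2 x)).

Definition opLc (R : realType) (nu c H : R) (psi : R -> R) (u : cfun R) :
    cfun R :=
  fun x => - (1 - c ^+ 2)%:C * wD (wD u) x
           + s_ psi x * calT (fun y => s_ psi y * u y) x
           - (c * nu)%:C * wD u x
           - (c_ psi x - H%:C * s_ psi x) * u x.

Definition opAc (R : realType) (nu c H : R) (psi : R -> R) : unbounded_op R :=
  UnboundedOp (@H2H1 R)
    (fun U => (U.2, fun x => - opLc nu c H psi U.1 x
                             + (2 * c)%:C * wD U.2 x - nu%:C * U.2 x)).

Definition small_coefficient (R : realType) (r : R) (a : R -> R) : Prop :=
  [/\ {within `[0, r[, continuous a},
      {in `[0, r[ &, {homo a : x y / x < y}},
      {in `[0, r[, forall x, 0 <= a x} &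
      a x @[x --> 0^'+] --> (0 : R)].

(* Main.v *)
Require Import Defs.
From HB Require Import structures.
From mathcomp Require Import all_boot all_order all_algebra.
From mathcomp Require Import all_classical all_reals all_analysis.
From mathcomp Require Import measurable_realfun complex ring lra.
Import Order.TTheory GRing.Theory Num.Theory.
Import numFieldNormedType.Exports.
Set Implicit Arguments.
Unset Strict Implicit.
Unset Printing Implicit Defensive.
Local Open Scope classical_set_scope.
Local Open Scope ring_scope.
Local Open Scope complex_scope.

(** For U = (u, v) the two generators have the same first component, and the
difference of the second components is
  - c^2 u'' - (P_psi u - P_theta u) + c nu u' - H s_psi u + 2 c v',
where P_phi u = s_phi T(s_phi u) - c_phi u collects the terms in which the
wall phi enters nonlocally.  Since psi - theta is O(c) in H^1 and H = O(c),
every term but the first and the last is O(c) times the H^1 norm of u in L^2.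
The remaining two are controlled by the graph of A: v is the first component
of A U, and u'' is recovered from the second one by moving P_theta u and
nu v to the other side ([graph_bound]).  Hence a(c) = b(c) = K |c| works.

The nonlocal terms are handled as products ([wall_op_perturbation]):
  s_psi T(s_psi u) - s_theta T(s_theta u)
    = (s_psi - s_theta) T(s_psi u) + s_theta T((s_psi - s_theta) u),
and similarly for c_phi = cos phi T(cos phi).  This needs only that T is linear
on H^1 with values in L^2, that H^1 functions are bounded by their H^1 norm,
and that multiplying an H^1 function by sin psi - sin theta or by
cos psi - cos theta costs a factor O(c) in H^1.  For the last point the
perturbation psi - theta, being in H^2, has a C^1 representative
([H2_C1_rep]); so the trigonometric functions of psi can be differentiated by
the chain rule, and their products with weakly differentiable functions by
moving the factor onto the test function ([real_weak_deriv_mul]).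

Both the half Laplacian and the Sobolev embedding rest on the theory of the
Fourier transform, which is defined as a limit in mean.  It is an isometry of
L^2 up to a constant ([fourier_isometry]), it is onto ([fourier_surj]), and it
turns a weak derivative into multiplication by i xi ([fourier_deriv]).  Then
|xi| fh has the L^2 norm of the transform of f', so the half Laplacian of f
exists in L^2 and has the norm of f'; and (1 + xi^2) |fh|^2 is integrable, so
fh is integrable and inversion bounds f ([inversion_L1]).

The isometry is first proved for integrable p >= 0 in L^2 ([plancherel_ge0]).
Weighting |p^|^2 with a Fejer kernel, Tonelli's theorem yields the quadratic
form of a triangle kernel at p; shrinking the triangle gives the integral of
p^2 on one side, and flattening the Fejer kernel gives the integral of |p^|^2
on the other.  The constant is twice [kappa], the integral of (1 - cos x)/x^2;
only its positivity matters.  Splitting u = u+ - u-, separating real and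
imaginary parts, and truncating extend the identity to all of L^2. *)

(** * The squared norm of L^2 *)

Section L2.
Context {R : realType}.
Local Notation mu := (@lebesgue_measure R).
Implicit Types (f g h : cfun R) (z : R[i]).

Lemma ae_imp (P Q : R -> Prop) : (forall x, P x -> Q x) ->
  {ae mu, forall x, P x} -> {ae mu, forall x, Q x}.
Proof. exact: (@filterS _ _ (ae_filter_ringOfSetsType mu)). Qed.

Lemma ae_imp2 (P Q S : R -> Prop) : (forall x, P x -> Q x -> S x) ->
  {ae mu, forall x, P x} -> {ae mu, forall x, Q x} -> {ae mu, forall x, S x}.
Proof. exact: (@filterS2 _ _ (ae_filter_ringOfSetsType mu)). Qed.

Lemma ae_imp3 (P Q S U : R -> Prop) : (forall x, P x -> Q x -> S x -> U x) ->
  {ae mu, forall x, P x} -> {ae mu, forall x, Q x} -> {ae mu, forall x, S x} ->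
  {ae mu, forall x, U x}.
Proof. exact: (@filterS3 _ _ (ae_filter_ringOfSetsType mu)). Qed.

Definition sqc z : R := complex.Re z ^+ 2 + complex.Im z ^+ 2.

Lemma sqc_ge0 z : 0 <= sqc z.
Proof. by rewrite addr_ge0 ?sqr_ge0. Qed.

Lemma normc_sqc z : Normc.normc z ^+ 2 = sqc z.
Proof. by case: z => a b; rewrite /sqc /= sqr_sqrtr // addr_ge0 ?sqr_ge0. Qed.

Lemma L2enorm_sqr f : (L2enorm f `^ 2)%E = (\int[mu]_x (sqc (f x))%:E)%E.
Proof.
rewrite /L2enorm powR_Lnorm ?pnatr_eq0//; apply: eq_integral => x _.
rewrite abse_EFin poweR_EFin; congr EFin.
by rewrite powR_mulrn ?normr_ge0// real_normK ?num_real// normc_sqc.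
Qed.

(** All estimates are on squared norms: they are integrals, and the factor 2 that
the triangle inequality loses on them is harmless. *)
Definition L2sq f : R := \int[mu]_x sqc (f x).

Definition cmeas f := measurable_fun setT (fun x => complex.Re (f x)) /\
  measurable_fun setT (fun x => complex.Im (f x)).

Lemma L2norm_sqr f : L2norm f ^+ 2 = L2sq f.
Proof.
rewrite /L2sq /Rintegral -L2enorm_sqr /L2norm.
have := Lnorm_ge0 mu 2%:E (fun x => (Normc.normc (f x))%:E).
rewrite -/(L2enorm f); case: (L2enorm f) => [r|_|//] //=.
  by rewrite lee_fin => r0; rewrite powR_mulrn.
by rewrite pnatr_eq0 /= expr0n.
Qed.

Lemma L2P f : L2 f <-> cmeas f /\ (\int[mu]_x (sqc (f x))%:E < +oo)%E.
Proof.
rewrite -L2enorm_sqr /L2 /cmeas /=.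
have := Lnorm_ge0 mu 2%:E (fun x => (Normc.normc (f x))%:E).
rewrite -/(L2enorm f) => n0.
split => [[? ? h]|[[? ?] h]]; split => //.
  by apply: poweR_lty.
by move: h n0; case: (L2enorm f) => [r _ _|/=|] //; rewrite ?ltry// pnatr_eq0.
Qed.

Lemma sqcM z1 z2 : sqc (z1 * z2) = sqc z1 * sqc z2.
Proof. by case: z1 => a b; case: z2 => c d; rewrite /sqc /=; ring. Qed.

Lemma sqcN z : sqc (- z) = sqc z.
Proof. by case: z => a b; rewrite /sqc /= !sqrrN. Qed.

Lemma sqcD_le z1 z2 : sqc (z1 + z2) <= 2 * sqc z1 + 2 * sqc z2.
Proof.
case: z1 => a b; case: z2 => c d; rewrite /sqc /=.
have := sqr_ge0 (a - c); have := sqr_ge0 (b - d); nra.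
Qed.

Lemma sqc_real (a : R) : sqc a%:C = a ^+ 2.
Proof. by rewrite /sqc /= expr0n addr0. Qed.

Lemma sqc0 : sqc 0 = 0 :> R.
Proof. by rewrite /sqc /= expr0n addr0. Qed.

Lemma sqc_eq0 z : sqc z = 0 -> z = 0.
Proof.
case: z => a b; rewrite /sqc /= => /eqP; rewrite paddr_eq0 ?sqr_ge0//.
by rewrite !sqrf_eq0 => /andP[/eqP -> /eqP ->].
Qed.

Lemma ReD z1 z2 : complex.Re (z1 + z2) = complex.Re z1 + complex.Re z2.
Proof. by case: z1 => a b; case: z2 => c d. Qed.
Lemma ImD z1 z2 : complex.Im (z1 + z2) = complex.Im z1 + complex.Im z2.
Proof. by case: z1 => a b; case: z2 => c d. Qed.
Lemma ReN z : complex.Re (- z) = - complex.Re z.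
Proof. by case: z. Qed.
Lemma ImN z : complex.Im (- z) = - complex.Im z.
Proof. by case: z. Qed.
Lemma ReM z1 z2 : complex.Re (z1 * z2) =
  complex.Re z1 * complex.Re z2 - complex.Im z1 * complex.Im z2.
Proof. by case: z1 => a b; case: z2 => c d. Qed.
Lemma ImM z1 z2 : complex.Im (z1 * z2) =
  complex.Re z1 * complex.Im z2 + complex.Im z1 * complex.Re z2.
Proof. by case: z1 => a b; case: z2 => c d. Qed.
Lemma RCE (a : R) : (complex.Re a%:C = a) * (complex.Im a%:C = 0).
Proof. by []. Qed.
Definition ReImE := (ReD, ImD, ReN, ImN, ReM, ImM, RCE).

Lemma cmeas_sqc f : cmeas f -> measurable_fun setT (fun x => sqc (f x)).
Proof.
by move=> [mr mi]; apply: measurable_funD; apply: measurable_funX.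
Qed.

Lemma cmeasD f g : cmeas f -> cmeas g -> cmeas (fun x => f x + g x).
Proof.
move=> [mr mi] [mr' mi']; split.
  by under eq_fun do rewrite ReD; exact: measurable_funD.
by under eq_fun do rewrite ImD; exact: measurable_funD.
Qed.

Lemma cmeasN f : cmeas f -> cmeas (fun x => - f x).
Proof.
move=> [mr mi]; split.
  by under eq_fun do rewrite ReN; exact: measurable_funN.
by under eq_fun do rewrite ImN; exact: measurable_funN.
Qed.

Lemma cmeasM f g : cmeas f -> cmeas g -> cmeas (fun x => f x * g x).
Proof.
move=> [mr mi] [mr' mi']; split.
  under eq_fun do rewrite ReM.
  by apply: measurable_funB; exact: measurable_funM.
under eq_fun do rewrite ImM.
by apply: measurable_funD; exact: measurable_funM.
Qed.

Lemma cmeas_cst z : cmeas (fun=> z).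
Proof. by split; exact: measurable_cst. Qed.

Lemma cmeas_real (a : R -> R) : measurable_fun setT a -> cmeas (of_real a).
Proof. by move=> ma; split => //; exact: measurable_cst. Qed.

Lemma L2_cmeas f : L2 f -> cmeas f.
Proof. by move=> /L2P[]. Qed.

Lemma L2_int f : L2 f -> mu.-integrable setT (EFin \o (fun x => sqc (f x))).
Proof.
move=> /L2P[mf h]; apply/integrableP; split.
  by apply/measurable_EFinP; exact: cmeas_sqc.
move: h; congr (_ < +oo)%E; apply: eq_integral => x _ /=.
by rewrite ger0_norm// sqc_ge0.
Qed.

Lemma int_L2 f : cmeas f -> mu.-integrable setT (EFin \o (fun x => sqc (f x))) ->
  L2 f.
Proof.
move=> mf /integrableP[_ h]; apply/L2P; split => //; move: h.
congr (_ < +oo)%E; apply: eq_integral => x _ /=.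
by rewrite ger0_norm// sqc_ge0.
Qed.

Lemma ae_le_integrable (a b : R -> R) : measurable_fun setT a ->
  mu.-integrable setT (EFin \o b) ->
  {ae mu, forall x, `|a x| <= b x} -> mu.-integrable setT (EFin \o a).
Proof.
move=> ma ib ab; apply/integrableP; split; first exact/measurable_EFinP.
have mb := measurable_int _ ib; move/integrableP: ib => [_]; apply: le_lt_trans.
apply: ae_ge0_le_integral => //.
- by apply: measurableT_comp => //; exact/measurable_EFinP.
- by apply: measurableT_comp.
by apply: ae_imp ab => x h _ /=; rewrite lee_fin (le_trans h)// ler_norm.
Qed.

(** Replacing b by the maximum of a and b turns the almost-everywhere inequality
into one that holds everywhere. *)
Lemma ae_le_Rintegral (a b : R -> R) :
  mu.-integrable setT (EFin \o a) -> mu.-integrable setT (EFin \o b) ->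
  (forall x, 0 <= a x) ->
  {ae mu, forall x, a x <= b x} -> \int[mu]_x a x <= \int[mu]_x b x.
Proof.
move=> ia ib a0 ab.
pose c x := Num.max (a x) (b x).
have mc : measurable_fun setT c.
  by apply: measurable_maxr; apply/measurable_EFinP;
    [exact: (measurable_int _ ia)|exact: (measurable_int _ ib)].
have e : ae_eq mu setT (EFin \o b) (EFin \o c).
  by apply: ae_imp ab => x h _ /=; rewrite /c max_r.
rewrite [leRHS](_ : _ = \int[mu]_x c x); last first.
  rewrite /Rintegral; congr fine; apply: ae_eq_integral => //.
    exact: (measurable_int _ ib).
  exact/measurable_EFinP.
apply: le_Rintegral => //; last by move=> x _; rewrite /c le_max lexx.
apply: (@ae_le_integrable c (fun x => `|b x|)) => //.
  have /integrable_norm := ib; exact.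
apply: ae_imp ab => x h; rewrite /c max_r// .
Qed.

Lemma L2_le f (b : R -> R) : cmeas f -> mu.-integrable setT (EFin \o b) ->
  {ae mu, forall x, sqc (f x) <= b x} -> L2 f /\ L2sq f <= \int[mu]_x b x.
Proof.
move=> mf ib fb.
have lf : L2 f.
  apply: int_L2 => //; apply: ae_le_integrable ib _; first exact: cmeas_sqc.
  by apply: ae_imp fb => x; rewrite ger0_norm// sqc_ge0.
split => //; apply: ae_le_Rintegral => //; first exact: L2_int.
by move=> x; exact: sqc_ge0.
Qed.

Lemma integrable_scale (k : R) (b : R -> R) :
  mu.-integrable setT (EFin \o b) -> mu.-integrable setT (EFin \o (fun x => k * b x)).
Proof. by move=> /(integrableZl measurableT k); apply: eq_integrable. Qed.

Lemma L2_leK f g (K : R) : cmeas f -> L2 g ->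
  {ae mu, forall x, sqc (f x) <= K * sqc (g x)} -> L2 f /\ L2sq f <= K * L2sq g.
Proof.
move=> mf lg fg; rewrite /L2sq -RintegralZl//; last exact: L2_int.
by apply: L2_le => //; exact/integrable_scale/L2_int.
Qed.

Lemma L2_leD f g h (K1 K2 : R) : cmeas f -> L2 g -> L2 h ->
  {ae mu, forall x, sqc (f x) <= K1 * sqc (g x) + K2 * sqc (h x)} ->
  L2 f /\ L2sq f <= K1 * L2sq g + K2 * L2sq h.
Proof.
move=> mf lg lh fg.
have ig := integrable_scale K1 (L2_int lg).
have ih := integrable_scale K2 (L2_int lh).
rewrite /L2sq -!RintegralZl//; try exact: L2_int.
rewrite -RintegralD//.
apply: L2_le => //; apply: eq_integrable (integrableD _ ig ih) => //.
Qed.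

Lemma L2D f g : L2 f -> L2 g -> L2 (fun x => f x + g x).
Proof.
move=> lf lg; apply: proj1 (@L2_leD _ f g 2 2 _ lf lg _).
  by apply: cmeasD; exact: L2_cmeas.
by apply: aeW => x; exact: sqcD_le.
Qed.

Lemma L2sqD f g : L2 f -> L2 g -> L2sq (fun x => f x + g x) <= 2 * L2sq f + 2 * L2sq g.
Proof.
move=> lf lg; apply: proj2 (@L2_leD _ f g 2 2 _ lf lg _).
  by apply: cmeasD; exact: L2_cmeas.
by apply: aeW => x; exact: sqcD_le.
Qed.

Lemma L2N f : L2 f -> L2 (fun x => - f x).
Proof.
move=> lf; apply: proj1 (@L2_leK _ f 1 _ lf _); first exact/cmeasN/L2_cmeas.
by apply: aeW => x; rewrite sqcN mul1r.
Qed.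

Lemma L2sqN f : L2sq (fun x => - f x) = L2sq f.
Proof. by apply: eq_Rintegral => x _; rewrite sqcN. Qed.

Lemma L2B f g : L2 f -> L2 g -> L2 (fun x => f x - g x).
Proof. by move=> lf lg; apply: L2D => //; exact: L2N. Qed.

Lemma L2sqB f g : L2 f -> L2 g -> L2sq (fun x => f x - g x) <= 2 * L2sq f + 2 * L2sq g.
Proof. by move=> lf lg; rewrite -(L2sqN g); apply: L2sqD => //; exact: L2N. Qed.

Lemma L2Z z f : L2 f -> L2 (fun x => z * f x).
Proof.
move=> lf; apply: proj1 (@L2_leK _ f (sqc z) _ lf _).
  by apply: cmeasM; [exact: cmeas_cst|exact: L2_cmeas].
by apply: aeW => x; rewrite sqcM.
Qed.

Lemma L2sqZ z f : L2 f -> L2sq (fun x => z * f x) = sqc z * L2sq f.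
Proof.
move=> lf; rewrite /L2sq -RintegralZl//; last exact: L2_int.
by apply: eq_Rintegral => x _; rewrite sqcM.
Qed.

Lemma L2sq_ge0 f : 0 <= L2sq f.
Proof. by apply: Rintegral_ge0 => x _; exact: sqc_ge0. Qed.

Lemma aeeq_sym f g : aeeq f g -> aeeq g f.
Proof. by apply: ae_imp => x ->. Qed.

Lemma aeeq_trans f g h : aeeq f g -> aeeq g h -> aeeq f h.
Proof. by apply: ae_imp2 => x -> ->. Qed.

Lemma aeeq_refl f : aeeq f f.
Proof. exact: aeW. Qed.

Lemma L2sq_ae f g : cmeas f -> cmeas g -> aeeq f g -> L2sq f = L2sq g.
Proof.
move=> mf mg fg; rewrite /L2sq /Rintegral; congr fine.
apply: ae_eq_integral => //.
- by apply/measurable_EFinP; exact: cmeas_sqc.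
- by apply/measurable_EFinP; exact: cmeas_sqc.
by apply: ae_imp fg => x -> _.
Qed.

Lemma L2_ae f g : cmeas g -> aeeq f g -> L2 f -> L2 g.
Proof.
move=> mg fg lf; apply: proj1 (@L2_leK _ f 1 _ lf _) => //.
by apply: ae_imp fg => x ->; rewrite mul1r.
Qed.

Lemma L2sq_eq0 f : L2 f -> L2sq f = 0 -> aeeq f (fun=> 0).
Proof.
move=> lf; have := L2_int lf => /[dup] /integrable_fin_num i0 /measurable_int m f0.
have : (\int[mu]_x `|(sqc (f x))%:E|)%E = 0%E.
  transitivity (\int[mu]_x (sqc (f x))%:E)%E.
    by apply: eq_integral => x _; rewrite /= ger0_norm// sqc_ge0.
  by rewrite -(fineK (i0 measurableT)); congr EFin.
move/(ae_eq_integral_abs _ measurableT) => /(_ m).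
by apply: ae_imp => x /(_ I) [] /sqc_eq0.
Qed.

Lemma L2sqB_eq0 f g : L2 f -> L2 g -> L2sq (fun x => f x - g x) = 0 -> aeeq f g.
Proof.
move=> lf lg /(L2sq_eq0 (L2B lf lg)); apply: ae_imp => x /eqP.
by rewrite subr_eq0 => /eqP.
Qed.

Lemma L2sq0 : L2sq (fun=> 0 : R[i]) = 0.
Proof. by rewrite /L2sq (_ : (fun _ => _) = cst 0) ?Rintegral_cst ?mul0r//; apply/funext=> x; rewrite sqc0. Qed.

(** The real part of the Hermitian product, which is all that the polarization
arguments need. *)
Definition L2dot f g : R :=
  \int[mu]_x (complex.Re (f x) * complex.Re (g x) + complex.Im (f x) * complex.Im (g x)).

Lemma L2dot_int f g : L2 f -> L2 g -> mu.-integrable setT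
  (EFin \o (fun x => complex.Re (f x) * complex.Re (g x) + complex.Im (f x) * complex.Im (g x))).
Proof.
move=> lf lg; have [[mf mf'] [mg mg']] := (L2_cmeas lf, L2_cmeas lg).
apply: (@ae_le_integrable _ (fun x => sqc (f x) + sqc (g x))).
- by apply: measurable_funD; exact: measurable_funM.
- by apply: eq_integrable (integrableD _ (L2_int lf) (L2_int lg)).
apply: aeW => x; rewrite /sqc ler_norml; move: (f x) (g x) => [a b] [c d] /=.
have := sqr_ge0 (a - c); have := sqr_ge0 (b - d).
have := sqr_ge0 (a + c); have := sqr_ge0 (b + d) => h1 h2 h3 h4.
by apply/andP; split; nra.
Qed.

Lemma L2sqD_eq f g : L2 f -> L2 g ->
  L2sq (fun x => f x + g x) = L2sq f + 2 * L2dot f g + L2sq g.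
Proof.
move=> lf lg; have [[i1 i2] i3] := (L2_int lf, L2dot_int lf lg, L2_int lg).
rewrite /L2sq /L2dot -RintegralZl// -RintegralD//; last exact: integrable_scale.
rewrite -RintegralD//; last first.
  by apply: eq_integrable (integrableD _ i1 (integrable_scale 2 i2)).
by apply: eq_Rintegral => x _; rewrite /sqc !ReImE; ring.
Qed.

Lemma L2dotNr f g : L2 f -> L2 g -> L2dot f (fun x => - g x) = - L2dot f g.
Proof.
move=> lf lg; rewrite -mulN1r /L2dot -RintegralZl//; last exact: L2dot_int.
by apply: eq_Rintegral => x _; rewrite !ReImE; ring.
Qed.

Lemma L2sqB_eq f g : L2 f -> L2 g ->
  L2sq (fun x => f x - g x) = L2sq f - 2 * L2dot f g + L2sq g.
Proof.
by move=> lf lg; rewrite L2sqD_eq// ?L2dotNr ?L2sqN ?mulrN//; exact: L2N.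
Qed.

Lemma L2dotDr f g h : L2 f -> L2 g -> L2 h ->
  L2dot f (fun x => g x + h x) = L2dot f g + L2dot f h.
Proof.
move=> lf lg lh; rewrite /L2dot -RintegralD//; try exact: L2dot_int.
by apply: eq_Rintegral => x _; rewrite !ReImE; ring.
Qed.

Lemma L2dotC f g : L2dot f g = L2dot g f.
Proof. by apply: eq_Rintegral => x _; ring. Qed.

Lemma L2dot_sqr_le f g : L2 f -> L2 g -> L2dot f g ^+ 2 <= L2sq f * L2sq g.
Proof.
move=> lf lg.
have h t : 0 <= L2sq f + 2 * t * L2dot f g + t ^+ 2 * L2sq g.
  have l := L2Z t%:C lg; have := L2sq_ge0 (fun x => f x + t%:C * g x).
  rewrite L2sqD_eq// L2sqZ// sqc_real (_ : L2dot _ _ = t * L2dot f g); first by rewrite mulrA.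
  rewrite /L2dot -RintegralZl//; last exact: L2dot_int.
  by apply: eq_Rintegral => x _; rewrite !ReImE; ring.
have [g0|g0] := eqVneq (L2sq g) 0.
  rewrite g0 mulr0; have [->|d0] := eqVneq (L2dot f g) 0; first by rewrite expr0n.
  have := h (- (L2sq f + 1) / (2 * L2dot f g)); rewrite g0 mulr0 addr0.
  rewrite (_ : 2 * _ * _ = - (L2sq f + 1)); first by move=> ?; lra.
  by field.
have gp : 0 < L2sq g by rewrite lt_neqAle eq_sym g0 L2sq_ge0.
have := h (- L2dot f g / L2sq g).
rewrite (_ : _ + _ = L2sq f - L2dot f g ^+ 2 / L2sq g); last by field.
by rewrite subr_ge0 ler_pdivrMr.
Qed.
End L2.

(** * Completeness of L^2 *)

Section Completeness.
Context {R : realType}.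
Local Notation mu := (@lebesgue_measure R).
Implicit Types (f g h : cfun R) (z : R[i]).

Lemma limn_einf_le (u : nat -> \bar R) (K : \bar R) :
  (\forall n \near \oo, (u n <= K)%E) -> (limn_einf u <= K)%E.
Proof.
move=> [N _ h]; rewrite limn_einf_lim; apply: lime_le.
  exact: is_cvg_einfs.
near=> n; apply: (@le_trans _ _ (u (n + N)%N)).
  by apply: ereal_inf_lbound; exists (n + N)%N => //=; rewrite leq_addr.
by apply: h => /=; rewrite leq_addl.
Unshelve. all: by end_near. Qed.

(** The form in which Fatou's lemma is used: a bound on the integrals passes to
the almost-everywhere limit. *)
Lemma fatou_bound (F : nat -> R -> R) (G : R -> R) (K : \bar R) :
  (forall n, measurable_fun setT (F n)) -> measurable_fun setT G ->
  (forall n x, 0 <= F n x) -> (forall x, 0 <= G x) ->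
  {ae mu, forall x, F n x @[n --> \oo] --> G x} ->
  (\forall n \near \oo, (\int[mu]_x (F n x)%:E <= K)%E) ->
  (\int[mu]_x (G x)%:E <= K)%E.
Proof.
move=> mF mG F0 G0 FG FK.
have mEF n : measurable_fun setT (fun x => (F n x)%:E) by apply/measurable_EFinP; exact: mF.
apply: le_trans (limn_einf_le FK).
have := @fatou _ _ _ mu setT measurableT (fun n x => (F n x)%:E) mEF
  (fun n x _ => F0 n x).
apply: le_trans; apply: ae_ge0_le_integral => //.
- by move=> x _; rewrite lee_fin.
- exact/measurable_EFinP.
- move=> x _; rewrite limn_einf_lim; apply: lime_ge; first exact: is_cvg_einfs.
  by near=> n; apply: le_ereal_inf_tmp => _ [m _ <-]; rewrite lee_fin.
- apply: (eq_measurable_fun (fun x => - limn_esup (fun n => (- (F n x)%:E)))%E).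
    by move=> x _; rewrite (limn_esupN (fun n => (F n x)%:E)) oppeK.
  apply: measurableT_comp => //; apply: measurable_fun_limn_esup => n.
  exact: measurableT_comp.
apply: ae_imp FG => x h _.
have /cvg_limn_einf_sup[-> _] : (F n x)%:E @[n --> \oo] --> (G x)%:E.
  by apply: cvg_EFin h; exact: nearW.
exact: lexx.
Unshelve. all: by end_near. Qed.

Lemma cvg_sqc (w : nat -> R[i]) z :
  complex.Re (w n) @[n --> \oo] --> complex.Re z ->
  complex.Im (w n) @[n --> \oo] --> complex.Im z ->
  sqc (w n) @[n --> \oo] --> sqc z.
Proof. by move=> cr ci; apply: cvgD; rewrite expr2; under eq_fun do rewrite expr2; apply: cvgM. Qed.

Lemma cvg_shift_add N (w : nat -> R) (l : R) :
  w n @[n --> \oo] --> l -> w (n + N)%N @[n --> \oo] --> l.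
Proof. by move=> wl; have := wl; rewrite -(cvg_shiftn N). Qed.

(** The increments are dominated by a geometric series of ratio 2^(-1/2). *)
Lemma cauchy_series_cvg (v : nat -> R) (M : R) : 0 <= M ->
  (forall k, (v k.+1 - v k) ^+ 2 <= M * 2^-1 ^+ k) -> cvgn v.
Proof.
move=> M0 h.
pose q : R := Num.sqrt 2^-1.
have q0 : 0 <= q by exact: sqrtr_ge0.
have q2 : q ^+ 2 = 2^-1 by rewrite sqr_sqrtr// invr_ge0.
have q1 : q < 1 by rewrite -(@ltr_pXn2r _ 2)// ?nnegrE// expr1n q2 invf_lt1// ltr1n.
have c : cvgn (series (telescope v)).
  apply: normed_cvg.
  apply: (@series_le_cvg _ _ (geometric (Num.sqrt M) q)).
  - by move=> n; exact: normr_ge0.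
  - by move=> n; rewrite /geometric /= mulr_ge0// ?sqrtr_ge0 ?exprn_ge0.
  - move=> n; rewrite /geometric /telescope /=.
    rewrite -[leLHS]ger0_norm// -sqrtr_sqr -[leRHS]ger0_norm ?mulr_ge0 ?sqrtr_ge0 ?exprn_ge0//.
    rewrite -[leRHS]sqrtr_sqr ler_sqrt ?sqr_ge0// real_normK ?num_real//.
    by rewrite exprMn sqr_sqrtr// -exprM mulnC exprM q2.
  - by apply: is_cvg_geometric_series; rewrite ger0_norm.
rewrite (_ : v = (fun n => v 0%N + series (telescope v) n)); last first.
  by apply/funext => n; rewrite -eq_sum_telescope.
by apply: is_cvgD => //; exact: is_cvg_cst.
Qed.

(** Riesz-Fischer: a subsequence with rapidly decreasing increments converges
almost everywhere, and Fatou's lemma identifies its limit as the limit in mean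
of the whole sequence. *)
Lemma L2_complete (u : nat -> cfun R) : (forall n, L2 (u n)) ->
  (forall e, 0 < e -> exists N, forall m n, (N <= m)%N -> (N <= n)%N ->
     L2sq (fun x => u m x - u n x) <= e) ->
  exists g, L2 g /\ L2sq (fun x => u n x - g x) @[n --> \oo] --> (0 : R).
Proof.
move=> lu cu.
(* With increments of squared norm at most e k along the subsequence, the sum of
   2^k times their squared moduli is integrable. *)
pose e k : R := (2 ^+ k.+1 * 2 ^+ k)^-1.
have e0 k : 0 < e k by rewrite invr_gt0 mulr_gt0// exprn_gt0.
have [phi phiP] := choice (fun k => cu (e k) (e0 k)).
pose nk k := maxn k (\max_(j < k.+1) phi j)%N.
have nk1 k : (phi k <= nk k)%N.
  by rewrite leq_max; apply/orP; right; exact: (leq_bigmax (@ord_max k)).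
have nkk k : (k <= nk k)%N by rewrite leq_maxl.
have nkS k : (nk k <= nk k.+1)%N.
  rewrite /nk geq_max; apply/andP; split; first by rewrite leq_max leqnSn.
  by rewrite [X in maxn _ X]big_ord_recr/= !leq_max leqnn !orbT.
pose v k := u (nk k).
have lv k : L2 (v k) by exact: lu.
pose d k x := v k.+1 x - v k x.
have ld k : L2 (d k) by exact: L2B.
have dN k : L2sq (d k) <= e k by apply: phiP => //; exact: leq_trans (nkS k).
have mv k := L2_cmeas (lv k).
have md k := L2_cmeas (ld k).
pose T k x : \bar R := (2 ^+ k * sqc (d k x))%:E.
have T0 k x : (0 <= T k x)%E by rewrite lee_fin mulr_ge0 ?exprn_ge0 ?sqc_ge0.
have mT k : measurable_fun setT (T k).
  apply/measurable_EFinP; apply: measurable_funM => //; exact: cmeas_sqc.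
have iS : (\int[mu]_x (\sum_(k <oo) T k x) < +oo)%E.
  rewrite integral_nneseries//.
  apply: (@le_lt_trans _ _ (\sum_(k <oo) (1 / (2 ^ (k + 1))%:R)%:E)%E); last first.
    have /cvg_lim -> // := @cvg_geometric_eseries_half R 1 0.
    by rewrite ltry.
  apply: lee_nneseries => [k *|k *]; first by apply: integral_ge0 => x _; exact: T0.
  have /fineK <- : (\int[mu]_x T k x)%E \is a fin_num.
    apply: integrable_fin_num => //; exact: integrable_scale (L2_int (ld k)).
  rewrite lee_fin -/(Rintegral mu setT (fun x => 2 ^+ k * sqc (d k x))).
  rewrite RintegralZl//; last exact: L2_int.
  rewrite -ler_pdivlMl ?exprn_gt0// (le_trans (dN k))// /e addn1 natrX.
  by rewrite div1r invfM mulrC.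
have aeS : {ae mu, forall x, (\sum_(k <oo) T k x < +oo)%E}.
  have : mu.-integrable setT (fun x => \sum_(k <oo) T k x)%E.
    apply/integrableP; split; first by apply: (ge0_emeasurable_sum (P := xpredT)) => // *; exact: mT.
    move: iS; congr (_ < +oo)%E; apply: eq_integral => x _.
    by rewrite gee0_abs// nneseries_ge0.
  move/integrable_ae => /(_ measurableT); apply: ae_imp => x /(_ I).
  by rewrite ge0_fin_numE// nneseries_ge0.
have aec : {ae mu, forall x, cvgn (fun k => complex.Re (v k x)) /\
                             cvgn (fun k => complex.Im (v k x))}.
  apply: ae_imp aeS => x Sx.
  have S0 : (0 <= \sum_(k <oo) T k x)%E by exact: nneseries_ge0.
  have h k : sqc (d k x) <= fine (\sum_(k <oo) T k x)%E * 2^-1 ^+ k.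
    rewrite exprVn ler_pdivlMr ?exprn_gt0// mulrC -lee_fin fineK ?ge0_fin_numE//.
    have := @nneseries_lim_ge R (T ^~ x) xpredT 0%N k.+1 (fun n _ _ => T0 n x).
    by apply: le_trans; rewrite big_nat_recr//= leeDr// sume_ge0.
  split; apply: (@cauchy_series_cvg _ (fine (\sum_(k <oo) T k x)%E)); rewrite ?fine_ge0// => k.
    by apply: le_trans (h k); rewrite /sqc /d !ReImE lerDl sqr_ge0.
  by apply: le_trans (h k); rewrite /sqc /d !ReImE lerDr sqr_ge0.
(* Upper limits are measurable and agree with the limits where these exist. *)
pose gr x := fine (limn_esup (fun k => (complex.Re (v k x))%:E)).
pose gi x := fine (limn_esup (fun k => (complex.Im (v k x))%:E)).
pose g x : R[i] := gr x +i* gi x.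
have mg : cmeas g.
  split; apply: (measurableT_comp (fine_measurable measurableT));
    apply: measurable_fun_limn_esup => k; apply/measurable_EFinP; exact: (mv k).1 || exact: (mv k).2.
have limE (w : nat -> R) : cvgn w -> w n @[n --> \oo] --> fine (limn_esup (fun k => (w k)%:E)).
  move=> cw; have /cvg_limn_einf_sup[_ ->] : (w k)%:E @[k --> \oo] --> (limn w)%:E.
    by apply: cvg_EFin cw; exact: nearW.
  exact: cw.
have vg : {ae mu, forall x, complex.Re (v k x) @[k --> \oo] --> gr x /\
                            complex.Im (v k x) @[k --> \oo] --> gi x}.
  by apply: ae_imp aec => x [c1 c2]; split; exact: limE.
have key ep N : 0 < ep -> (forall m n, (N <= m)%N -> (N <= n)%N ->
     L2sq (fun x => u m x - u n x) <= ep) -> (forall k, (N <= k)%N ->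
     (\int[mu]_x (sqc (u k x - g x))%:E <= ep%:E)%E).
  move=> ep0 hN k Nk.
  apply: (@fatou_bound (fun j x => sqc (u k x - v (j + N)%N x))).
  - by move=> n; apply: cmeas_sqc; apply: L2_cmeas; exact: L2B.
  - by apply: cmeas_sqc; apply: cmeasD; [exact: L2_cmeas|exact: cmeasN].
  - by move=> *; exact: sqc_ge0.
  - by move=> *; exact: sqc_ge0.
  - apply: ae_imp vg => x [cr ci].
    have cr' := @cvg_shift_add N _ _ cr; have ci' := @cvg_shift_add N _ _ ci.
    apply: (@cvg_sqc (fun n => u k x - v (n + N)%N x)).
      under eq_fun do rewrite !ReImE; rewrite !ReImE /=.
      by apply: cvgB; [exact: cvg_cst|exact: cr'].
    under eq_fun do rewrite !ReImE; rewrite !ReImE /=.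
    by apply: cvgB; [exact: cvg_cst|exact: ci'].
  - apply: nearW => j.
    have lkj := L2B (lu k) (lv (j + N)%N).
    rewrite -(fineK (integrable_fin_num measurableT (L2_int lkj))) lee_fin.
    by apply: hN => //; rewrite (leq_trans _ (nkk _))// leq_addl.
have lug n : L2 (fun x => u n x - g x) -> L2 g.
  move=> lun; have := L2B (lu n) lun; apply: L2_ae => //.
  by apply: aeW => x; rewrite opprB addrC subrK.
have mug n : cmeas (fun x => u n x - g x).
  by apply: cmeasD; [exact: L2_cmeas|exact: cmeasN].
have lg : L2 g.
  have [N hN] := cu 1 ltr01; apply: (lug N); apply/L2P; split => //.
  by rewrite (le_lt_trans (key 1 N ltr01 hN N (leqnn N)))// ltry.
exists g; split => //; apply/cvgrPdist_le => ep ep0.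
have [N hN] := cu _ ep0; exists N => // k /= Nk.
rewrite sub0r normrN ger0_norm ?L2sq_ge0// -lee_fin /L2sq /Rintegral fineK.
  exact: (key ep N).
by apply: integrable_fin_num => //; apply: L2_int; exact: L2B.
Qed.
End Completeness.

(** * Integrals over the line *)

Section ChangeOfVariable.
Context {R : realType}.
Local Notation mu := (@lebesgue_measure R).

Lemma ge0_integral_opp (f : R -> \bar R) : measurable_fun setT f ->
  (forall x, (0 <= f x)%E) -> (\int[mu]_x f (- x)%R = \int[mu]_x f x)%E.
Proof.
move=> mf f0.
rewrite -[LHS](@ge0_integral_pushforward _ _ (measurableTypeR R) (measurableTypeR R) R (-%R : _ -> measurableTypeR R) _ mu setT f)//.
apply: eq_measure_integral => A mA _; exact: lebesgue_measureN.
Qed.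

Lemma ge0_integral_scale (a : R) (f : R -> \bar R) : 0 < a ->
  measurable_fun setT f -> (forall x, (0 <= f x)%E) ->
  (\int[mu]_x f (a * x)%R = a^-1%:E * \int[mu]_x f x)%E.
Proof.
move=> a0 mf f0.
have ma : @measurable_fun _ _ (measurableTypeR R) (measurableTypeR R) setT (fun x : R => a * x).
  exact: measurable_funM.
pose sc : {mfun measurableTypeR R >-> measurableTypeR R} := HB.pack (fun x : R => a * x)
  (isMeasurableFun.Build _ _ (measurableTypeR R) (measurableTypeR R) (fun x => a * x) ma).
pose p := NngNum (ltW a0).
have key A : measurable A -> (mu A = mscale p (pushforward mu sc) A)%E.
  apply: lebesgue_measure_unique => // _ [[c d]] _ <-.
  pose I := `]c / a, d / a]%classic.
  have pre : (fun x : R => a * x) @^-1` `]c, d]%classic = I.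
    by apply/seteqP; split=> x; rewrite /I /= !in_itv/= ltr_pdivrMr// ler_pdivlMr// [x * a]mulrC.
  transitivity (a%:E * mu I)%E; last by rewrite -pre.
  rewrite /I !lebesgue_measure_itv /= !lte_fin ltr_pM2r ?invr_gt0//.
  case: ifPn => _; last by rewrite mule0.
  by rewrite -!EFinB -EFinM -mulrBl mulrC mulfVK// gt_eqF.
have p0 : (0 <= a^-1) by rewrite invr_ge0 ltW.
transitivity (\int[pushforward mu sc]_x f x)%E.
  by rewrite (ge0_integral_pushforward ma).
rewrite -(@ge0_integral_mscale _ _ _ mu setT measurableT (NngNum p0) f)//.
apply: eq_measure_integral => A mA _.
transitivity (a^-1%:E * mu A)%E; last by [].
rewrite (key ma A mA) /mscale /=.
by rewrite muleA -EFinM mulVf ?mul1e// gt_eqF.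
Qed.

Lemma lorentz_int : mu.-integrable setT (EFin \o (fun x : R => (1 + x ^+ 2)^-1)).
Proof.
have g0 (x : R) : 0 <= (1 + x ^+ 2)^-1 by rewrite invr_ge0 addr_ge0 ?sqr_ge0.
have cg : continuous (fun x : R => (1 + x ^+ 2)^-1) by exact: continuous_oneDsqrV.
apply/integrableP; split.
  by apply/measurable_EFinP; exact: continuous_measurable_fun.
have -> : (\int[mu]_x `|(EFin \o (fun x : R => (1 + x ^+ 2)^-1)%R) x| =
  \int[mu]_x ((1 + x ^+ 2)^-1)%R%:E)%E.
  by apply: eq_integral => x _ /=; rewrite ger0_norm.
rewrite ge0_symfun_integralT//; last by move=> x /=; rewrite sqrrN.
rewrite -set_itvcy; have := integral0y_oneDsqr; rewrite /oneDsqr => ->.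
by rewrite ltry.
Qed.
End ChangeOfVariable.

(** * Bounds for sine and cosine *)

Section Trig.
Context {R : realType}.
Implicit Types x : R.

Lemma sin_abs_le x : `|sin x| <= `|x|.
Proof.
wlog x0 : x / 0 <= x.
  move=> h; have [|/ltW x0] := leP 0 x; first exact: h.
  by rewrite -normrN -sinN -[leRHS]normrN; apply: h; rewrite oppr_ge0.
have [->|xn0] := eqVneq x 0; first by rewrite sin0.
have xp : 0 < x by rewrite lt_neqAle eq_sym xn0.
have [c _] := @MVT _ sin cos 0 x xp (fun c _ => is_derive_sin c)
  (continuous_subspaceT (fun y => @continuous_sin _ y)).
rewrite sin0 !subr0 => ->; rewrite normrM ler_piMl//; exact: cos_max.
Qed.

Lemma one_sub_cos x : 1 - cos x = 2 * sin (x / 2) ^+ 2.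
Proof.
have {1}-> : x = x / 2 + x / 2 by field.
by rewrite cosD -!expr2 cos2sin2; ring.
Qed.

Lemma one_sub_cos_ge0 x : 0 <= 1 - cos x.
Proof. by rewrite subr_ge0 cos_le1. Qed.

Lemma one_sub_cos_le x : 1 - cos x <= x ^+ 2 / 2.
Proof.
rewrite one_sub_cos -(real_normK (num_real (sin _))).
have := sin_abs_le (x / 2); rewrite normrM [`|2^-1|]ger0_norm// => h.
have : `|sin (x / 2)| ^+ 2 <= (`|x| / 2) ^+ 2 by rewrite ler_pXn2r// nnegrE ?divr_ge0.
have -> : (`|x| / 2) ^+ 2 = x ^+ 2 / 4 by rewrite -[x ^+ 2]real_normK ?num_real//; field.
by move=> ?; lra.
Qed.

Lemma sin_div_cvg : (h^-1 * sin h) @[h --> (0 : R)^'] --> (1 : R).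
Proof.
have := @is_derive_sin R 0; case=> d e.
have : (fun h : R => h^-1 *: (sin (h *: 1 + 0) - sin 0)) @ 0^' --> 'D_1 sin (0 : R) by exact: d.
rewrite e cos0; under eq_fun do rewrite sin0 subr0 addr0.
by under eq_fun do rewrite /GRing.scale /= mulr1.
Qed.

End Trig.

(** * The Fejer and triangle kernels *)

Section Kernel.
Context {R : realType}.
Local Notation mu := (@lebesgue_measure R).
Implicit Types (t z e x y : R).

(** Inversion is the pointwise limit of x / (x^2 + 1/n), also at 0, where the
inverse is 0. *)
Lemma measurable_inv : measurable_fun setT (fun x : R => x^-1).
Proof.
apply: (@measurable_fun_cvg _ _ _ _ (fun n x => x * (x ^+ 2 + n.+1%:R^-1)^-1)).
  move=> n; apply: continuous_measurable_fun => x; apply: cvgM; first exact: cvg_id.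
  apply: cvgV; first by rewrite gt_eqF// ltr_wpDl ?sqr_ge0// invr_gt0 ltr0n.
  by apply: cvgD; [exact: exprn_continuous|exact: cvg_cst].
move=> x _; have [->|x0] := eqVneq x 0.
  by under eq_fun do rewrite mul0r; rewrite invr0; exact: cvg_cst.
have -> : x^-1 = x * (x ^+ 2 + 0)^-1 by rewrite addr0 expr2; field.
apply: cvgM; first exact: cvg_cst.
apply: cvgV; first by rewrite addr0 sqrf_eq0.
by apply: cvgD; [exact: cvg_cst|exact: cvg_harmonic].
Qed.

(** At x = 0 the value is 0, which is immaterial to the integral. *)
Definition cos_quot t x : R := (1 - cos (t * x)) / x ^+ 2.

Lemma cos_quot_ge0 t x : 0 <= cos_quot t x.
Proof. by rewrite divr_ge0 ?sqr_ge0// one_sub_cos_ge0. Qed.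

Lemma measurable_cosM t : measurable_fun setT (fun x => cos (t * x)).
Proof.
apply: continuous_measurable_fun => x.
by apply: continuous_comp; [exact: mulrl_continuous|exact: continuous_cos].
Qed.

Lemma measurable_sinM t : measurable_fun setT (fun x => sin (t * x)).
Proof.
apply: continuous_measurable_fun => x.
by apply: continuous_comp; [exact: mulrl_continuous|exact: continuous_sin].
Qed.

Lemma measurable_cos_quot t : measurable_fun setT (cos_quot t).
Proof.
apply: measurable_funM; first by apply: measurable_funB => //; exact: measurable_cosM.
apply: (eq_measurable_fun (fun x => (x ^-1) ^+ 2)); first by move=> x _; rewrite exprVn.
by apply: measurable_funX; exact: measurable_inv.
Qed.

Lemma cos_quot_le t x : cos_quot t x <= (t ^+ 2 / 2 + 2) * (1 + x ^+ 2)^-1.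
Proof.
have h0 := @one_sub_cos_ge0 R (t * x).
have p : 0 < 1 + x ^+ 2 by rewrite ltr_pwDl ?ltr01 ?sqr_ge0.
have [->|x0] := eqVneq x 0.
  by rewrite /cos_quot expr0n/= invr0 mulr0 addr0 invr1 mulr1 addr_ge0 ?divr_ge0 ?sqr_ge0.
have x2 : 0 < x ^+ 2 by rewrite lt_neqAle sqr_ge0 eq_sym sqrf_eq0 x0.
rewrite /cos_quot ler_pdivrMr// mulrAC ler_pdivlMr// mulrDr mulr1.
have h1 := @one_sub_cos_le R (t * x).
have h2 : 1 - cos (t * x) <= 2 by have := @cos_geN1 R (t * x); lra.
have := ler_wpM2r (ltW x2) h2; move: h1; rewrite exprMn; lra.
Qed.

Lemma cos_quot_int t : mu.-integrable setT (EFin \o cos_quot t).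
Proof.
apply: (ae_le_integrable (measurable_cos_quot t) (integrable_scale (t ^+ 2 / 2 + 2) lorentz_int)).
by apply: aeW => x; rewrite ger0_norm ?cos_quot_ge0 ?cos_quot_le.
Qed.

(** This integral equals pi; what the Plancherel identity requires is that it is
finite and positive. *)
Definition kappa : R := \int[mu]_x cos_quot 1 x.

(** Scaling x to t x pulls |t| out of the integral. *)
Lemma cos_quot_integral t : \int[mu]_x cos_quot t x = kappa * `|t|.
Proof.
wlog t0 : t / 0 <= t.
  move=> h; have [|/ltW t0] := leP 0 t; first exact: h.
  rewrite -normrN -h ?oppr_ge0//; apply: eq_Rintegral => x _.
  by rewrite /cos_quot mulNr cosN.
rewrite ger0_norm//; have [->|tn0] := eqVneq t 0.
  rewrite mulr0; transitivity (\int[mu]_x (cst (0:R)) x); last by rewrite Rintegral_cst ?mul0r.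
  by apply: eq_Rintegral => x _; rewrite /cos_quot mul0r cos0 subrr mul0r.
have tp : 0 < t by rewrite lt_neqAle eq_sym tn0.
transitivity (\int[mu]_x (t ^+ 2 * cos_quot 1 (t * x))).
  apply: eq_Rintegral => x _; rewrite /cos_quot mul1r exprMn.
  move: (cos _) => C; have [->|x0] := eqVneq x 0.
    by rewrite expr0n/= !(mulr0, invr0).
  by field; rewrite x0 tn0.
have eqE : (\int[mu]_x (cos_quot 1 (t * x))%:E = (t^-1 * kappa)%:E)%E.
  rewrite (@ge0_integral_scale _ t (fun x => (cos_quot 1 x)%:E))//.
  - by rewrite EFinM /kappa /Rintegral fineK//; exact: integrable_fin_num (cos_quot_int 1).
  - by apply/measurable_EFinP; exact: measurable_cos_quot.
  - by move=> x; rewrite lee_fin cos_quot_ge0.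
rewrite RintegralZl//; last first.
  apply/integrableP; split.
    apply/measurable_EFinP; apply: (measurableT_comp (measurable_cos_quot 1)).
    exact: measurable_funM.
  rewrite (_ : integral _ _ _ = (t^-1 * kappa)%:E) ?ltry// -eqE.
  by apply: eq_integral => x _ /=; rewrite ger0_norm ?cos_quot_ge0.
by rewrite /Rintegral eqE /= expr2 mulrA mulfK// mulrC.
Qed.

Lemma kappa_gt0 : 0 < kappa.
Proof.
have pi0 := @pi_gt0 R.
pose c : R := (pi ^+ 2)^-1.
have c0 : 0 < c by rewrite invr_gt0 exprn_gt0.
pose b : R -> R := fun x => c * \1_(`[pi / 2, pi]%classic) x.
have ib : mu.-integrable setT (EFin \o b).
  exact: integrable_scale (integrable_indic_itv (pi / 2) pi true false).
apply: (@lt_le_trans _ _ (\int[mu]_x b x)).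
  rewrite /b RintegralZl//; last exact: (integrable_indic_itv (pi / 2) pi true false).
  rewrite mulr_gt0// /Rintegral integral_indic// setIT.
  rewrite -[X in fine X]/(mu `[pi / 2, pi]%classic) lebesgue_measure_itv /=.
  by rewrite lte_fin ltr_pdivrMr// ltr_pMr// ltr1n /= subr_gt0 ltr_pdivrMr// ltr_pMr// ltr1n.
apply: le_Rintegral => //; first exact: cos_quot_int.
move=> x _; rewrite /b indicE; case: (boolP (x \in _)) => [|_]; last by rewrite mulr0 cos_quot_ge0.
rewrite inE /= in_itv/= => /andP[h1 h2]; rewrite mulr1 /cos_quot mul1r.
have x0 : 0 < x by apply: lt_le_trans h1; rewrite divr_gt0.
rewrite ler_pdivlMr ?exprn_gt0// (@le_trans _ _ 1)//.
  by rewrite mulrC ler_pdivrMr ?exprn_gt0// mul1r lerXn2r ?nnegrE// ltW.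
rewrite lerBrDr gerDl -[x](subrK (pi / 2)) cosDpihalf oppr_le0 sin_ge0_pi//.
by rewrite subr_ge0 h1 lerBlDr (le_trans h2)// lerDl divr_ge0// ltW.
Qed.

(** The Fejer kernel, normalized to tend to 1 as e tends to 0. *)
Definition fejer e x : R := 2 / e ^+ 2 * cos_quot e x.

(** The triangle of base [-e, e] and integral 1, written as a second difference of
the absolute value: this is the form in which it comes out of [cos_quot_integral]. *)
Definition tri e z : R := (`|z + e| + `|z - e| - 2 * `|z|) / (2 * e ^+ 2).

Lemma fejer_ge0 e x : 0 <= fejer e x.
Proof. by rewrite mulr_ge0 ?cos_quot_ge0// divr_ge0 ?sqr_ge0. Qed.

Lemma measurable_fejer e : measurable_fun setT (fejer e).
Proof. by apply: measurable_funM => //; exact: measurable_cos_quot. Qed.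

Lemma fejer_le1 e x : 0 < e -> fejer e x <= 1.
Proof.
move=> e0; have [->|x0] := eqVneq x 0.
  by rewrite /fejer /cos_quot expr0n/= invr0 !mulr0.
have x2 : 0 < x ^+ 2 by rewrite lt_neqAle sqr_ge0 eq_sym sqrf_eq0 x0.
rewrite /fejer /cos_quot mulrA ler_pdivrMr// mul1r mulrAC ler_pdivrMr ?exprn_gt0//.
by have := @one_sub_cos_le R (e * x); rewrite exprMn; lra.
Qed.

Lemma fejer_cvg x : x != 0 -> fejer n.+1%:R^-1 x @[n --> \oo] --> (1 : R).
Proof.
move=> x0; pose h n : R := n.+1%:R^-1 * x / 2.
have hn0 n : h n != 0 by rewrite /h !mulf_neq0 ?invr_eq0 ?pnatr_eq0.
have -> : (fun n => fejer n.+1%:R^-1 x) = (fun n => ((h n)^-1 * sin (h n)) ^+ 2).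
  apply/funext => n; rewrite /fejer /cos_quot one_sub_cos -/(h n).
  have : n.+1%:R != 0 :> R by rewrite pnatr_eq0.
  rewrite exprMn /h; move: (n.+1%:R : R) (sin _) => N s N0; field; by rewrite x0 N0.
have hc : h n @[n --> \oo] --> (0 : R)^'.
  move=> A [e /= e0 hA].
  have : h n @[n --> \oo] --> (0 : R).
    rewrite -(mul0r (x / 2)); under eq_fun do rewrite /h -mulrA.
    by apply: cvgM; [exact: cvg_harmonic|exact: cvg_cst].
  by move=> /cvgrPdist_lt/(_ _ e0); apply: filterS => n hh; apply: hA.
have : ((h n)^-1 * sin (h n)) @[n --> \oo] --> (1 : R).
  exact: cvg_comp sin_div_cvg.
move=> c; rewrite -(mulr1 1); under eq_fun do rewrite expr2; exact: cvgM.
Qed.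

Lemma tri_ge0 e z : 0 <= tri e z.
Proof.
apply: divr_ge0; last by rewrite mulr_ge0 ?sqr_ge0.
rewrite subr_ge0.
rewrite -[2]ger0_norm// -normrM (_ : 2 * z = (z + e) + (z - e)); last by ring.
exact: ler_normD.
Qed.

Lemma tri_out e z : 0 < e -> e <= `|z| -> tri e z = 0.
Proof.
move=> e0 h; rewrite /tri; suff -> : `|z + e| + `|z - e| - 2 * `|z| = 0 by rewrite mul0r.
have [z0|z0] := leP 0 z; move: h.
  rewrite (ger0_norm z0) => ez; rewrite !ger0_norm; lra.
rewrite (ltr0_norm z0) => ez; rewrite !ler0_norm; lra.
Qed.

Lemma tri_in e z : 0 < e -> `|z| <= e -> tri e z = (e - `|z|) / e ^+ 2.
Proof.
move=> e0; rewrite ler_norml => /andP[h1 h2]; rewrite /tri.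
rewrite (_ : `|z + e| = z + e); last by rewrite ger0_norm; lra.
rewrite (_ : `|z - e| = e - z); last by rewrite ler0_norm; lra.
by field; lra.
Qed.

Lemma tri_le e z : 0 < e -> tri e z <= e^-1.
Proof.
move=> e0; have [h|h] := leP `|z| e.
  rewrite tri_in// ler_pdivrMr ?exprn_gt0// expr2 mulrA mulVf ?mul1r ?gt_eqF//.
  by rewrite gerBl.
by rewrite tri_out ?ltW// invr_gt0.
Qed.

Lemma triN e z : tri e (- z) = tri e z.
Proof.
rewrite /tri normrN (_ : - z + e = - (z - e)) ?normrN; last by ring.
rewrite (_ : - z - e = - (z + e)) ?normrN; last by ring.
by rewrite [`|z - e| + _]addrC.
Qed.

(** A product of cosines is a sum of cosines; the constants cancel, so that the
right-hand side involves only the kernels whose integrals are known. *)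
Lemma fejer_cos e z x : 0 < e -> fejer e x * (1 + cos (z * x)) =
  2 / e ^+ 2 * (cos_quot e x - cos_quot z x + 2^-1 * cos_quot (z + e) x + 2^-1 * cos_quot (z - e) x).
Proof. move=> e0; rewrite /fejer /cos_quot (_ : (z + e) * x = z * x + e * x); last by ring.
rewrite (_ : (z - e) * x = z * x - e * x); last by ring.
by rewrite cosD cosB; move: ((x ^+ 2)^-1) (2 / e ^+ 2) => X E; field.
Qed.

(** Up to a constant, the triangle is the Fourier transform of the Fejer kernel.
The summand 1 makes the integrand nonnegative, so that Tonelli's theorem can be
applied to double integrals built from it. *)
Lemma fejer_cos_int e z : 0 < e ->
  mu.-integrable setT (EFin \o (fun x => fejer e x * (1 + cos (z * x)))) /\
  \int[mu]_x (fejer e x * (1 + cos (z * x))) = 2 * kappa * (e^-1 + tri e z).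
Proof.
move=> e0; under eq_fun do rewrite fejer_cos//.
have i1 := cos_quot_int e; have i2 := cos_quot_int z.
have i3 := integrable_scale 2^-1 (cos_quot_int (z + e)).
have i4 := integrable_scale 2^-1 (cos_quot_int (z - e)).
have i12 : mu.-integrable setT (EFin \o (fun x => cos_quot e x - cos_quot z x)).
  by apply: eq_integrable (integrableB _ i1 i2).
have i123 : mu.-integrable setT (EFin \o (fun x => cos_quot e x - cos_quot z x + 2^-1 * cos_quot (z + e) x)).
  by apply: eq_integrable (integrableD _ i12 i3).
have i : mu.-integrable setT (EFin \o (fun x => cos_quot e x - cos_quot z x + 2^-1 * cos_quot (z + e) x + 2^-1 * cos_quot (z - e) x)).
  by apply: eq_integrable (integrableD _ i123 i4).
split; first exact: integrable_scale.
rewrite RintegralZl// RintegralD// RintegralD// RintegralB// !RintegralZl ?cos_quot_int//.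
rewrite !cos_quot_integral (gtr0_norm e0) /tri; field; lra.
Qed.

Lemma tri_eql e z : 0 < e -> 0 <= z -> z <= e -> tri e z = (e - z) / e ^+ 2.
Proof. by move=> e0 z0 ze; rewrite tri_in ?ger0_norm. Qed.

Lemma continuous_tri e : continuous (tri e).
Proof.
move=> z; apply: cvgM; last exact: cvg_cst.
apply: cvgB; last by apply: cvgM; [exact: cvg_cst|apply: cvg_norm; exact: cvg_id].
apply: cvgD; apply: cvg_norm; [apply: cvgD|apply: cvgB]; (exact: cvg_id || exact: cvg_cst).
Qed.

Lemma tri_half e : 0 < e ->
  (\int[mu]_(z in `[0%R, +oo[) (tri e z)%:E = (2^-1)%:E)%E.
Proof.
move=> e0.
have -> : `[0%R, +oo[%classic = `[0, e]%classic `|` `]e, +oo[%classic :> set R.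
  by rewrite -itv_bndbnd_setU// bnd_simp ltW.
rewrite integral_setU//; last 2 first.
- apply/measurable_funTS/measurable_EFinP; exact: continuous_measurable_fun (continuous_tri (e:=e)).
- apply/disj_setPS => x [] /=; rewrite !in_itv/= => /andP[_ xe]; rewrite andbT => ex.
  by have := le_lt_trans xe ex; rewrite ltxx.
rewrite [X in (_ + X)%E](_ : _ = 0%E) ?adde0; last first.
  rewrite integral0_eq// => x /=; rewrite in_itv/= andbT => ex.
  by rewrite tri_out// ger0_norm ?ltW// (lt_trans e0).
have cF (x : R) : is_derive x 1 (fun x : R => (e * x - x ^+ 2 / 2) / e ^+ 2) ((e - x) / e ^+ 2).
  apply: is_derive_eq; rewrite /GRing.scale /=; field; lra.
rewrite (@continuous_FTC2 _ (tri e) (fun x => (e * x - x ^+ 2 / 2) / e ^+ 2))//.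
- rewrite -EFinB; congr EFin; field; lra.
- exact: continuous_subspaceT (continuous_tri (e:=e)).
- have c x : (fun x : R => (e * x - x ^+ 2 / 2) / e ^+ 2) x @[x --> x] --> (e * x - x ^+ 2 / 2) / e ^+ 2.
    have /derivable1_diffP/differentiable_continuous := @ex_derive _ _ _ _ _ _ _ (cF x).
    exact.
  split; [by move=> x _; have [] := cF x|exact: cvg_at_right_filter (c 0)|exact: cvg_at_left_filter (c e)].
move=> x; rewrite in_itv/= => /andP[x0 xe].
by rewrite derive1E tri_eql ?ltW//; have [_ ->] := cF x.
Qed.

Lemma ge0_integral_shift (a : R) (f : R -> \bar R) :
  measurable_fun setT f -> (forall x, (0 <= f x)%E) ->
  (\int[mu]_x f (x + a)%R = \int[mu]_x f x)%E.
Proof.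
move=> mf f0.
have ma : @measurable_fun _ _ (measurableTypeR R) (measurableTypeR R) setT (fun x : R => x + a).
  exact: measurable_funD.
pose sc : {mfun measurableTypeR R >-> measurableTypeR R} := HB.pack (fun x : R => x + a)
  (isMeasurableFun.Build _ _ (measurableTypeR R) (measurableTypeR R) (fun x => x + a) ma).
transitivity (\int[pushforward mu sc]_x f x)%E.
  by rewrite (ge0_integral_pushforward ma).
apply: eq_measure_integral => A mA _; apply/esym.
have key B : measurable B -> (mu B = pushforward mu sc B)%E.
  apply: lebesgue_measure_unique => // _ [[c d]] _ <-.
  pose I := `]c - a, d - a]%classic.
  have pre : (fun x : R => x + a) @^-1` `]c, d]%classic = I.
    by apply/seteqP; split=> x; rewrite /I /= !in_itv/= ltrBlDr lerBrDr.
  transitivity (mu I); last by rewrite -pre.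
  rewrite /I !lebesgue_measure_itv /= !lte_fin ltrD2r.
  by case: ifPn => // _; rewrite -!EFinB; congr EFin; ring.
exact: key.
Qed.

Lemma tri_integral e x : 0 < e -> (\int[mu]_y (tri e (x - y))%:E = 1)%E.
Proof.
move=> e0.
have mt : measurable_fun setT (fun z => (tri e z)%:E).
  by apply/measurable_EFinP; exact: continuous_measurable_fun (continuous_tri (e:=e)).
have t0 z : (0 <= (tri e z)%:E)%E by rewrite lee_fin tri_ge0.
have -> : (\int[mu]_y (tri e (x - y))%:E = \int[mu]_y (tri e (y + - x)%R)%:E)%E.
  by apply: eq_integral => y _; rewrite -triN opprB.
rewrite (@ge0_integral_shift _ (fun z => (tri e z)%:E))//.
rewrite ge0_symfun_integralT//.
- by rewrite -set_itvcy tri_half// -EFinM divff.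
- exact: continuous_tri.
- by move=> z /=; rewrite triN.
Qed.
End Kernel.

(** * The Plancherel identity for nonnegative functions *)

Section Transforms.
Context {R : realType}.
Local Notation mu := (@lebesgue_measure R).
Implicit Types (p u v : R -> R) (x y xi e : R).

Definition L1 p := mu.-integrable setT (EFin \o p).

Lemma L1_meas p : L1 p -> measurable_fun setT p.
Proof. by move=> /(measurable_int _) ?; apply/measurable_EFinP. Qed.

Lemma EFin_Rint p : L1 p -> (\int[mu]_x p x)%:E = (\int[mu]_x (p x)%:E)%E.
Proof. by move=> h; rewrite fineK//; exact: integrable_fin_num h. Qed.

Lemma L1_bdd p (k : R -> R) : L1 p -> measurable_fun setT k -> (forall x, `|k x| <= 1) ->
  L1 (fun x => p x * k x).
Proof.
move=> ip fejer k1; apply: (@ae_le_integrable _ _ (fun x => `|p x|)).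
- by apply: measurable_funM => //; exact: L1_meas.
- by have /integrable_norm := ip.
- by apply: aeW => x; rewrite normrM ler_piMr.
Qed.

Lemma RintZ (k : R) p : L1 p -> \int[mu]_x (k * p x) = k * \int[mu]_x p x.
Proof. exact: RintegralZl. Qed.

Lemma one_add_cos_ge0 x : 0 <= 1 + cos x.
Proof. by have := cos_geN1 x; lra. Qed.

Lemma L1D u v : L1 u -> L1 v -> L1 (fun x => u x + v x).
Proof. by move=> iu iv; apply: eq_integrable (integrableD _ iu iv). Qed.

Lemma L1B u v : L1 u -> L1 v -> L1 (fun x => u x - v x).
Proof. by move=> iu iv; apply: eq_integrable (integrableB _ iu iv). Qed.

Lemma measurable_cosMr xi : measurable_fun setT (fun x : R => cos (x * xi)).
Proof. by under eq_fun do rewrite mulrC; exact: measurable_cosM. Qed.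

Lemma measurable_sinMr xi : measurable_fun setT (fun x : R => sin (x * xi)).
Proof. by under eq_fun do rewrite mulrC; exact: measurable_sinM. Qed.

Lemma L1_cos p xi : L1 p -> L1 (fun x => p x * cos (x * xi)).
Proof.
by move=> ip; apply: L1_bdd => //; [exact: measurable_cosMr|move=> x; exact: cos_max].
Qed.

Lemma L1_sin p xi : L1 p -> L1 (fun x => p x * sin (x * xi)).
Proof.
by move=> ip; apply: L1_bdd => //; [exact: measurable_sinMr|move=> x; exact: sin_max].
Qed.

Definition Ct p xi : R := \int[mu]_x (p x * cos (x * xi)).
Definition St p xi : R := \int[mu]_x (p x * sin (x * xi)).

Lemma continuous_Ct p : L1 p -> continuous (Ct p).
Proof.
move=> ip xi.
apply: (@continuity_under_integral _ _ _ mu (fun xi x => p x * cos (x * xi)) setT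
  measurableT (xi - 1) (xi + 1) _ _ (fun x => `|p x|)).
- by move=> z _; exact: L1_cos.
- apply: aeW => x _ z _; apply: cvgM; first exact: cvg_cst.
  by apply: continuous_comp; [exact: mulrl_continuous|exact: continuous_cos].
- by have /integrable_norm := ip.
- by move=> z _; apply: aeW => x _; rewrite normrM ler_piMr// cos_max.
- by rewrite inE/= in_itv/=; apply/andP; split; lra.
Qed.

Lemma continuous_St p : L1 p -> continuous (St p).
Proof.
move=> ip xi.
apply: (@continuity_under_integral _ _ _ mu (fun xi x => p x * sin (x * xi)) setT
  measurableT (xi - 1) (xi + 1) _ _ (fun x => `|p x|)).
- by move=> z _; exact: L1_sin.
- apply: aeW => x _ z _; apply: cvgM; first exact: cvg_cst.
  by apply: continuous_comp; [exact: mulrl_continuous|exact: continuous_sin].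
- by have /integrable_norm := ip.
- by move=> z _; apply: aeW => x _; rewrite normrM ler_piMr// sin_max.
- by rewrite inE/= in_itv/=; apply/andP; split; lra.
Qed.

Lemma measurable_Ct p : L1 p -> measurable_fun setT (Ct p).
Proof. by move=> ip; apply: continuous_measurable_fun; exact: continuous_Ct. Qed.

Lemma measurable_St p : L1 p -> measurable_fun setT (St p).
Proof. by move=> ip; apply: continuous_measurable_fun; exact: continuous_St. Qed.

Definition Pt p : R := \int[mu]_x p x.

(** Integral of p(y) (1 + cos((x - y) xi)) in y, expanded by the addition theorem. *)
Definition Et p x xi : R := Pt p + cos (x * xi) * Ct p xi + sin (x * xi) * St p xi.

Lemma Et_int p x xi : L1 p -> L1 (fun y => p y * (1 + cos ((x - y) * xi))) /\
  \int[mu]_y (p y * (1 + cos ((x - y) * xi))) = Et p x xi.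
Proof.
move=> ip.
have -> : (fun y => p y * (1 + cos ((x - y) * xi))) =
  (fun y => p y + cos (x * xi) * (p y * cos (y * xi)) + sin (x * xi) * (p y * sin (y * xi))).
  by apply/funext => y; rewrite mulrBl cosB; ring.
have ic := integrable_scale (cos (x * xi)) (L1_cos xi ip).
have iS := integrable_scale (sin (x * xi)) (L1_sin xi ip).
split; first by apply: L1D => //; exact: L1D.
rewrite RintegralD//; last exact: L1D.
by rewrite RintegralD// !RintegralZl//; [exact: L1_sin|exact: L1_cos].
Qed.

Lemma Et_int2 p xi : L1 p -> L1 (fun x => p x * Et p x xi) /\
  \int[mu]_x (p x * Et p x xi) = Pt p ^+ 2 + Ct p xi ^+ 2 + St p xi ^+ 2.
Proof.
move=> ip.
have -> : (fun x => p x * Et p x xi) =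
  (fun y => Pt p * p y + Ct p xi * (p y * cos (y * xi)) + St p xi * (p y * sin (y * xi))).
  by apply/funext => y; rewrite /Et; ring.
have i1 := integrable_scale (Pt p) ip.
have ic := integrable_scale (Ct p xi) (L1_cos xi ip).
have iS := integrable_scale (St p xi) (L1_sin xi ip).
split; first by apply: L1D => //; exact: L1D.
rewrite RintegralD//; last exact: L1D.
by rewrite RintegralD// (RintZ _ ip) (RintZ _ (L1_cos xi ip)) (RintZ _ (L1_sin xi ip)) !expr2.
Qed.

Lemma Et_ge0 p x xi : L1 p -> (forall x, 0 <= p x) -> 0 <= Et p x xi.
Proof.
move=> ip p0; have [_ <-] := Et_int x xi ip; apply: Rintegral_ge0 => y _.
by rewrite mulr_ge0// -lerBlDl sub0r cos_geN1.
Qed.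

Lemma measurable2_cos : measurable_fun setT (fun z : R * R => cos (z.1 * z.2)).
Proof.
apply: (measurableT_comp (continuous_measurable_fun (@continuous_cos R))).
by apply: measurable_funM.
Qed.

Lemma measurable2_sin : measurable_fun setT (fun z : R * R => sin (z.1 * z.2)).
Proof.
apply: (measurableT_comp (continuous_measurable_fun (@continuous_sin R))).
by apply: measurable_funM.
Qed.

Lemma tonelli (f : R -> R -> R) :
  measurable_fun setT (fun z : R * R => f z.1 z.2) -> (forall x y, 0 <= f x y) ->
  (\int[mu]_x \int[mu]_y (f x y)%:E = \int[mu]_y \int[mu]_x (f x y)%:E)%E.
Proof.
move=> mf f0.
apply: (@fubini_tonelli _ _ (measurableTypeR R) (measurableTypeR R) R mu mu
  (fun z => (f z.1 z.2)%:E)).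
- by apply/measurable_EFinP.
- by move=> z; rewrite lee_fin.
Qed.

(** The factor next to the kernel is the double integral of
p(x) p(y) (1 + cos((x - y) xi)).  After exchanging the integrations, the
integral in xi is [fejer_cos_int]. *)
Lemma tonelli_kernel p e : L1 p -> (forall x, 0 <= p x) -> 0 < e ->
  (\int[mu]_xi (fejer e xi * (Pt p ^+ 2 + Ct p xi ^+ 2 + St p xi ^+ 2))%:E =
   \int[mu]_x \int[mu]_y (p x * p y * (2 * kappa * (e^-1 + tri e (x - y))))%:E)%E.
Proof.
move=> ip p0 e0; have mp := L1_meas ip.
have mc1 : measurable_fun setT (fun z : R * R => cos (z.2 * z.1)).
  by apply: (eq_measurable_fun (fun z : R * R => cos (z.1 * z.2))) measurable2_cos => z _; rewrite mulrC.
have ms1 : measurable_fun setT (fun z : R * R => sin (z.2 * z.1)).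
  by apply: (eq_measurable_fun (fun z : R * R => sin (z.1 * z.2))) measurable2_sin => z _; rewrite mulrC.
transitivity (\int[mu]_xi \int[mu]_x (fejer e xi * (p x * Et p x xi))%:E)%E.
  apply: eq_integral => xi _; have [i <-] := Et_int2 xi ip.
  by rewrite -RintegralZl// EFin_Rint//; exact: integrable_scale.
rewrite (@tonelli (fun xi x => fejer e xi * (p x * Et p x xi))); last 2 first.
- apply: measurable_funM.
    exact: (measurableT_comp (measurable_fejer e)).
  apply: measurable_funM; first exact: (measurableT_comp mp).
  apply: measurable_funD; last first.
    by apply: measurable_funM => //; exact: (measurableT_comp (measurable_St ip)).
  apply: measurable_funD => //.
  by apply: measurable_funM => //; exact: (measurableT_comp (measurable_Ct ip)).
- by move=> xi x; apply: mulr_ge0; [exact: fejer_ge0|apply: mulr_ge0 => //; exact: Et_ge0].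
apply: eq_integral => x _.
transitivity (\int[mu]_xi \int[mu]_y (fejer e xi * (p x * (p y * (1 + cos ((x - y) * xi)))))%:E)%E.
  apply: eq_integral => xi _; have [i <-] := Et_int x xi ip.
  rewrite -RintegralZl// -RintegralZl// ?EFin_Rint//; try exact: integrable_scale.
  by apply: integrable_scale; exact: integrable_scale.
rewrite (@tonelli (fun xi y => fejer e xi * (p x * (p y * (1 + cos ((x - y) * xi)))))); last 2 first.
- apply: measurable_funM.
    exact: (measurableT_comp (measurable_fejer e)).
  apply: measurable_funM => //; apply: measurable_funM; first exact: (measurableT_comp mp).
  apply: measurable_funD => //.
  apply: (measurableT_comp (continuous_measurable_fun (@continuous_cos R))).
  by apply: measurable_funM => //; apply: measurable_funB.
- move=> xi y; apply: mulr_ge0; first exact: fejer_ge0.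
  by apply: mulr_ge0 => //; apply: mulr_ge0 => //; exact: one_add_cos_ge0.
apply: eq_integral => y _; have [i <-] := fejer_cos_int (x - y) e0.
rewrite -RintegralZl// EFin_Rint; last exact: integrable_scale.
by apply: eq_integral => xi _; congr EFin; ring.
Qed.

Lemma measurable_tri2 p e : measurable_fun setT p ->
  measurable_fun setT (fun z : R * R => (p z.2 * tri e (z.1 - z.2))%:E).
Proof.
move=> mp; apply/measurable_EFinP; apply: measurable_funM.
  exact: (measurableT_comp mp).
apply: (measurableT_comp (continuous_measurable_fun (continuous_tri (e:=e)))).
exact: measurable_funB.
Qed.

Lemma measurable_tri_sub e x : measurable_fun setT (fun y => tri e (x - y)).
Proof.
apply: (measurableT_comp (continuous_measurable_fun (continuous_tri (e:=e)))).
exact: measurable_funB.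
Qed.

Lemma L1_tri e x : 0 < e -> L1 (fun y => tri e (x - y)).
Proof.
move=> e0; apply/integrableP; split.
  by apply/measurable_EFinP; exact: measurable_tri_sub.
have h := tri_integral x e0.
apply: (@le_lt_trans _ _ 1%E); last by rewrite ltry.
rewrite -h le_eqVlt; apply/orP; left; apply/eqP; apply: eq_integral => y _ /=.
by rewrite ger0_norm// tri_ge0.
Qed.

Lemma Rint_tri e x : 0 < e -> \int[mu]_y tri e (x - y) = 1.
Proof. by move=> e0; rewrite /Rintegral tri_integral. Qed.

Lemma L1_Mtri p e x : 0 < e -> L1 p -> L1 (fun y => p y * tri e (x - y)).
Proof.
move=> e0 ip; have h : L1 (fun y => p y * (e * tri e (x - y))).
  apply: L1_bdd => //; first by apply: measurable_funM => //; exact: measurable_tri_sub.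
  move=> y; rewrite ger0_norm; last by rewrite mulr_ge0 ?tri_ge0// ltW.
  by rewrite -ler_pdivlMl// mulr1 tri_le.
apply: eq_integrable (integrable_scale e^-1 h) => // y _ /=.
by congr EFin; field; rewrite gt_eqF.
Qed.

Definition tri_mean p e x : R := \int[mu]_y (p y * tri e (x - y)).

Lemma measurable_tri_mean p e : 0 < e -> L1 p -> (forall x, 0 <= p x) ->
  measurable_fun setT (tri_mean p e).
Proof.
move=> e0 ip p0; apply: (measurableT_comp (fine_measurable measurableT)).
apply: (@measurable_fun_fubini_tonelli_F _ _ (measurableTypeR R) (measurableTypeR R) R mu
  (fun z => (p z.2 * tri e (z.1 - z.2))%:E)).
  exact: measurable_tri2 (L1_meas ip).
by move=> z; rewrite lee_fin mulr_ge0// tri_ge0.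
Qed.

Lemma tri_mean_ge0 p e x : (forall x, 0 <= p x) -> 0 <= tri_mean p e x.
Proof. by move=> p0; apply: Rintegral_ge0 => y _; rewrite mulr_ge0// tri_ge0. Qed.

(** The triangle is bounded by 1/e and vanishes outside the ball of radius e, so
the deviation of the mean from p(x) is at most twice the mean deviation over
that ball, which vanishes at every Lebesgue point. *)
Lemma tri_mean_cvg p : L1 p ->
  {ae mu, forall x, tri_mean p n.+1%:R^-1 x @[n --> \oo] --> p x}.
Proof.
move=> ip; have mp := L1_meas ip.
have : locally_integrable [set: R] p.
  have := @integrable_locally R p setT measurableT ip.
  by congr locally_integrable; apply/funext => x; rewrite patchE in_setT.
move/lebesgue_differentiation; apply: ae_imp => x px.
have hc : (n.+1%:R^-1 : R) @[n --> \oo] --> (0 : R)^'+.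
  move=> A [e /= e0 hA].
  have := @cvg_harmonic R; move/cvgrPdist_lt/(_ _ e0); apply: filterS => n hh.
  by apply: hA => //=; rewrite invr_gt0.
have dc : davg p x n.+1%:R^-1 @[n --> \oo] --> 0%E by exact: (cvg_comp _ _ hc px).
have bound e : 0 < e -> (`|tri_mean p e x - p x|%:E <= 2%:E * davg p x e)%E.
  move=> e0.
  have i1 := L1_Mtri x e0 ip.
  have i2 := integrable_scale (p x) (L1_tri x e0).
  have -> : tri_mean p e x - p x = \int[mu]_y ((p y - p x) * tri e (x - y)).
    rewrite -[X in _ - X](mulr1 (p x)) -(Rint_tri x e0) -RintZ; last exact: L1_tri.
    by rewrite -RintegralB//; apply: eq_Rintegral => y _; rewrite mulrBl.
  have i12 : L1 (fun y => (p y - p x) * tri e (x - y)).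
    by apply: eq_integrable (L1B i1 i2) => // y _ /=; rewrite mulrBl.
  have := le_normr_Rintegral measurableT i12; rewrite -lee_fin => /le_trans; apply.
  have i12n : L1 (fun y => `|(p y - p x) * tri e (x - y)|).
    by have /integrable_norm := i12.
  rewrite (EFin_Rint i12n) /davg /iavg.
  have mb : measurable (ball x e) by exact: measurable_ball.
  have mh : measurable_fun setT (fun y => `|(p y - p x)|%:E).
    by apply/measurable_EFinP; apply: measurableT_comp => //; exact: measurable_funB.
  have -> : (\int[mu]_y `|(p y - p x) * tri e (x - y)|%:E =
             \int[mu]_(y in ball x e) `|(p y - p x) * tri e (x - y)|%:E)%E.
    rewrite [RHS]integral_mkcond; apply: eq_integral => y _.
    rewrite patchE; case: ifPn => // /negP yb.
    rewrite tri_out ?mulr0 ?normr0// leNgt; apply/negP => h; apply: yb.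
    by rewrite inE.
  apply: (@le_trans _ _ (\int[mu]_(y in ball x e) (e^-1%:E * `|(p y - p x)|%:E))%E).
    apply: ge0_le_integral => //.
    - by apply: measurable_funTS; exact: measurable_int i12n.
    - by apply: measurable_funTS; apply: emeasurable_funM.
    move=> y _; rewrite -EFinM lee_fin normrM mulrC.
    by rewrite ler_wpM2r// ger0_norm ?tri_ge0// tri_le.
  rewrite ge0_integralZl//; last 2 first.
  - exact: measurable_funTS.
  - by rewrite lee_fin invr_ge0 ltW.
  rewrite (lebesgue_measure_ball _ (ltW e0)) inver.
  have e2 : (e *+ 2 == 0) = false by rewrite gt_eqF// mulrn_wgt0.
  rewrite e2 muleA -EFinM (_ : 2 * (e *+ 2)^-1 = e^-1); last by rewrite mulr2n; field; lra.
  exact: lexx.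
apply/cvgrPdist_lt => ep ep0.
have ep2 : 0 < ep / 2 by rewrite divr_gt0.
move/fine_cvgP : dc => [fd /cvgrPdist_lt /(_ _ ep2)] hd.
near=> n.
have := bound n.+1%:R^-1; rewrite invr_gt0 ltr0n => /(_ isT).
have fn : davg p x n.+1%:R^-1 \is a fin_num by near: n.
have : `|0 - fine (davg p x n.+1%:R^-1)| < ep / 2 by near: n; exact: hd.
rewrite sub0r normrN -{2}(fineK fn) -EFinM lee_fin => h1 h2.
by rewrite distrC; have := ler_norm (fine (davg p x n.+1%:R^-1)); lra.
Unshelve. all: by end_near. Qed.

Definition tri_form p e : \bar R := (\int[mu]_x (p x * tri_mean p e x)%:E)%E.

(** The contribution of the summand 1 in [tonelli_kernel] is the same on both
sides and finite, so it can be subtracted. *)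
Lemma tonelli_kernel_tri p e : L1 p -> (forall x, 0 <= p x) -> 0 < e ->
  (\int[mu]_xi (fejer e xi * (Ct p xi ^+ 2 + St p xi ^+ 2))%:E =
   (2 * kappa)%:E * tri_form p e)%E.
Proof.
move=> ip p0 e0; have := tonelli_kernel ip p0 e0.
have mp := L1_meas ip; have mA := measurable_tri_mean e0 ip p0.
have mCS : measurable_fun setT (fun xi => Ct p xi ^+ 2 + St p xi ^+ 2).
  apply: measurable_funD; apply: measurable_funX;
    [exact: measurable_Ct|exact: measurable_St].
have k0 : 0 <= 2 * @kappa R by rewrite mulr_ge0// ltW// kappa_gt0.
have imk : L1 (fejer e) by exact: integrable_scale (cos_quot_int e).
have mkE : \int[mu]_xi fejer e xi = 2 * kappa / e.
  rewrite /fejer RintZ ?cos_quot_integral; last exact: cos_quot_int.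
  by rewrite gtr0_norm//; field; lra.
pose c : R := Pt p ^+ 2 * (2 * kappa / e).
have -> : (\int[mu]_xi (fejer e xi * (Pt p ^+ 2 + Ct p xi ^+ 2 + St p xi ^+ 2))%:E =
  c%:E + \int[mu]_xi (fejer e xi * (Ct p xi ^+ 2 + St p xi ^+ 2))%:E)%E.
  have -> : c%:E = (\int[mu]_xi (Pt p ^+ 2 * fejer e xi)%:E)%E.
    by rewrite /c -mkE -RintZ// EFin_Rint//; exact: integrable_scale.
  rewrite -ge0_integralD//.
  - by apply: eq_integral => xi _; rewrite -EFinD; congr EFin; ring.
  - by move=> xi _; rewrite lee_fin mulr_ge0 ?sqr_ge0 ?fejer_ge0.
  - by apply/measurable_EFinP; apply: measurable_funM => //; exact: measurable_fejer.
  - by move=> xi _; rewrite lee_fin mulr_ge0 ?addr_ge0 ?sqr_ge0 ?fejer_ge0.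
  - by apply/measurable_EFinP; apply: measurable_funM => //; exact: measurable_fejer.
have inner x : (\int[mu]_y (p x * p y * (2 * kappa * (e^-1 + tri e (x - y))))%:E =
    (p x * (2 * kappa * (Pt p / e)))%:E + (2 * kappa)%:E * (p x * tri_mean p e x)%:E)%E.
  rewrite -EFinM -EFinD /tri_mean.
  have it := L1_Mtri x e0 ip.
  have -> : p x * (2 * kappa * (Pt p / e)) + 2 * kappa * (p x * \int[mu]_y (p y * tri e (x - y))) =
    (p x * (2 * kappa / e)) * Pt p + (2 * kappa * p x) * \int[mu]_y (p y * tri e (x - y)) by ring.
  rewrite /Pt -(RintZ _ ip) -(RintZ _ it) -RintegralD//; try exact: integrable_scale.
  rewrite EFin_Rint; last by apply: L1D; exact: integrable_scale.
  by apply: eq_integral => y _; congr EFin; ring.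
under [X in _ = X -> _]eq_integral do rewrite inner.
rewrite ge0_integralD//; last 4 first.
- move=> x _; rewrite lee_fin mulr_ge0// mulr_ge0// divr_ge0 ?(ltW e0)//.
  by apply: Rintegral_ge0 => y _; exact: p0.
- by apply/measurable_EFinP; apply: measurable_funM.
- by move=> x _; rewrite -EFinM lee_fin mulr_ge0// mulr_ge0// tri_mean_ge0.
- by apply: measurable_funeM; apply/measurable_EFinP; exact: measurable_funM.
have -> : (\int[mu]_x (p x * (2 * kappa * (Pt p / e)))%:E = c%:E)%E.
  rewrite -EFin_Rint; last first.
    by apply: eq_integrable (integrable_scale (2 * kappa * (Pt p / e)) ip) => // x _ /=; rewrite mulrC.
  congr EFin; transitivity (\int[mu]_x ((2 * kappa * (Pt p / e)) * p x)).
    by apply: eq_Rintegral => x _; rewrite mulrC.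
  by rewrite RintZ// -/(Pt p) /c; ring.
rewrite ge0_integralZl//; last 2 first.
- by apply/measurable_EFinP; exact: measurable_funM.
- by move=> x _; rewrite lee_fin mulr_ge0// tri_mean_ge0.
by move/(congr1 (fun z => z - c%:E)%E); rewrite ![(c%:E + _)%E]addeC !addeK.
Qed.

(** The product p(x) p(y) is at most (p(x)^2 + p(y)^2)/2, and the triangle has
integral 1 in each variable. *)
Lemma tri_form_le p e : L1 p -> L1 (fun x => p x ^+ 2) -> (forall x, 0 <= p x) -> 0 < e ->
  (tri_form p e <= \int[mu]_x (p x ^+ 2)%:E)%E.
Proof.
move=> ip ip2 p0 e0; have mp := L1_meas ip.
have mt := @measurable_tri_sub e.
have t0 x y : 0 <= tri e (x - y) by exact: tri_ge0.
have mtt : measurable_fun setT (fun z : R * R => tri e (z.1 - z.2)).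
  apply: (measurableT_comp (continuous_measurable_fun (continuous_tri (e:=e)))).
  exact: measurable_funB.
pose h := 2^-1 : R.
have h0 : 0 <= h by rewrite invr_ge0.
have E1 x : (\int[mu]_y (h * (p x ^+ 2 * tri e (x - y)))%:E = (h * p x ^+ 2)%:E)%E.
  transitivity (\int[mu]_y ((h * p x ^+ 2)%:E * (tri e (x - y))%:E))%E.
    by apply: eq_integral => y _; rewrite -EFinM mulrA.
  rewrite ge0_integralZl//.
  - by rewrite tri_integral// mule1.
  - by apply/measurable_EFinP; exact: mt.
  - by move=> y _; rewrite lee_fin.
  - by rewrite lee_fin mulr_ge0 ?sqr_ge0.
have E2 : (\int[mu]_x \int[mu]_y (h * (p y ^+ 2 * tri e (x - y)))%:E =
           \int[mu]_x (h * p x ^+ 2)%:E)%E.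
  rewrite (@tonelli (fun x y => h * (p y ^+ 2 * tri e (x - y)))).
  - by apply: eq_integral => y _; rewrite -E1; apply: eq_integral => x _; rewrite -triN opprB.
  - apply: measurable_funM => //; apply: measurable_funM => //.
    by apply: measurable_funX; exact: (measurableT_comp mp).
  - by move=> x y; rewrite mulr_ge0// mulr_ge0 ?sqr_ge0.
apply: (@le_trans _ _ (\int[mu]_x (\int[mu]_y (h * (p x ^+ 2 * tri e (x - y)))%:E +
                                  \int[mu]_y (h * (p y ^+ 2 * tri e (x - y)))%:E))%E).
  have mF : measurable_fun setT (fun x => \int[mu]_y (h * (p y ^+ 2 * tri e (x - y)))%:E)%E.
    apply: (@measurable_fun_fubini_tonelli_F _ _ (measurableTypeR R) (measurableTypeR R) R mu
      (fun z => (h * (p z.2 ^+ 2 * tri e (z.1 - z.2)))%:E)).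
      apply/measurable_EFinP; apply: measurable_funM => //; apply: measurable_funM => //.
      by apply: measurable_funX; exact: (measurableT_comp mp).
    by move=> z; rewrite lee_fin mulr_ge0// mulr_ge0 ?sqr_ge0.
  apply: ge0_le_integral => //.
  - by move=> x _; rewrite lee_fin mulr_ge0// tri_mean_ge0.
  - by apply/measurable_EFinP; apply: measurable_funM => //; exact: measurable_tri_mean.
  - under eq_fun do rewrite E1; apply: emeasurable_funD => //.
    by apply/measurable_EFinP; apply: measurable_funM => //; exact: measurable_funX.
  move=> x _; rewrite /tri_mean -RintZ; last exact: L1_Mtri.
  rewrite EFin_Rint; last by apply: integrable_scale; exact: L1_Mtri.
  have m1 : measurable_fun setT (fun y => (h * (p x ^+ 2 * tri e (x - y)))%:E).
    by apply/measurable_EFinP; do 2 apply: measurable_funM => //; exact: mt.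
  have m2 : measurable_fun setT (fun y => (h * (p y ^+ 2 * tri e (x - y)))%:E).
    apply/measurable_EFinP; apply: measurable_funM => //.
    by apply: measurable_funM; [exact: measurable_funX|exact: mt].
  rewrite -ge0_integralD//; last 2 first.
  - by move=> y _; rewrite lee_fin mulr_ge0// mulr_ge0 ?sqr_ge0.
  - by move=> y _; rewrite lee_fin mulr_ge0// mulr_ge0 ?sqr_ge0.
  apply: ge0_le_integral => //.
  - by move=> y _; rewrite lee_fin mulr_ge0// mulr_ge0.
  - by apply/measurable_EFinP; do 2 apply: measurable_funM => //; exact: mt.
  - exact: emeasurable_funD.
  move=> y _; rewrite -EFinD lee_fin.
  have := t0 x y; move: (tri e (x - y)) => t t_ge0; rewrite -subr_ge0.
  rewrite (_ : _ - _ = h * (p x - p y) ^+ 2 * t); last by rewrite /h; field.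
  by rewrite mulr_ge0// mulr_ge0 ?sqr_ge0.
rewrite ge0_integralD//; last 4 first.
- by move=> x _; rewrite E1 lee_fin mulr_ge0 ?sqr_ge0.
- under eq_fun do rewrite E1.
  by apply/measurable_EFinP; apply: measurable_funM => //; exact: measurable_funX.
- by move=> x _; apply: integral_ge0 => y _; rewrite lee_fin mulr_ge0// mulr_ge0 ?sqr_ge0.
- apply: (@measurable_fun_fubini_tonelli_F _ _ (measurableTypeR R) (measurableTypeR R) R mu
      (fun z => (h * (p z.2 ^+ 2 * tri e (z.1 - z.2)))%:E)).
    apply/measurable_EFinP; apply: measurable_funM => //; apply: measurable_funM => //.
    by apply: measurable_funX; exact: (measurableT_comp mp).
  by move=> z; rewrite lee_fin mulr_ge0// mulr_ge0 ?sqr_ge0.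
rewrite E2; under eq_integral do rewrite E1.
rewrite -ge0_integralD//; last 4 first.
- by move=> x _; rewrite lee_fin mulr_ge0 ?sqr_ge0.
- by apply/measurable_EFinP; apply: measurable_funM => //; exact: measurable_funX.
- by move=> x _; rewrite lee_fin mulr_ge0 ?sqr_ge0.
- by apply/measurable_EFinP; apply: measurable_funM => //; exact: measurable_funX.
rewrite le_eqVlt; apply/orP; left; apply/eqP; apply: eq_integral => x _.
by rewrite -EFinD; congr EFin; rewrite /h; field.
Qed.

(** Both inequalities come from Fatou's lemma applied to the identity
[tonelli_kernel_tri]: as e tends to 0 the Fejer kernel, which is at most 1, tends
to 1, and the means of p tend to p, with [tri_form_le] as an upper bound. *)
Lemma plancherel_ge0 p : L1 p -> L1 (fun x => p x ^+ 2) -> (forall x, 0 <= p x) ->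
  (\int[mu]_xi (Ct p xi ^+ 2 + St p xi ^+ 2)%:E =
   (2 * kappa)%:E * \int[mu]_x (p x ^+ 2)%:E)%E.
Proof.
move=> ip ip2 p0; have mp := L1_meas ip.
have en0 n : 0 < n.+1%:R^-1 :> R by rewrite invr_gt0.
have k0 : 0 < 2 * @kappa R by rewrite mulr_gt0// kappa_gt0.
have mCS : measurable_fun setT (fun xi => Ct p xi ^+ 2 + St p xi ^+ 2).
  apply: measurable_funD; apply: measurable_funX;
    [exact: measurable_Ct|exact: measurable_St].
have CS0 xi : 0 <= Ct p xi ^+ 2 + St p xi ^+ 2 by rewrite addr_ge0 ?sqr_ge0.
apply/eqP; rewrite eq_le; apply/andP; split.
- apply: (@fatou_bound _ (fun n xi => fejer n.+1%:R^-1 xi * (Ct p xi ^+ 2 + St p xi ^+ 2))) => //.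
  + by move=> n; apply: measurable_funM => //; exact: measurable_fejer.
  + by move=> n xi; rewrite mulr_ge0// fejer_ge0.
  (* The Fejer kernel is 0 at 0, so convergence holds only off this point. *)
  + have : {ae mu, forall x : R, x != 0}.
      exists [set 0]; split => //; first exact: lebesgue_measure_set1.
      by move=> x /= /negP; rewrite negbK => /eqP.
    apply: ae_imp => xi xi0; rewrite -{2}(mul1r (_ + _)).
    by apply: cvgM; [exact: fejer_cvg|exact: cvg_cst].
  + apply: nearW => n; rewrite tonelli_kernel_tri//.
    by rewrite lee_pmul2l ?fin_numE// ?lte_fin// tri_form_le.
- rewrite -lee_pdivlMl//.
  apply: (@fatou_bound _ (fun n x => p x * tri_mean p n.+1%:R^-1 x)).
  + by move=> n; apply: measurable_funM => //; exact: measurable_tri_mean.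
  + exact: measurable_funX.
  + by move=> n x; rewrite mulr_ge0// tri_mean_ge0.
  + by move=> x; exact: sqr_ge0.
  + apply: ae_imp (tri_mean_cvg ip) => x h; rewrite expr2.
    by apply: cvgM => //; exact: cvg_cst.
  + apply: nearW => n; rewrite lee_pdivlMl// -/(tri_form _ _) -tonelli_kernel_tri//.
    apply: ge0_le_integral => //.
    * by move=> xi _; rewrite lee_fin mulr_ge0// fejer_ge0.
    * by apply/measurable_EFinP; apply: measurable_funM => //; exact: measurable_fejer.
    * exact/measurable_EFinP.
    * by move=> xi _; rewrite lee_fin ler_piMl// fejer_le1.
Qed.
End Transforms.

(** * The Plancherel identity for integrable functions in L^2 *)

Section ComplexTransform.
Context {R : realType}.
Local Notation mu := (@lebesgue_measure R).
Implicit Types (p u v : R -> R) (x y xi e : R) (f g h : cfun R) (z : R[i]).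

Lemma RintD u v : L1 u -> L1 v ->
  \int[mu]_x (u x + v x) = \int[mu]_x u x + \int[mu]_x v x.
Proof. exact: RintegralD. Qed.

Lemma RintB u v : L1 u -> L1 v ->
  \int[mu]_x (u x - v x) = \int[mu]_x u x - \int[mu]_x v x.
Proof. exact: RintegralB. Qed.

Lemma CtD u v xi : L1 u -> L1 v -> Ct (fun x => u x + v x) xi = Ct u xi + Ct v xi.
Proof.
move=> iu iv; rewrite /Ct -RintegralD//; [|exact: L1_cos..].
by apply: eq_Rintegral => x _; rewrite mulrDl.
Qed.

Lemma StD u v xi : L1 u -> L1 v -> St (fun x => u x + v x) xi = St u xi + St v xi.
Proof.
move=> iu iv; rewrite /St -RintegralD//; [|exact: L1_sin..].
by apply: eq_Rintegral => x _; rewrite mulrDl.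
Qed.

Lemma CtZ k u xi : L1 u -> Ct (fun x => k * u x) xi = k * Ct u xi.
Proof.
move=> iu; rewrite /Ct -RintZ; last exact: L1_cos.
by apply: eq_Rintegral => x _; rewrite mulrA.
Qed.

Lemma StZ k u xi : L1 u -> St (fun x => k * u x) xi = k * St u xi.
Proof.
move=> iu; rewrite /St -RintZ; last exact: L1_sin.
by apply: eq_Rintegral => x _; rewrite mulrA.
Qed.

Lemma CtB u v xi : L1 u -> L1 v -> Ct (fun x => u x - v x) xi = Ct u xi - Ct v xi.
Proof.
move=> iu iv; rewrite /Ct -RintegralB//; [|exact: L1_cos..].
by apply: eq_Rintegral => x _; rewrite mulrBl.
Qed.

Lemma StB u v xi : L1 u -> L1 v -> St (fun x => u x - v x) xi = St u xi - St v xi.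
Proof.
move=> iu iv; rewrite /St -RintegralB//; [|exact: L1_sin..].
by apply: eq_Rintegral => x _; rewrite mulrBl.
Qed.

Lemma CtN u xi : Ct u (- xi) = Ct u xi.
Proof. by apply: eq_Rintegral => x _; rewrite mulrN cosN. Qed.

Lemma StN u xi : L1 u -> St u (- xi) = - St u xi.
Proof.
move=> iu; transitivity (-1 * St u xi); last by rewrite mulN1r.
rewrite [in RHS]/St -RintZ; last exact: L1_sin.
by apply: eq_Rintegral => x _; rewrite mulrN sinN; ring.
Qed.

(** The squared modulus of the Fourier transform of a real function. *)
Definition spectrum u xi : R := Ct u xi ^+ 2 + St u xi ^+ 2.

Lemma spectrum_ge0 u xi : 0 <= spectrum u xi.
Proof. by rewrite addr_ge0 ?sqr_ge0. Qed.

Lemma L1_ge0 u : measurable_fun setT u -> (forall x, 0 <= u x) ->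
  (\int[mu]_x (u x)%:E < +oo)%E -> L1 u.
Proof.
move=> mu0 u0 h; apply/integrableP; split; first exact/measurable_EFinP.
by move: h; congr (_ < +oo)%E; apply: eq_integral => x _ /=; rewrite ger0_norm.
Qed.

Lemma plancherel_ge0R p : L1 p -> L1 (fun x => p x ^+ 2) -> (forall x, 0 <= p x) ->
  L1 (spectrum p) /\ \int[mu]_xi spectrum p xi = 2 * kappa * \int[mu]_x p x ^+ 2.
Proof.
move=> ip ip2 p0; have := plancherel_ge0 ip ip2 p0.
rewrite -(EFin_Rint ip2) -EFinM => h; split; last by rewrite /Rintegral h.
apply: L1_ge0; last by rewrite h ltry.
  by apply: measurable_funD; apply: measurable_funX;
    [exact: measurable_Ct|exact: measurable_St].
exact: spectrum_ge0.
Qed.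

Lemma L1_sqr_le u v : L1 (fun x => u x ^+ 2) -> measurable_fun setT v ->
  (forall x, `|v x| <= `|u x|) -> L1 (fun x => v x ^+ 2).
Proof.
move=> iu mv h; apply: (@ae_le_integrable _ _ (fun x => u x ^+ 2)) => //.
  exact: measurable_funX.
apply: aeW => x; rewrite normrX -(real_normK (num_real (u x))).
by rewrite lerXn2r// nnegrE.
Qed.

Lemma L1_le u v : L1 u -> measurable_fun setT v ->
  (forall x, `|v x| <= `|u x|) -> L1 v.
Proof.
move=> iu mv h; apply: (@ae_le_integrable _ _ (fun x => `|u x|)) => //.
  by have /integrable_norm := iu.
exact: aeW.
Qed.

(** For u = p - q with p, q >= 0 the parallelogram identity expresses both sides
through the nonnegative functions p, q and p + q. *)
Lemma plancherel_real u : L1 u -> L1 (fun x => u x ^+ 2) ->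
  L1 (spectrum u) /\ \int[mu]_xi spectrum u xi = 2 * kappa * \int[mu]_x u x ^+ 2.
Proof.
move=> iu iu2; have mU := L1_meas iu.
(* Positive and negative parts; their sum is the modulus of u. *)
pose p x := (`|u x| + u x) / 2; pose q x := (`|u x| - u x) / 2.
have mn : measurable_fun setT (fun x => `|u x|) by exact: measurableT_comp.
have mp : measurable_fun setT p by apply: measurable_funM => //; exact: measurable_funD.
have mq : measurable_fun setT q by apply: measurable_funM => //; exact: measurable_funB.
have p0 x : 0 <= p x by rewrite /p; have := ler_norm (- u x); rewrite normrN; lra.
have q0 x : 0 <= q x by rewrite /q; have := ler_norm (u x); lra.
have pu x : `|p x| <= `|u x|.
  by rewrite (ger0_norm (p0 x)) /p; have := ler_norm (u x); lra.
have qu x : `|q x| <= `|u x|.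
  by rewrite (ger0_norm (q0 x)) /q; have := ler_norm (- u x); rewrite normrN; lra.
have ip : L1 p by exact: L1_le iu mp pu.
have iq : L1 q by exact: L1_le iu mq qu.
have ip2 : L1 (fun x => p x ^+ 2) by exact: L1_sqr_le iu2 mp pu.
have iq2 : L1 (fun x => q x ^+ 2) by exact: L1_sqr_le iu2 mq qu.
have s0 x : 0 <= p x + q x by exact: addr_ge0.
have sE x : p x + q x = `|u x| by rewrite /p /q; field.
have is2 : L1 (fun x => (p x + q x) ^+ 2).
  by apply: L1_sqr_le iu2 _ _; [exact: measurable_funD|move=> x; rewrite sE normr_id].
have [ap ep] := plancherel_ge0R ip ip2 p0.
have [aq eq] := plancherel_ge0R iq iq2 q0.
have [asum esum] := plancherel_ge0R (L1D ip iq) is2 s0.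
have uE : u = (fun x => p x - q x) by apply/funext => x; rewrite /p /q; field.
have dE xi : spectrum u xi = 2 * spectrum p xi + 2 * spectrum q xi - spectrum (fun x => p x + q x) xi.
  by rewrite uE /spectrum CtB// StB// CtD// StD//; ring.
have i2p := integrable_scale 2 ap; have i2q := integrable_scale 2 aq.
have -> : spectrum u = (fun xi => 2 * spectrum p xi + 2 * spectrum q xi - spectrum (fun x => p x + q x) xi).
  exact/funext.
split; first by apply: L1B => //; exact: L1D.
rewrite RintegralB//; last exact: L1D.
rewrite RintegralD// !RintZ// ep eq esum.
have -> : \int[mu]_x u x ^+ 2 = \int[mu]_x (2 * p x ^+ 2 + 2 * q x ^+ 2 - (p x + q x) ^+ 2).
  by apply: eq_Rintegral => x _; rewrite uE; ring.
have j2p := integrable_scale 2 ip2; have j2q := integrable_scale 2 iq2.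
rewrite RintegralB//; last exact: L1D.
by rewrite RintegralD// !RintZ//; ring.
Qed.

Definition cL1 f := L1 (fun x => complex.Re (f x)) /\ L1 (fun x => complex.Im (f x)).

(** The Fourier integral with kernel exp(- i x xi), by real and imaginary parts. *)
Definition Fhat f xi : R[i] :=
  (Ct (fun x => complex.Re (f x)) xi + St (fun x => complex.Im (f x)) xi) +i*
  (Ct (fun x => complex.Im (f x)) xi - St (fun x => complex.Re (f x)) xi).

Lemma cmeas_Fhat f : cL1 f -> cmeas (Fhat f).
Proof.
move=> [ir ii]; split.
  by apply: measurable_funD; [exact: measurable_Ct|exact: measurable_St].
by apply: measurable_funB; [exact: measurable_Ct|exact: measurable_St].
Qed.

Lemma L2_Re_sqr f : L2 f -> L1 (fun x => complex.Re (f x) ^+ 2).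
Proof.
move=> lf; apply: (@ae_le_integrable _ _ (fun x => sqc (f x))).
- by apply: measurable_funX; have [] := L2_cmeas lf.
- exact: L2_int.
- by apply: aeW => x; rewrite ger0_norm ?sqr_ge0// lerDl sqr_ge0.
Qed.

Lemma L2_Im_sqr f : L2 f -> L1 (fun x => complex.Im (f x) ^+ 2).
Proof.
move=> lf; apply: (@ae_le_integrable _ _ (fun x => sqc (f x))).
- by apply: measurable_funX; have [] := L2_cmeas lf.
- exact: L2_int.
- by apply: aeW => x; rewrite ger0_norm ?sqr_ge0// lerDr sqr_ge0.
Qed.

(** The mixed terms of the squared modulus are odd in xi, so after averaging over xi
and - xi only the spectra of the real and imaginary parts remain. *)
Lemma plancherel_L1 f : cL1 f -> L2 f ->
  L2 (Fhat f) /\ L2sq (Fhat f) = 2 * kappa * L2sq f.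
Proof.
move=> cf lf; have [ir ii] := cf.
set u := fun x => complex.Re (f x); set v := fun x => complex.Im (f x).
have [au eu] := plancherel_real ir (L2_Re_sqr lf).
have [av ev] := plancherel_real ii (L2_Im_sqr lf).
have mF := cmeas_Fhat cf.
have iuv : L1 (fun xi => spectrum u xi + spectrum v xi) by exact: L1D.
have sE xi : sqc (Fhat f xi) + sqc (Fhat f (- xi)) = 2 * (spectrum u xi + spectrum v xi).
  by rewrite /sqc /Fhat /= !CtN !StN// /spectrum /u /v; ring.
have l : L2 (Fhat f).
  apply: proj1 (@L2_le _ _ (fun xi => 2 * (spectrum u xi + spectrum v xi)) mF _ _).
    exact: integrable_scale.
  by apply: aeW => xi; rewrite -sE lerDl sqc_ge0.
split => //.
have opp : (\int[mu]_xi (sqc (Fhat f (- xi)))%:E = \int[mu]_xi (sqc (Fhat f xi))%:E)%E.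
  rewrite (@ge0_integral_opp _ (fun xi => (sqc (Fhat f xi))%:E))//.
    by apply/measurable_EFinP; exact: cmeas_sqc.
  by move=> xi; rewrite lee_fin sqc_ge0.
have io : L1 (fun xi => sqc (Fhat f (- xi))).
  apply: L1_ge0.
  - by apply: (measurableT_comp (cmeas_sqc mF)); exact: measurable_funN.
  - by move=> xi; exact: sqc_ge0.
  - by rewrite opp; have /L2P[] := l.
have : \int[mu]_xi (2 * (spectrum u xi + spectrum v xi)) = 2 * L2sq (Fhat f).
  transitivity (\int[mu]_xi (sqc (Fhat f xi) + sqc (Fhat f (- xi)))).
    by apply: eq_Rintegral => xi _; rewrite sE.
  have il : L1 (fun xi => sqc (Fhat f xi)) := L2_int l.
  rewrite (RintD il io).
  have -> : \int[mu]_xi sqc (Fhat f (- xi)) = L2sq (Fhat f) by rewrite /Rintegral opp.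
  by rewrite /L2sq; ring.
rewrite (RintZ _ iuv) (RintD au av) eu ev -mulrDr => h.
have n2 : (2 : R) != 0 by rewrite pnatr_eq0.
by rewrite -(mulfI n2 h) -(RintD (L2_Re_sqr lf) (L2_Im_sqr lf)).
Qed.
End ComplexTransform.

(** * The Fourier transform on L^2 *)

Section Fourier.
Context {R : realType}.
Local Notation mu := (@lebesgue_measure R).
Implicit Types (p u v a : R -> R) (x y xi e : R) (f g h : cfun R) (z : R[i]).

Lemma complex_ext z1 z2 : complex.Re z1 = complex.Re z2 -> complex.Im z1 = complex.Im z2 -> z1 = z2.
Proof. by case: z1 => a b; case: z2 => c d /= -> ->. Qed.

(** Fubini's theorem for u(x) a(xi) k(x xi), whose modulus is integrable because k
is bounded. *)
Lemma multiplication_kernel u a (k : R -> R) : L1 u -> L1 a -> continuous k ->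
  (forall x, `|k x| <= 1) ->
  \int[mu]_xi ((\int[mu]_x (u x * k (x * xi))) * a xi) =
  \int[mu]_x (u x * \int[mu]_xi (a xi * k (xi * x))).
Proof.
move=> iu ia ck k1; have mU := L1_meas iu; have ma := L1_meas ia.
have mk : measurable_fun setT k by exact: continuous_measurable_fun.
have mkx x : measurable_fun setT (fun y => k (y * x)).
  by apply: (measurableT_comp mk); apply: measurable_funM.
have iuk xi : L1 (fun x => u x * k (x * xi)) by exact: L1_bdd.
have iak x : L1 (fun xi => a xi * k (xi * x)) by exact: L1_bdd.
pose F : measurableTypeR R * measurableTypeR R -> \bar R :=
  fun w => (u w.2 * k (w.2 * w.1) * a w.1)%:E.
have mF : measurable_fun setT F.
  apply/measurable_EFinP; apply: measurable_funM; last exact: (measurableT_comp ma).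
  apply: measurable_funM; first exact: (measurableT_comp mU).
  by apply: (measurableT_comp mk); apply: measurable_funM.
have iF : (mu \x mu)%E.-integrable setT F.
  apply/integrable12ltyP => //=.
  have iun : L1 (fun x => `|u x|) by have /integrable_norm := iu.
  have ian : L1 (fun x => `|a x|) by have /integrable_norm := ia.
  apply: (@le_lt_trans _ _ (\int[mu]_xi (\int[mu]_x `|u x| * `|a xi|)%:E)%E); last first.
    rewrite -EFin_Rint ?ltry//; exact: integrable_scale.
  apply: ge0_le_integral => //.
  - by move=> x _; apply: integral_ge0.
  - apply: (@measurable_fun_fubini_tonelli_F _ _ (measurableTypeR R) (measurableTypeR R) R mu (abse \o F)).
      exact: measurableT_comp.
    by move=> w; exact: abse_ge0.
  - apply/measurable_EFinP; apply: measurable_funM => //; exact: measurableT_comp.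
  move=> xi _.
  have j : L1 (fun x => `|a xi| * `|u x|) by exact: integrable_scale.
  rewrite mulrC -RintZ// EFin_Rint//; apply: ge0_le_integral => //.
  - by apply/measurable_EFinP; apply: measurableT_comp => //; apply: measurable_funM => //; exact: L1_meas (iuk xi).
  - exact: measurable_int j.
  - move=> x _; rewrite /F /= lee_fin !normrM mulrC ler_wpM2l//.
    by rewrite ler_piMr.
have := Fubini iF; rewrite /F /=.
have -> : (\int[mu]_x \int[mu]_y (u y * k (y * x) * a x)%:E =
   \int[mu]_xi ((\int[mu]_x (u x * k (x * xi))) * a xi)%:E)%E.
  apply: eq_integral => xi _; rewrite mulrC -(RintZ _ (iuk xi)) EFin_Rint; last exact: integrable_scale (iuk xi).
  by apply: eq_integral => x _; rewrite mulrC.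
have -> : (\int[mu]_y \int[mu]_x (u y * k (y * x) * a x)%:E =
   \int[mu]_x (u x * \int[mu]_xi (a xi * k (xi * x)))%:E)%E.
  apply: eq_integral => x _; rewrite -(RintZ _ (iak x)) EFin_Rint; last exact: integrable_scale (iak x).
  by apply: eq_integral => xi _; congr EFin; rewrite [xi * x]mulrC; ring.
by move=> h; rewrite /Rintegral h.
Qed.

Lemma Ct_mul u a : L1 u -> L1 a ->
  \int[mu]_xi (Ct u xi * a xi) = \int[mu]_x (u x * Ct a x).
Proof.
by move=> iu ia; apply: multiplication_kernel => //;
  [exact: continuous_cos|exact: cos_max].
Qed.

Lemma St_mul u a : L1 u -> L1 a ->
  \int[mu]_xi (St u xi * a xi) = \int[mu]_x (u x * St a x).
Proof.
by move=> iu ia; apply: multiplication_kernel => //;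
  [exact: continuous_sin|exact: sin_max].
Qed.

Definition ind (n : nat) x : R := \1_(`[- n%:R, n%:R]%classic) x.
(** The truncation whose Fourier integral occurs in the definition of the transform
as a limit in mean. *)
Definition trunc (n : nat) f : cfun R := fun x => (ind n x)%:C * f x.

Lemma ind01 n x : 0 <= ind n x <= 1.
Proof. by rewrite /ind indicE; case: (_ \in _); rewrite /= lexx ler01. Qed.

Lemma ind_idem n x : ind n x * ind n x = ind n x.
Proof. by rewrite /ind indicE; case: (_ \in _); rewrite /= ?mulr1 ?mulr0. Qed.

Lemma L1_ind n : L1 (ind n).
Proof. exact: (integrable_indic_itv (- n%:R) n%:R true false). Qed.

Lemma measurable_ind n : measurable_fun setT (ind n).
Proof. exact: L1_meas (L1_ind n). Qed.

Lemma ind_near x : \forall n \near \oo, ind n x = 1.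
Proof.
near=> n; rewrite /ind indicE mem_set//= in_itv/= -ler_norml.
by near: n; exact: nbhs_infty_ger.
Unshelve. all: by end_near. Qed.

Lemma trunc_Re n f x : complex.Re (trunc n f x) = ind n x * complex.Re (f x).
Proof. by rewrite /trunc ReM RCE mul0r subr0. Qed.
Lemma trunc_Im n f x : complex.Im (trunc n f x) = ind n x * complex.Im (f x).
Proof. by rewrite /trunc ImM RCE mul0r addr0. Qed.

Lemma sqc_trunc n f x : sqc (trunc n f x) = ind n x * sqc (f x).
Proof. by rewrite /trunc sqcM sqc_real expr2 ind_idem. Qed.

Lemma cmeas_trunc n f : cmeas f -> cmeas (trunc n f).
Proof.
by move=> mf; apply: cmeasM => //; apply: cmeas_real; exact: measurable_ind.
Qed.

Lemma trunc_L2 n f : L2 f -> L2 (trunc n f).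
Proof.
move=> lf; apply: proj1 (@L2_leK _ _ f 1 _ lf _); first exact/cmeas_trunc/L2_cmeas.
apply: aeW => x; rewrite sqc_trunc mul1r ler_piMl ?sqc_ge0//.
by have /andP[] := ind01 n x.
Qed.

Lemma ind_mul_L1 n u : measurable_fun setT u -> L1 (fun x => u x ^+ 2) ->
  L1 (fun x => ind n x * u x).
Proof.
move=> mU iu; apply: (@ae_le_integrable _ _ (fun x => ind n x + u x ^+ 2)).
- by apply: measurable_funM => //; exact: measurable_ind.
- by apply: L1D => //; exact: L1_ind.
apply: aeW => x; rewrite normrM -(real_normK (num_real (u x))).
have := normr_ge0 (u x); move: (`|u x|) => t t0.
rewrite /ind indicE; case: (_ \in _) => /=; last by rewrite normr0 mul0r add0r sqr_ge0.
rewrite normr1; have := sqr_ge0 (t - 1); nra.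
Qed.

Lemma trunc_cL1 n f : L2 f -> cL1 (trunc n f).
Proof.
move=> lf; have [mr mi] := L2_cmeas lf; split.
  under eq_fun do rewrite trunc_Re.
  by apply: ind_mul_L1 => //; exact: L2_Re_sqr.
under eq_fun do rewrite trunc_Im.
by apply: ind_mul_L1 => //; exact: L2_Im_sqr.
Qed.

Lemma Rint_ind n u : \int[mu]_(x in `[- n%:R, n%:R]) u x = \int[mu]_x (ind n x * u x).
Proof.
rewrite Rintegral_mkcond; apply: eq_Rintegral => x _.
by rewrite patchE /ind indicE; case: (_ \in _); rewrite /= ?mul1r ?mul0r.
Qed.

Lemma truncated_fourierE f n : L2 f -> truncated_fourier f n = Fhat (trunc n f).
Proof.
move=> lf; have [ir ii] := trunc_cL1 n lf; apply/funext => xi.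
rewrite /truncated_fourier /cintegral !Rint_ind /Fhat; congr (_ +i* _).
  rewrite /Ct /St -RintD; [|exact: L1_cos|exact: L1_sin].
  apply: eq_Rintegral => x _; rewrite trunc_Re trunc_Im ReM /= cosN sinN; ring.
rewrite /Ct /St -RintB; [|exact: L1_cos|exact: L1_sin].
apply: eq_Rintegral => x _; rewrite trunc_Re trunc_Im ImM /= cosN sinN; ring.
Qed.

Lemma cvg_Rint_dct (F : nat -> R -> R) (G b : R -> R) :
  (forall n, measurable_fun setT (F n)) -> measurable_fun setT G -> L1 b ->
  {ae mu, forall x, F n x @[n --> \oo] --> G x} ->
  (forall n, {ae mu, forall x, `|F n x| <= b x}) ->
  \int[mu]_x F n x @[n --> \oo] --> \int[mu]_x G x.
Proof.
move=> mF mG ib FG Fb.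
have ae : {ae mu, forall x n, setT x -> (`|(F n x)%:E| <= (b x)%:E)%E}.
  have : {ae mu, forall x, forall n, `|F n x| <= b x}.
    pose N := \bigcup_n [set x | ~ (`|F n x| <= b x)].
    have : mu.-negligible N by apply: negligible_bigcup => n; exact: Fb.
    apply: negligibleS => x /= /existsNP[n hn]; by exists n.
  by apply: ae_imp => x hx n _; rewrite lee_fin.
have aec : {ae mu, forall x, setT x -> (F n x)%:E @[n --> \oo] --> (G x)%:E}.
  by apply: ae_imp FG => x h _; apply: cvg_EFin h; exact: nearW.
have mEF n : measurable_fun setT (fun x => (F n x)%:E) by apply/measurable_EFinP; exact: mF.
have mEG : measurable_fun setT (fun x => (G x)%:E) by apply/measurable_EFinP; exact: mG.
have [ig _] := @dominated_convergence _ _ R mu setT measurableT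
  (fun n x => (F n x)%:E) (EFin \o G) (EFin \o b) mEF mEG aec ib ae.
by rewrite -(EFin_Rint ig) => /fine_cvg.
Qed.

Lemma L2sq_dct (w : nat -> cfun R) (b : R -> R) : (forall n, cmeas (w n)) -> L1 b ->
  (forall n, {ae mu, forall x, sqc (w n x) <= b x}) ->
  {ae mu, forall x, sqc (w n x) @[n --> \oo] --> 0} ->
  L2sq (w n) @[n --> \oo] --> (0 : R).
Proof.
move=> mw ib wb w0.
have := @cvg_Rint_dct (fun n x => sqc (w n x)) (cst 0) b
  (fun n => cmeas_sqc (mw n)) (measurable_cst _) ib w0.
rewrite Rintegral_cst// mul0r; apply => n.
by apply: ae_imp (wb n) => x; rewrite ger0_norm ?sqc_ge0.
Qed.

Lemma trunc_cvg f : L2 f -> L2sq (fun x => trunc n f x - f x) @[n --> \oo] --> (0 : R).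
Proof.
move=> lf; have mf := L2_cmeas lf.
have sE n x : sqc (trunc n f x - f x) = (1 - ind n x) * sqc (f x).
  rewrite (_ : _ - _ = (ind n x - 1)%:C * f x); last first.
    by rewrite /trunc rmorphB rmorph1 mulrBl mul1r.
  by rewrite sqcM sqc_real; congr (_ * _); have := ind_idem n x; move: (ind n x) => i; rewrite expr2; lra.
apply: (@L2sq_dct _ (fun x => sqc (f x))).
- by move=> n; apply: cmeasD; [exact: cmeas_trunc|exact: cmeasN].
- exact: L2_int.
- move=> n; apply: aeW => x; rewrite sE ler_piMl ?sqc_ge0//.
  by have /andP[] := ind01 n x; lra.
- apply: aeW => x; apply: cvg_near_cst.
  by apply: filterS (ind_near x) => n h; rewrite sE h subrr mul0r.
Qed.

Lemma cL1D f g : cL1 f -> cL1 g -> cL1 (fun x => f x + g x).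
Proof.
move=> [fr fi] [gr gi]; split.
  by under eq_fun do rewrite ReD; exact: L1D.
by under eq_fun do rewrite ImD; exact: L1D.
Qed.

Lemma cL1Z z f : cL1 f -> cL1 (fun x => z * f x).
Proof.
move=> [fr fi]; split.
  by under eq_fun do rewrite ReM; apply: L1B; exact: integrable_scale.
by under eq_fun do rewrite ImM; apply: L1D; exact: integrable_scale.
Qed.

Lemma FhatD f g xi : cL1 f -> cL1 g -> Fhat (fun x => f x + g x) xi = Fhat f xi + Fhat g xi.
Proof.
move=> [fr fi] [gr gi]; rewrite /Fhat.
have rE : (fun x => complex.Re (f x + g x)) = (fun x => complex.Re (f x) + complex.Re (g x)).
  by apply/funext => x; rewrite ReD.
have iE : (fun x => complex.Im (f x + g x)) = (fun x => complex.Im (f x) + complex.Im (g x)).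
  by apply/funext => x; rewrite ImD.
rewrite rE iE.
by rewrite !CtD// !StD//; congr (_ +i* _); ring.
Qed.

Lemma FhatZ z f xi : cL1 f -> Fhat (fun x => z * f x) xi = z * Fhat f xi.
Proof.
move=> [fr fi].
have rE : (fun x => complex.Re (z * f x)) = (fun x => complex.Re z * complex.Re (f x) - complex.Im z * complex.Im (f x)).
  by apply/funext => x; rewrite ReM.
have iE : (fun x => complex.Im (z * f x)) = (fun x => complex.Re z * complex.Im (f x) + complex.Im z * complex.Re (f x)).
  by apply/funext => x; rewrite ImM.
rewrite /Fhat rE iE.
have [a1 a2] := (integrable_scale (complex.Re z) fr, integrable_scale (complex.Im z) fr).
have [a3 a4] := (integrable_scale (complex.Re z) fi, integrable_scale (complex.Im z) fi).
rewrite CtB// StB// CtD// StD// !CtZ// !StZ//.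
by move: z a1 a2 a3 a4 rE iE => [c d] /= _ _ _ _ _ _; congr (_ +i* _); ring.
Qed.

Lemma FhatB f g xi : cL1 f -> cL1 g -> Fhat (fun x => f x - g x) xi = Fhat f xi - Fhat g xi.
Proof.
move=> cf cg; transitivity (Fhat (fun x => f x + -1 * g x) xi).
  by congr (Fhat _ xi); apply/funext => x; rewrite mulN1r.
by rewrite FhatD ?FhatZ ?mulN1r//; exact: cL1Z.
Qed.

Lemma L2_fin f : L2 f -> L2enorm f = (L2norm f)%:E.
Proof.
move=> [_ _ h]; rewrite /L2norm fineK// ge0_fin_numE//.
exact: Lnorm_ge0.
Qed.

Lemma L2norm_ge0 f : 0 <= L2norm f.
Proof. by apply: fine_ge0; exact: Lnorm_ge0. Qed.

Lemma L2norm_sqrt f : L2norm f = Num.sqrt (L2sq f).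
Proof. by rewrite -L2norm_sqr sqrtr_sqr ger0_norm// L2norm_ge0. Qed.

Lemma L2enorm_cvg0 (w : nat -> cfun R) : (forall n, L2 (w n)) ->
  L2enorm (w n) @[n --> \oo] --> (0 : \bar R)%E <-> L2sq (w n) @[n --> \oo] --> (0 : R).
Proof.
move=> lorentz.
have -> : (fun n => L2enorm (w n)) = (fun n => (L2norm (w n))%:E).
  by apply/funext => n; exact: L2_fin.
split=> [/fine_cvg h|h].
  rewrite -(mulr0 0); under eq_fun do rewrite -L2norm_sqr expr2.
  by apply: cvgM; exact: h.
apply: cvg_EFin; first exact: nearW.
have -> : fine \o (fun n => (L2norm (w n))%:E) = Num.sqrt \o (fun n => L2sq (w n)).
  by apply/funext => n /=; rewrite L2norm_sqrt.
by have := cvg_comp _ _ h (@sqrt_continuous R 0); rewrite sqrtr0.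
Qed.

(** On truncations the Fourier integral converges absolutely, so that the theory of
integrable functions applies to them. *)
Lemma is_fourierP f g : is_fourier f g <->
  [/\ L2 f, L2 g & L2sq (fun xi => Fhat (trunc n f) xi - g xi) @[n --> \oo] --> (0 : R)].
Proof.
have key : L2 f -> L2 g -> (L2enorm (fun xi => truncated_fourier f n xi - g xi)
     @[n --> \oo] --> (0 : \bar R)%E <-> L2sq (fun xi => Fhat (trunc n f) xi - g xi) @[n --> \oo] --> (0 : R)).
  move=> lf lg; rewrite -L2enorm_cvg0; last first.
    move=> n; apply: L2B => //.
    by have [] := plancherel_L1 (trunc_cL1 n lf) (trunc_L2 n lf).
  by under eq_fun do rewrite truncated_fourierE//.
by split=> -[lf lg h]; split => //; apply/key.
Qed.

Lemma sqr_cvg0 (s e : nat -> R) : (forall n, s n ^+ 2 <= e n) ->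
  e n @[n --> \oo] --> (0 : R) -> s n @[n --> \oo] --> (0 : R).
Proof.
move=> se /cvgrPdist_lt e0; apply/cvgrPdist_lt => ep ep0.
have /e0 : 0 < ep ^+ 2 by rewrite exprn_gt0.
apply: filterS => n; rewrite !sub0r !normrN => h.
have : `|s n| ^+ 2 < ep ^+ 2.
  by rewrite real_normK ?num_real// (le_lt_trans (se n))// (le_lt_trans (ler_norm _)).
by rewrite ltr_pXn2r// nnegrE// (ltW ep0).
Qed.

Lemma L2dot_cvg h g (w : nat -> cfun R) : L2 h -> L2 g -> (forall n, L2 (w n)) ->
  L2sq (fun x => w n x - g x) @[n --> \oo] --> (0 : R) ->
  L2dot h (w n) @[n --> \oo] --> L2dot h g.
Proof.
move=> lh lg lorentz c.
have lwg n : L2 (fun x => w n x - g x) by exact: L2B.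
have c0 : L2dot h (fun x => w n x - g x) @[n --> \oo] --> (0 : R).
  apply: (@sqr_cvg0 _ (fun n => L2sq h * L2sq (fun x => w n x - g x))).
    by move=> n; exact: L2dot_sqr_le.
  by rewrite -(mulr0 (L2sq h)); apply: cvgM => //; exact: cvg_cst.
have -> : (fun n => L2dot h (w n)) = (fun n => L2dot h (fun x => w n x - g x) + L2dot h g).
  apply/funext => n; rewrite -L2dotDr//; congr L2dot; apply/funext => x; by rewrite subrK.
by rewrite -[X in _ --> X]add0r; apply: cvgD => //; exact: cvg_cst.
Qed.

Lemma L2sq_cvg g (w : nat -> cfun R) : L2 g -> (forall n, L2 (w n)) ->
  L2sq (fun x => w n x - g x) @[n --> \oo] --> (0 : R) -> L2sq (w n) @[n --> \oo] --> L2sq g.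
Proof.
move=> lg lorentz c; have d := L2dot_cvg lg lg lorentz c.
have -> : (fun n => L2sq (w n)) = (fun n => L2sq (fun x => w n x - g x) + 2 * L2dot g (w n) - L2sq g).
  by apply/funext => n; rewrite L2sqB_eq// [L2dot (w n) g]L2dotC; ring.
have e : L2sq g = 0 + 2 * L2dot g g - L2sq g.
  have -> : L2dot g g = L2sq g by apply: eq_Rintegral => x _; rewrite /sqc; ring.
  ring.
rewrite [X in _ --> X]e; apply: cvgB; last exact: cvg_cst.
by apply: cvgD => //; apply: cvgM => //; exact: cvg_cst.
Qed.

Lemma L2dot_cvg2 f g (w w' : nat -> cfun R) : L2 f -> L2 g -> (forall n, L2 (w n)) ->
  (forall n, L2 (w' n)) ->
  L2sq (fun x => w n x - f x) @[n --> \oo] --> (0 : R) ->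
  L2sq (fun x => w' n x - g x) @[n --> \oo] --> (0 : R) ->
  L2dot (w n) (w' n) @[n --> \oo] --> L2dot f g.
Proof.
move=> lf lg lorentz lw' c c'.
have lwf n : L2 (fun x => w n x - f x) by exact: L2B.
have d := L2sq_cvg lg lw' c'.
have c0 : L2dot (w' n) (fun x => w n x - f x) @[n --> \oo] --> (0 : R).
  apply: (@sqr_cvg0 _ (fun n => L2sq (w' n) * L2sq (fun x => w n x - f x))).
    by move=> n; exact: L2dot_sqr_le.
  by rewrite -(mulr0 (L2sq g)); apply: cvgM.
have -> : (fun n => L2dot (w n) (w' n)) =
    (fun n => L2dot (w' n) (fun x => w n x - f x) + L2dot f (w' n)).
  apply/funext => n; rewrite [L2dot f _]L2dotC -L2dotDr// L2dotC; congr L2dot.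
  by apply/funext => x; rewrite subrK.
by rewrite -[X in _ --> X]add0r; apply: cvgD => //; exact: L2dot_cvg.
Qed.

Lemma trunc_L2_cvg f : L2 f -> [/\ forall n, L2 (trunc n f), forall n, cL1 (trunc n f),
  forall n, L2 (Fhat (trunc n f)) & forall n, L2sq (Fhat (trunc n f)) = 2 * kappa * L2sq (trunc n f)].
Proof.
move=> lf; split=> n; [exact: trunc_L2|exact: trunc_cL1|..];
  by have [] := plancherel_L1 (trunc_cL1 n lf) (trunc_L2 n lf).
Qed.

(** The transforms of the truncations form a Cauchy sequence, by [plancherel_L1]
applied to their differences. *)
Lemma fourier_exists f : L2 f -> exists g, is_fourier f g.
Proof.
move=> lf; have [lt ct lF _] := trunc_L2_cvg lf.
have k0 := @kappa_gt0 R.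
suff [g [lg c]] : exists g, L2 g /\ L2sq (fun xi => Fhat (trunc n f) xi - g xi) @[n --> \oo] --> (0 : R).
  by exists g; apply/is_fourierP.
apply: L2_complete => // e e0.
have e8 : 0 < e / (8 * kappa) by rewrite divr_gt0// mulr_gt0.
have /cvgrPdist_lt/(_ _ e8)[N _ hN] := trunc_cvg lf.
exists N => m n Nm Nn.
have hm : L2sq (fun x => trunc m f x - f x) < e / (8 * kappa).
  by have := hN m Nm; rewrite /= sub0r normrN ger0_norm// L2sq_ge0.
have hn : L2sq (fun x => trunc n f x - f x) < e / (8 * kappa).
  by have := hN n Nn; rewrite /= sub0r normrN ger0_norm// L2sq_ge0.
have -> : (fun x => Fhat (trunc m f) x - Fhat (trunc n f) x) =
          Fhat (fun x => trunc m f x - trunc n f x).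
  by apply/funext => xi; rewrite FhatB.
have ltm : L2 (fun x => trunc m f x - trunc n f x) by exact: L2B.
have ctm : cL1 (fun x => trunc m f x - trunc n f x).
  have := cL1D (ct m) (cL1Z (-1) (ct n)); congr cL1; apply/funext => x.
  by rewrite mulN1r.
have [_ ->] := plancherel_L1 ctm ltm.
have : L2sq (fun x => trunc m f x - trunc n f x) <= 2 * (e / (8 * kappa)) + 2 * (e / (8 * kappa)).
  have -> : (fun x => trunc m f x - trunc n f x) =
     (fun x => (trunc m f x - f x) - (trunc n f x - f x)).
    by apply/funext => x; rewrite opprB addrA subrK.
  apply: le_trans (L2sqB (L2B (lt m) lf) (L2B (lt n) lf)) _.
  by move: hm hn; lra.
move=> h; have k20 : 0 <= 2 * kappa :> R by rewrite mulr_ge0// ltW.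
apply: le_trans (ler_wpM2l k20 h) _.
by rewrite le_eqVlt; apply/orP; left; apply/eqP; field; rewrite gt_eqF.
Qed.

Lemma fourier_isometry f g : is_fourier f g -> L2sq g = 2 * kappa * L2sq f.
Proof.
move=> /is_fourierP[lf lg c]; have [lt ct lF FN] := trunc_L2_cvg lf.
have h1 := L2sq_cvg lg lF c.
have h2 : L2sq (Fhat (trunc n f)) @[n --> \oo] --> 2 * kappa * L2sq f.
  under eq_fun do rewrite FN.
  apply: cvgM; first exact: cvg_cst.
  exact: (L2sq_cvg lf lt (trunc_cvg lf)).
exact: (cvg_unique _ h1 h2).
Qed.

Lemma fourier_unique f g g' : is_fourier f g -> is_fourier f g' -> aeeq g g'.
Proof.
move=> /is_fourierP[lf lg c] /is_fourierP[_ lg' c'].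
have [lt ct lF FN] := trunc_L2_cvg lf.
apply: L2sqB_eq0 => //; apply/eqP; rewrite eq_le L2sq_ge0 andbT.
have h : (2 * L2sq (fun xi => Fhat (trunc n f) xi - g' xi) + 2 * L2sq (fun xi => Fhat (trunc n f) xi - g xi))
   @[n --> \oo] --> (0 : R).
  rewrite -(addr0 0) -{1 2}(mulr0 2).
  by apply: cvgD; apply: cvgM => //; exact: cvg_cst.
have -> : L2sq (fun x => g x - g' x) = lim ((L2sq (fun x => g x - g' x)) @[n --> \oo]).
  by rewrite lim_cst.
rewrite -(cvg_lim _ h)//; apply: ler_lim; first exact: is_cvg_cst.
  by apply/cvg_ex; exists 0.
apply: nearW => n.
have -> : (fun x => g x - g' x) = (fun xi => (Fhat (trunc n f) xi - g' xi) - (Fhat (trunc n f) xi - g xi)).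
  by apply/funext => x; rewrite opprB addrCA [in RHS]addrAC subrr add0r.
exact: L2sqB (L2B (lF n) lg') (L2B (lF n) lg).
Qed.

Lemma fourier_lin z f fh g gh : is_fourier f fh -> is_fourier g gh ->
  is_fourier (fun x => z * f x + g x) (fun x => z * fh x + gh x).
Proof.
move=> /is_fourierP[lf lfh c] /is_fourierP[lg lgh c'].
have [lt ct lF FN] := trunc_L2_cvg lf.
have [lt' ct' lF' FN'] := trunc_L2_cvg lg.
apply/is_fourierP; split; [exact: L2D (L2Z _ _) _|exact: L2D (L2Z _ _) _|].
have E n : (fun xi => Fhat (trunc n (fun x => z * f x + g x)) xi - (z * fh xi + gh xi)) =
  (fun xi => z * (Fhat (trunc n f) xi - fh xi) + (Fhat (trunc n g) xi - gh xi)).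
  apply/funext => xi.
  have -> : trunc n (fun x => z * f x + g x) = (fun x => z * trunc n f x + trunc n g x).
    by apply/funext => x; rewrite /trunc; ring.
  by rewrite FhatD// ?FhatZ//; [ring|exact: cL1Z].
under eq_fun do rewrite E.
have h : (2 * (sqc z * L2sq (fun xi => Fhat (trunc n f) xi - fh xi)) +
  2 * L2sq (fun xi => Fhat (trunc n g) xi - gh xi)) @[n --> \oo] --> (0 : R).
  have -> : (0 : R) = 2 * (sqc z * 0) + 2 * 0 by rewrite !mulr0 addr0.
  apply: cvgD; apply: cvgM => //; try exact: cvg_cst.
  by apply: cvgM => //; exact: cvg_cst.
apply: (squeeze_cvgr _ (cvg_cst 0) h); apply: nearW => n; rewrite L2sq_ge0 /=.
rewrite -L2sqZ; last exact: L2B.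
by apply: L2sqD; [apply: L2Z; exact: L2B|exact: L2B].
Qed.

Lemma fourier_ae f f' g g' : is_fourier f g -> cmeas f' -> aeeq f f' ->
  cmeas g' -> aeeq g g' -> is_fourier f' g'.
Proof.
move=> /is_fourierP[lf lg c] mf' ff mg' gg.
have lf' := L2_ae mf' ff lf; have lg' := L2_ae mg' gg lg.
apply/is_fourierP; split => //.
have [_ ct _ _] := trunc_L2_cvg lf; have [_ ct' _ _] := trunc_L2_cvg lf'.
have aeR u v (k : R -> R) : L1 (fun x => u x * k x) -> L1 (fun x => v x * k x) ->
   {ae mu, forall x, u x = v x} ->
   \int[mu]_x (u x * k x) = \int[mu]_x (v x * k x).
  move=> i1 i2 uv; congr fine; apply: ae_eq_integral => //.
  - exact: measurable_int i1.
  - exact: measurable_int i2.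
  - by apply: ae_imp uv => x -> _.
have FE n : Fhat (trunc n f') = Fhat (trunc n f).
  apply/funext => xi; have [i1 i2] := ct n; have [i1' i2'] := ct' n.
  have tr : {ae mu, forall x, complex.Re (trunc n f' x) = complex.Re (trunc n f x)}.
    by apply: ae_imp ff => x; rewrite /trunc => ->.
  have ti : {ae mu, forall x, complex.Im (trunc n f' x) = complex.Im (trunc n f x)}.
    by apply: ae_imp ff => x; rewrite /trunc => ->.
  congr (_ +i* _); congr (_ + _); rewrite ?/Ct ?/St; try congr (- _); apply: aeR => //;
    by [exact: L1_cos|exact: L1_sin].
have -> : (fun n => L2sq (fun xi => Fhat (trunc n f') xi - g' xi)) =
          (fun n => L2sq (fun xi => Fhat (trunc n f) xi - g xi)).
  apply/funext => n; apply: L2sq_ae.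
  - rewrite FE; apply: cmeasD; [exact: cmeas_Fhat|exact: cmeasN].
  - by apply: cmeasD; [exact: cmeas_Fhat|apply: cmeasN; exact: L2_cmeas].
  - by apply: ae_imp gg => x ->; rewrite FE.
exact: c.
Qed.

Lemma fourier_inj f g f' g' : is_fourier f g -> is_fourier f' g' -> aeeq g g' -> aeeq f f'.
Proof.
move=> ff ff' gg; have h := fourier_lin (-1) ff' ff.
have [lf lg _] := ff; have [lf' lg' _] := ff'.
have := fourier_isometry h.
have -> : L2sq (fun x => -1 * g' x + g x) = 0.
  rewrite -[RHS](@L2sq0 R); apply: L2sq_ae.
  - by apply: cmeasD; [apply: cmeasM; [exact: cmeas_cst|exact: L2_cmeas]|exact: L2_cmeas].
  - exact: cmeas_cst.
  - by apply: ae_imp gg => x ->; rewrite mulN1r addNr.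
move=> /esym/eqP; rewrite mulf_eq0 mulf_eq0 pnatr_eq0/= gt_eqF ?kappa_gt0//= => /eqP h0.
apply: L2sqB_eq0 => //; rewrite -[RHS]h0; congr L2sq; apply/funext => x.
by rewrite mulN1r addrC.
Qed.

Definition conjf f : cfun R := fun x => complex.Re (f x) +i* - complex.Im (f x).

Lemma sqc_conjf f x : sqc (conjf f x) = sqc (f x).
Proof. by rewrite /sqc /= sqrrN. Qed.

Lemma cmeas_conjf f : cmeas f -> cmeas (conjf f).
Proof. by move=> [mr mi]; split => //=; exact: measurable_funN. Qed.

Lemma L2_conjf f : L2 f -> L2 (conjf f).
Proof.
move=> lf; apply: proj1 (@L2_leK _ _ f 1 _ lf _); first exact/cmeas_conjf/L2_cmeas.
by apply: aeW => x; rewrite sqc_conjf mul1r.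
Qed.

Lemma L2sq_conjf f : L2sq (conjf f) = L2sq f.
Proof. by apply: eq_Rintegral => x _; rewrite sqc_conjf. Qed.

Lemma L1_CtM u a : L1 u -> L1 a -> L1 (fun x => Ct u x * a x).
Proof.
move=> iu ia; have iun : L1 (fun x => `|u x|) by have /integrable_norm := iu.
apply: (@ae_le_integrable _ _ (fun x => \int[mu]_y `|u y| * `|a x|)).
- by apply: measurable_funM; [exact: measurable_Ct|exact: L1_meas].
- by apply: integrable_scale; have /integrable_norm := ia.
apply: aeW => x; rewrite normrM ler_wpM2r//.
apply: le_trans (le_normr_Rintegral measurableT (L1_cos x iu)) _.
apply: le_Rintegral => //; first by have /integrable_norm := L1_cos x iu.
by move=> y _; rewrite normrM ler_piMr// cos_max.
Qed.

Lemma L1_StM u a : L1 u -> L1 a -> L1 (fun x => St u x * a x).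
Proof.
move=> iu ia; have iun : L1 (fun x => `|u x|) by have /integrable_norm := iu.
apply: (@ae_le_integrable _ _ (fun x => \int[mu]_y `|u y| * `|a x|)).
- by apply: measurable_funM; [exact: measurable_St|exact: L1_meas].
- by apply: integrable_scale; have /integrable_norm := ia.
apply: aeW => x; rewrite normrM ler_wpM2r//.
apply: le_trans (le_normr_Rintegral measurableT (L1_sin x iu)) _.
apply: le_Rintegral => //; first by have /integrable_norm := L1_sin x iu.
by move=> y _; rewrite normrM ler_piMr// sin_max.
Qed.

(** The multiplication formula; the conjugations account for the sign in the
exponential. *)
Lemma Fhat_adjoint f g : cL1 f -> cL1 g ->
  L2dot (Fhat f) g = L2dot f (conjf (Fhat (conjf g))).
Proof.
move=> [iu iv] [ia ib].
set u := fun x => complex.Re (f x); set v := fun x => complex.Im (f x).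
set a := fun x => complex.Re (g x); set b := fun x => complex.Im (g x).
have [[[i1 i2] i3] i4] := (L1_CtM iu ia, L1_StM iv ia, L1_CtM iv ib, L1_StM iu ib).
transitivity (\int[mu]_x (Ct u x * a x) + \int[mu]_x (St v x * a x) +
   \int[mu]_x (Ct v x * b x) - \int[mu]_x (St u x * b x)).
  rewrite -(RintD i1 i2) -(RintD (L1D i1 i2) i3) -(RintB (L1D (L1D i1 i2) i3) i4).
  by apply: eq_Rintegral => x _; rewrite /Fhat /= /a /b; ring.
rewrite !Ct_mul// !St_mul//.
have sw p q (T : (R -> R) -> R -> R) : L1 (fun x => T q x * p x) -> L1 (fun x => p x * T q x).
  by apply: eq_integrable => // x _ /=; rewrite mulrC.
have j1 := sw _ _ Ct (L1_CtM ia iu); have j2 := sw _ _ St (L1_StM ia iv).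
have j3 := sw _ _ Ct (L1_CtM ib iv); have j4 := sw _ _ St (L1_StM ib iu).
rewrite -(RintD j1 j2) -(RintD (L1D j1 j2) j3) -(RintB (L1D (L1D j1 j2) j3) j4).
have bN : (fun x => complex.Im (conjf g x)) = (fun x => -1 * b x).
  by apply/funext => x; rewrite mulN1r.
apply: eq_Rintegral => x _; rewrite /Fhat bN /= CtZ// StZ//.
by rewrite /u /v -/a; ring.
Qed.

Lemma fourier_adjoint f fh g gh : L2 g -> is_fourier f fh -> is_fourier (conjf g) gh ->
  L2dot fh g = L2dot f (conjf gh).
Proof.
move=> lg /is_fourierP[lf lfh c] /is_fourierP[lcg lgh c'].
have [lt ct lF _] := trunc_L2_cvg lf; have [lt' ct' lF' _] := trunc_L2_cvg lcg.
have [ltg ctg _ _] := trunc_L2_cvg lg.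
have h1 := L2dot_cvg2 lfh lg lF ltg c (trunc_cvg lg).
have tcj n : trunc n (conjf g) = conjf (trunc n g).
  by apply/funext => x; rewrite /trunc /conjf !ReImE; case: (g x) => ? ? /=; congr (_ +i* _); ring.
have h2 : L2dot (trunc n f) (conjf (Fhat (trunc n (conjf g)))) @[n --> \oo] --> L2dot f (conjf gh).
  apply: L2dot_cvg2 => //; [exact: L2_conjf|by move=> n; exact: L2_conjf|exact: trunc_cvg|].
  have -> // : (fun n => L2sq (fun x => conjf (Fhat (trunc n (conjf g))) x - conjf gh x)) =
    (fun n => L2sq (fun x => Fhat (trunc n (conjf g)) x - gh x)).
  apply/funext => n; rewrite -L2sq_conjf; congr L2sq; apply/funext => x.
  by apply: complex_ext; rewrite /conjf !ReImE /= ?ReImE //; ring.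
have e : (fun n => L2dot (Fhat (trunc n f)) (trunc n g)) =
  (fun n => L2dot (trunc n f) (conjf (Fhat (trunc n (conjf g))))).
  apply/funext => n; rewrite (Fhat_adjoint (ct n) (ctg n)) (tcj n); reflexivity.
by rewrite e in h1; exact: (cvg_unique _ h1 h2).
Qed.

(** With k the transform of the candidate, isometry and the adjoint formula give
|k - g|^2 = |k|^2 - 2 <k, g> + |g|^2 = 0, whatever the value of kappa. *)
Lemma fourier_inverse g gh : L2 g -> is_fourier (conjf g) gh ->
  is_fourier (fun x => ((2 * kappa)^-1)%:C * conjf gh x) g.
Proof.
move=> lg fg; have [_ lgh _] := fg.
have k0 := @kappa_gt0 R.
set c : R := (2 * kappa)^-1; set f := fun x => c%:C * conjf gh x.
have lf : L2 f by apply: L2Z; exact: L2_conjf.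
have [k fk] := fourier_exists lf; have [_ lk _] := fk.
have Nk := fourier_isometry fk; have Ng := fourier_isometry fg.
have Nf : L2sq f = c ^+ 2 * L2sq gh by rewrite /f L2sqZ ?sqc_real ?L2sq_conjf//; exact: L2_conjf.
have dk : L2dot k g = c * L2sq gh.
  rewrite (fourier_adjoint lg fk fg) /f /L2sq -RintZ; last exact: L2_int.
  by apply: eq_Rintegral => x _; rewrite !ReImE /sqc /=; ring.
rewrite L2sq_conjf in Ng.
have kg : aeeq k g.
  apply: L2sqB_eq0 => //; rewrite L2sqB_eq// dk Nk Nf Ng /c; field; lra.
apply: fourier_ae fk _ _ _ kg; [exact: L2_cmeas|exact: aeeq_refl|exact: L2_cmeas].
Qed.

Lemma fourier_surj g : L2 g -> exists f, is_fourier f g.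
Proof.
move=> lg; have [gh fg] := fourier_exists (L2_conjf lg).
by exists (fun x => ((2 * kappa)^-1)%:C * conjf gh x); exact: fourier_inverse.
Qed.
End Fourier.

(** * The Fourier transform of a weak derivative *)

Section WeakFourier.
Context {R : realType}.
Local Notation mu := (@lebesgue_measure R).
Implicit Types (p u v a phi w : R -> R) (x y xi e : R) (f g h : cfun R) (z : R[i]).

(** The derivative is kept as a separate function, so that chain and product rules
give it in explicit form. *)
Definition C1 a (a' : R -> R) := (forall x, is_derive x 1 a (a' x)) /\ continuous a'.

(** A quadratic remainder is the simplest way to differentiate functions built
from [pos]. *)
Lemma is_derive_quad a x (d K : R) :
  (forall h : R, `|a (x + h) - a x - d * h| <= K * h ^+ 2) -> is_derive x 1 a d.
Proof.
move=> H.
have K0 : 0 <= K by have := H 1; rewrite expr1n !mulr1; exact: le_trans (normr_ge0 _).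
have c : (fun h : R => h^-1 *: (a (h *: (1 : R) + x) - a x)) @ (0 : R)^' --> d.
  apply/cvgrPdist_lt => e e0.
  have K1 : 0 < K + 1 by lra.
  near=> h.
  have h0 : h != 0 by near: h; exact: nbhs_dnbhs_neq.
  have he : `|h| < e / (K + 1).
    near: h; apply: dnbhs0_lt; exact: divr_gt0.
  rewrite distrC /GRing.scale /= mulr1 [h + x]addrC.
  have -> : h^-1 * (a (x + h) - a x) - d = h^-1 * (a (x + h) - a x - d * h) by field.
  rewrite normrM normfV mulrC ltr_pdivrMr ?normr_gt0//.
  apply: le_lt_trans (H h) _; rewrite -(real_normK (num_real h)) expr2 mulrA.
  rewrite ltr_pM2r ?normr_gt0//.
  move: he; rewrite ltr_pdivlMr// => he; apply: le_lt_trans he.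
  by rewrite mulrC ler_wpM2l// lerDl.
split; first by apply/cvg_ex; exists d.
by apply/cvg_lim.
Unshelve. all: by end_near. Qed.

(** The positive part; its square is continuously differentiable, which makes it
a convenient building block for cutoff functions. *)
Definition pos (t : R) : R := (t + `|t|) / 2.

Lemma pos_sqr_derive (t : R) : is_derive t 1 (fun t : R => pos t ^+ 2) (2 * pos t).
Proof.
apply: (@is_derive_quad _ _ _ 1) => h; rewrite mul1r ler_norml /pos.
have [t0|t0] := leP 0 t; have [th|th] := leP 0 (t + h);
  rewrite ?(ger0_norm t0) ?(ltr0_norm t0) ?(ger0_norm th) ?(ltr0_norm th); apply/andP; split; nra.
Qed.

Lemma continuous_pos : continuous pos.
Proof.
move=> t; apply: cvgM; last exact: cvg_cst.
by apply: cvgD; [exact: cvg_id|apply: cvg_norm; exact: cvg_id].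
Qed.

Lemma derive1_is a x d : is_derive x 1 a d -> derive1 a x = d.
Proof. by move=> h; rewrite derive1E; exact: (@derive_val _ _ _ _ _ _ _ h). Qed.

Lemma C1_derive a a' x : C1 a a' -> derive1 a x = a' x.
Proof. by move=> [h _]; exact: derive1_is. Qed.

Lemma C1_continuous a a' : C1 a a' -> continuous a.
Proof.
move=> [h _] x; apply: differentiable_continuous; apply/derivable1_diffP.
by have [] := h x.
Qed.

Lemma C1M a a' b b' : C1 a a' -> C1 b b' ->
  C1 (fun x => a x * b x) (fun x => a' x * b x + a x * b' x).
Proof.
move=> Ca Cb; have [ha ca] := Ca; have [hb cb] := Cb; split.
  move=> x; have := ha x; have := hb x => hbx hax.
  apply: is_derive_eq; rewrite /GRing.scale /=; ring.
have c1 := C1_continuous Ca; have c2 := C1_continuous Cb.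
by move=> x; apply: cvgD; apply: cvgM; [exact: ca|exact: c2|exact: c1|exact: cb].
Qed.

Lemma test_funP phi : test_fun phi <-> C1 phi (derive1 phi) /\
  exists M : R, forall x, M < `|x| -> phi x = 0.
Proof.
split=> [[d c s]|[[d c] s]].
  split; last exact: s.
  by split; [move=> x; rewrite derive1E; exact: derivableP|exact: c].
split; [|exact: c|exact: s].
by move=> x; apply: ex_derive; exact: d.
Qed.

Lemma C1_test phi phi' : C1 phi phi' -> (exists M : R, forall x, M < `|x| -> phi x = 0) ->
  test_fun phi.
Proof.
move=> C s; apply/test_funP; split; last exact: s.
by rewrite (_ : derive1 phi = phi')//; apply/funext => x; exact: C1_derive C.
Qed.

(** A cutoff function on [-(n+1), n+1] that tends to 1 and whose derivative
is O(1/n), uniformly in x. *)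
Definition bump (n : nat) x : R := pos (1 - x ^+ 2 / n.+1%:R ^+ 2) ^+ 2.
Definition bump' (n : nat) x : R :=
  2 * pos (1 - x ^+ 2 / n.+1%:R ^+ 2) * (- (2 * x / n.+1%:R ^+ 2)).

Lemma C1_bump n : C1 (bump n) (bump' n).
Proof.
split.
  move=> x; have h := pos_sqr_derive (1 - x ^+ 2 / n.+1%:R ^+ 2).
  have h2 : is_derive x 1 (fun x : R => 1 - x ^+ 2 / n.+1%:R ^+ 2) (- (2 * x / n.+1%:R ^+ 2)).
    apply: is_derive_eq; rewrite /GRing.scale /=; ring.
  have := @is_derive1_comp _ (fun t : R => pos t ^+ 2)
    (fun x : R => 1 - x ^+ 2 / n.+1%:R ^+ 2) x _ _ h h2.
  exact.
move=> x; apply: cvgM.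
  apply: cvgM; first exact: cvg_cst.
  apply: (@continuous_comp _ _ _ (fun x : R => 1 - x ^+ 2 / n.+1%:R ^+ 2) pos); last exact: continuous_pos.
  apply: cvgB; first exact: cvg_cst.
  by apply: cvgM; [exact: exprn_continuous|exact: cvg_cst].
apply: cvgN; apply: cvgM; last exact: cvg_cst.
by apply: cvgM; [exact: cvg_cst|exact: cvg_id].
Qed.

Lemma pos_le0 t : t <= 0 -> pos t = 0.
Proof. by move=> t0; rewrite /pos ler0_norm// subrr mul0r. Qed.

Lemma pos_ge0 t : 0 <= pos t.
Proof. by rewrite /pos; have := ler_norm (- t); rewrite normrN; lra. Qed.

Lemma bump_arg n x : n.+1%:R < `|x| -> 1 - x ^+ 2 / n.+1%:R ^+ 2 <= 0.
Proof.
move=> h; rewrite subr_le0 ler_pdivlMr ?exprn_gt0// mul1r -(real_normK (num_real x)).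
by rewrite lerXn2r ?nnegrE// ltW.
Qed.

Lemma bump_out n x : n.+1%:R < `|x| -> bump n x = 0.
Proof. by move=> h; rewrite /bump pos_le0 ?expr0n// bump_arg. Qed.

Lemma bump'_out n x : n.+1%:R < `|x| -> bump' n x = 0.
Proof. by move=> h; rewrite /bump' pos_le0 ?mulr0 ?mul0r// bump_arg. Qed.

Lemma pos_le1 t : t <= 1 -> pos t <= 1.
Proof. by rewrite /pos => t1; have [t0|t0] := leP 0 t; rewrite ?(ger0_norm t0) ?(ltr0_norm t0); lra. Qed.

Lemma bump_pos_le1 n x : pos (1 - x ^+ 2 / n.+1%:R ^+ 2) <= 1.
Proof. by apply: pos_le1; rewrite gerBl divr_ge0 ?sqr_ge0. Qed.

Lemma bump01 n x : 0 <= bump n x <= 1.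
Proof. by rewrite /bump sqr_ge0 exprn_ile1 ?pos_ge0// bump_pos_le1. Qed.

Lemma ind_in n x : `|x| <= n%:R -> ind n x = 1.
Proof. by move=> h; rewrite /ind indicE mem_set//= in_itv/= -ler_norml. Qed.

Lemma ind_out n x (K : R) : K <> 0 -> (n%:R < `|x| -> K = 0) -> ind n x = 1.
Proof.
move=> K0 h; rewrite /ind indicE mem_set//= in_itv/= -ler_norml leNgt.
by apply/negP => /h.
Qed.

Lemma bump_le n x : `|bump n x| <= ind n.+1 x.
Proof.
have /andP[b0 b1] := bump01 n x; rewrite ger0_norm//.
have [h|h] := leP `|x| n.+1%:R; last by rewrite bump_out//; have /andP[] := ind01 n.+1 x.
by rewrite /ind indicE mem_set//= in_itv/= -ler_norml.
Qed.

Lemma bump'_le n x : `|bump' n x| <= 4 / n.+1%:R * ind n.+1 x.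
Proof.
have [h|h] := leP `|x| n.+1%:R; last first.
  by rewrite bump'_out// normr0 mulr_ge0//; have /andP[] := ind01 n.+1 x.
rewrite (ind_in h) mulr1 /bump'.
set P := pos _; have P1 : P <= 1 by exact: bump_pos_le1.
have P0 : 0 <= P by exact: pos_ge0.
have N0 : 0 < n.+1%:R :> R by [].
move: (n.+1%:R : R) N0 h P P1 P0 => N N0 h P P1 P0.
have N2 : 0 < N ^+ 2 by rewrite exprn_gt0.
rewrite (_ : 2 * P * - (2 * x / N ^+ 2) = - (4 * P / N ^+ 2 * x)); last by ring.
rewrite normrN normrM ger0_norm; last by rewrite divr_ge0 ?mulr_ge0// ltW.
have -> : 4 / N = 4 * 1 / N ^+ 2 * N by field; rewrite gt_eqF.
apply: ler_pM => //; first by rewrite divr_ge0 ?mulr_ge0// ltW.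
by rewrite ler_pM2r ?invr_gt0// ler_wpM2l.
Qed.

Lemma bump_cvg x : bump n x @[n --> \oo] --> (1 : R).
Proof.
have -> : (1 : R) = pos (1 - x ^+ 2 * (0 * 0)) ^+ 2.
  by rewrite mulr0 mulr0 subr0 /pos normr1; field.
have h : (fun n => 1 - x ^+ 2 * (n.+1%:R^-1 * n.+1%:R^-1)) @ \oo --> (1 - x ^+ 2 * (0 * 0) : R).
  apply: cvgB; first exact: cvg_cst.
  apply: cvgM; first exact: cvg_cst.
  by apply: cvgM; exact: cvg_harmonic.
have h2 := cvg_comp _ _ h (@continuous_pos _).
have -> : bump ^~ x = (fun n => (pos \o (fun n => 1 - x ^+ 2 * (n.+1%:R^-1 * n.+1%:R^-1))) n ^+ 2).
  by apply/funext => n; rewrite /bump /= -invfM expr2.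
by rewrite [X in _ --> X]expr2; under eq_fun do rewrite expr2; exact: cvgM.
Qed.

Definition mulc (w : R -> R) f : cfun R := fun x => (w x)%:C * f x.

Lemma mulc_Re w f x : complex.Re (mulc w f x) = w x * complex.Re (f x).
Proof. by rewrite /mulc ReM RCE mul0r subr0. Qed.
Lemma mulc_Im w f x : complex.Im (mulc w f x) = w x * complex.Im (f x).
Proof. by rewrite /mulc ImM RCE mul0r addr0. Qed.
Lemma sqc_mulc w f x : sqc (mulc w f x) = w x ^+ 2 * sqc (f x).
Proof. by rewrite /mulc sqcM sqc_real. Qed.

Lemma cmeas_mulc w f : measurable_fun setT w -> cmeas f -> cmeas (mulc w f).
Proof. by move=> mw mf; apply: cmeasM => //; exact: cmeas_real. Qed.

Lemma L2_mulc w f (K : R) : measurable_fun setT w ->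
  {ae mu, forall x, `|w x| <= K} -> L2 f ->
  L2 (mulc w f) /\ L2sq (mulc w f) <= K ^+ 2 * L2sq f.
Proof.
move=> mw wK lf; apply: L2_leK => //; first exact/cmeas_mulc/L2_cmeas.
apply: ae_imp wK => x h; rewrite sqc_mulc ler_wpM2r ?sqc_ge0//.
by rewrite -(real_normK (num_real (w x))) lerXn2r// nnegrE// (le_trans _ h).
Qed.

Lemma cutoff_mul (m : nat) (K : R) w f : measurable_fun setT w ->
  (forall x, `|w x| <= K * ind m x) -> L2 f -> cL1 (mulc w f) /\ L2 (mulc w f) /\
  L2sq (mulc w f) <= K ^+ 2 * L2sq f.
Proof.
move=> mw wK lf.
have K0 : 0 <= K.
  have := wK 0; rewrite /ind indicE mem_set/= ?mulr1.
    by apply: le_trans.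
  by rewrite in_itv/= oppr_le0 ler0n.
split; last first.
  apply: L2_mulc => //; apply: aeW => x; rewrite (le_trans (wK x))// ler_piMr//.
  by have /andP[] := ind01 m x.
have [ir ii] := trunc_cL1 m lf; have [mr mi] := L2_cmeas lf.
have b (u : R -> R) x : `|w x * u x| <= `|K * (ind m x * u x)|.
  rewrite !normrM mulrA ler_wpM2r// (le_trans (wK x))// (ger0_norm K0).
  by rewrite ler_wpM2l// ler_norm.
split.
  under eq_fun do rewrite mulc_Re.
  apply: (L1_le (integrable_scale K ir)); first exact: measurable_funM.
  by move=> x; rewrite trunc_Re; exact: (b (fun x => complex.Re (f x)) x).
under eq_fun do rewrite mulc_Im.
apply: (L1_le (integrable_scale K ii)); first exact: measurable_funM.
by move=> x; rewrite trunc_Im; exact: (b (fun x => complex.Im (f x)) x).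
Qed.

(** The product is integrable, and it equals its own truncations from some index
on, so its Fourier integral is its transform. *)
Lemma cutoff_fourier m (K : R) w f : measurable_fun setT w ->
  (forall x, `|w x| <= K * ind m x) -> L2 f -> is_fourier (mulc w f) (Fhat (mulc w f)).
Proof.
move=> mw wK lf; have [c1 [l2 _]] := cutoff_mul mw wK lf.
have [lF _] := plancherel_L1 c1 l2.
apply/is_fourierP; split => //; apply: cvg_near_cst.
exists m => // n /= mn.
have -> : trunc n (mulc w f) = mulc w f.
  apply/funext => x; rewrite /trunc; have [w0|w0] := eqVneq (w x) 0.
    by rewrite /mulc w0 mul0r mulr0.
  rewrite (@ind_out n x (w x)); [by rewrite mul1r|exact/eqP|move=> nx].
  apply/eqP; rewrite -normr_eq0 eq_le normr_ge0 andbT (le_trans (wK x))//.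
  have -> : ind m x = 0; last by rewrite mulr0.
  rewrite /ind indicE memNset//= in_itv/= -ler_norml; apply/negP; rewrite -ltNge.
  by rewrite (le_lt_trans _ nx)// ler_nat.
rewrite -[RHS](@L2sq0 R); congr L2sq; apply/funext => x; exact: subrr.
Qed.

Lemma ReMk (b c : R) : complex.Re (b +i* c) = b. Proof. by []. Qed.
Lemma ImMk (b c : R) : complex.Im (b +i* c) = c. Proof. by []. Qed.

Lemma sqc_imag (b : R) : sqc (0 +i* b) = b ^+ 2.
Proof. by rewrite /sqc ReMk ImMk expr0n add0r. Qed.

Lemma Re_imagMB (b : R) z1 z2 :
  complex.Re ((0 +i* b) * z1 - z2) = - b * complex.Im z1 - complex.Re z2.
Proof. by case: z1 => ? ?; case: z2 => ? ? /=; ring. Qed.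

Lemma Im_imagMB (b : R) z1 z2 :
  complex.Im ((0 +i* b) * z1 - z2) = b * complex.Re z1 - complex.Im z2.
Proof. by case: z1 => ? ?; case: z2 => ? ? /=; ring. Qed.

Lemma Fhat_Re f xi : complex.Re (Fhat f xi) =
  Ct (fun x => complex.Re (f x)) xi + St (fun x => complex.Im (f x)) xi.
Proof. by []. Qed.

Lemma Fhat_Im f xi : complex.Im (Fhat f xi) =
  Ct (fun x => complex.Im (f x)) xi - St (fun x => complex.Re (f x)) xi.
Proof. by []. Qed.

Definition real_weak_deriv u v := forall phi, test_fun phi ->
  \int[mu]_x (u x * derive1 phi x) = - \int[mu]_x (v x * phi x).

Lemma weak_derivP f g : weak_deriv f g <-> [/\ cloc_integrable f, cloc_integrable g,
  real_weak_deriv (fun x => complex.Re (f x)) (fun x => complex.Re (g x)) &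
  real_weak_deriv (fun x => complex.Im (f x)) (fun x => complex.Im (g x))].
Proof.
have ReC h (a : R -> R) : (fun x => complex.Re (h x * (a x)%:C)) = (fun x => complex.Re (h x) * a x).
  by apply/funext => x; rewrite ReM RCE mulr0 subr0.
have ImC h (a : R -> R) : (fun x => complex.Im (h x * (a x)%:C)) = (fun x => complex.Im (h x) * a x).
  by apply/funext => x; rewrite ImM RCE mulr0 add0r.
split=> [[cf cg h]|[cf cg hr hi]]; split => //.
- by move=> phi /h; rewrite /cintegral !ReC !ImC /= => -[].
- by move=> phi /h; rewrite /cintegral !ReC !ImC /= => -[].
- move=> phi tphi; rewrite /cintegral !ReC !ImC /=.
  by apply: complex_ext; rewrite /= ?hr// hi.
Qed.

Lemma C1_cos xi : C1 (fun x => cos (x * xi)) (fun x => - xi * sin (x * xi)).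
Proof.
split.
  move=> x; have h2 : is_derive x 1 (fun x : R => x * xi) xi.
    by apply: is_derive_eq; rewrite /GRing.scale /=; ring.
  have := @is_derive1_comp _ cos (fun x : R => x * xi) x _ _ (is_derive_cos _) h2.
  by rewrite mulrC mulrN -mulNr.
move=> x; apply: cvgM; first exact: cvg_cst.
by apply: (@continuous_comp _ _ _ (fun x : R => x * xi) sin); [exact: mulrr_continuous|exact: continuous_sin].
Qed.

Lemma C1_sin xi : C1 (fun x => sin (x * xi)) (fun x => xi * cos (x * xi)).
Proof.
split.
  move=> x; have h2 : is_derive x 1 (fun x : R => x * xi) xi.
    by apply: is_derive_eq; rewrite /GRing.scale /=; ring.
  have := @is_derive1_comp _ sin (fun x : R => x * xi) x _ _ (is_derive_sin _) h2.
  by rewrite mulrC.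
move=> x; apply: cvgM; first exact: cvg_cst.
by apply: (@continuous_comp _ _ _ (fun x : R => x * xi) cos); [exact: mulrr_continuous|exact: continuous_cos].
Qed.

Lemma measurable_bump n : measurable_fun setT (bump n).
Proof. by apply: continuous_measurable_fun; exact: C1_continuous (C1_bump n). Qed.

Lemma measurable_bump' n : measurable_fun setT (bump' n).
Proof. by apply: continuous_measurable_fun; have [] := C1_bump n. Qed.

Lemma bump_test n a a' : C1 a a' -> test_fun (fun x => bump n x * a x) /\
  derive1 (fun x => bump n x * a x) = (fun x => bump' n x * a x + bump n x * a' x).
Proof.
move=> Ca; have C := C1M (C1_bump n) Ca; split.
  apply: C1_test C _; exists n.+1%:R => x h; by rewrite bump_out// mul0r.
by apply/funext => x; exact: C1_derive C.
Qed.

(** The test functions are the cutoff function times cos(x xi) and sin(x xi). *)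
Lemma real_weak_deriv_bump u v n xi : real_weak_deriv u v -> L1 (fun x => bump n x * u x) ->
  L1 (fun x => bump n x * v x) -> L1 (fun x => bump' n x * u x) ->
  Ct (fun x => bump n x * v x) xi =
     xi * St (fun x => bump n x * u x) xi - Ct (fun x => bump' n x * u x) xi /\
  St (fun x => bump n x * v x) xi =
     - xi * Ct (fun x => bump n x * u x) xi - St (fun x => bump' n x * u x) xi.
Proof.
move=> uv iu iv iu'.
have [tc ec] := bump_test n (C1_cos xi); have [ts es] := bump_test n (C1_sin xi).
have hc := uv _ tc; have hs := uv _ ts; rewrite ec in hc; rewrite es in hs; split.
- have -> : Ct (fun x => bump n x * v x) xi = - (- \int[mu]_x (v x * (bump n x * cos (x * xi)))).
    by rewrite opprK; apply: eq_Rintegral => x _; ring.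
  rewrite -hc /St -RintZ; last exact: L1_sin.
  have i1 := L1_cos xi iu'; have i2 := integrable_scale xi (L1_sin xi iu).
  rewrite -(RintB i2 i1) -mulN1r -RintZ.
    by apply: eq_Rintegral => x _; ring.
  apply: eq_integrable (L1B i1 i2) => // x _ /=; congr EFin; ring.
- have -> : St (fun x => bump n x * v x) xi = - (- \int[mu]_x (v x * (bump n x * sin (x * xi)))).
    by rewrite opprK; apply: eq_Rintegral => x _; ring.
  rewrite -hs /Ct -RintZ; last exact: L1_cos.
  have i1 := L1_sin xi iu'; have i2 := integrable_scale (- xi) (L1_cos xi iu).
  rewrite -(RintB i2 i1) -mulN1r -RintZ.
    by apply: eq_Rintegral => x _; ring.
  apply: eq_integrable (L1B i1 i2) => // x _ /=; congr EFin; ring.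
Qed.

Lemma bump_leK n x : `|bump n x| <= 1 * ind n.+1 x.
Proof. by rewrite mul1r bump_le. Qed.

(** Fourier transform of the product rule (bump f)' = bump' f + bump g. *)
Lemma Fhat_bump_deriv f g n xi : L2 f -> L2 g -> weak_deriv f g ->
  Fhat (mulc (bump n) g) xi =
    (0 +i* xi) * Fhat (mulc (bump n) f) xi - Fhat (mulc (bump' n) f) xi.
Proof.
move=> lf lg /weak_derivP[_ _ wr wi].
have [[fr fi] _] := cutoff_mul (measurable_bump n) (bump_leK n) lf.
have [[gr gi] _] := cutoff_mul (measurable_bump n) (bump_leK n) lg.
have [[hr hi] _] := cutoff_mul (measurable_bump' n) (@bump'_le n) lf.
have reE w k : (fun x => complex.Re (mulc w k x)) = (fun x => w x * complex.Re (k x)).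
  by apply/funext => x; rewrite mulc_Re.
have imE w k : (fun x => complex.Im (mulc w k x)) = (fun x => w x * complex.Im (k x)).
  by apply/funext => x; rewrite mulc_Im.
rewrite !reE in fr gr hr; rewrite !imE in fi gi hi.
have [e1 e2] := real_weak_deriv_bump xi wr fr gr hr; have [e3 e4] := real_weak_deriv_bump xi wi fi gi hi.
apply: complex_ext.
  by rewrite Re_imagMB Fhat_Im !Fhat_Re !reE !imE e1 e4; ring.
by rewrite Im_imagMB Fhat_Re !Fhat_Im !reE !imE e3 e2; ring.
Qed.

Lemma fourier_isometryB f fh h hh : is_fourier f fh -> is_fourier h hh ->
  L2sq (fun x => hh x - fh x) = 2 * kappa * L2sq (fun x => h x - f x).
Proof.
move=> ff fh'; have := fourier_isometry (fourier_lin (-1) ff fh').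
have e (k1 k2 : cfun R) : (fun x => -1 * k1 x + k2 x) = (fun x : R => k2 x - k1 x).
  by apply/funext => x; rewrite mulN1r addrC.
by rewrite !e.
Qed.

Lemma bump_mul_cvg f : L2 f -> L2sq (fun x => mulc (bump n) f x - f x) @[n --> \oo] --> (0 : R).
Proof.
move=> lf; have mf := L2_cmeas lf.
have sE n x : sqc (mulc (bump n) f x - f x) = (1 - bump n x) ^+ 2 * sqc (f x).
  rewrite (_ : _ - _ = (bump n x - 1)%:C * f x); last first.
    by rewrite /mulc rmorphB rmorph1 mulrBl mul1r.
  by rewrite sqcM sqc_real -sqrrN opprB.
apply: (@L2sq_dct _ _ (fun x => sqc (f x))).
- by move=> n; apply: cmeasD; [apply: cmeas_mulc => //; exact: measurable_bump|exact: cmeasN].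
- exact: L2_int.
- move=> n; apply: aeW => x; rewrite sE ler_piMl ?sqc_ge0//.
  by have /andP[b0 b1] := bump01 n x; rewrite exprn_ile1//; lra.
- apply: aeW => x; under eq_fun do rewrite sE.
  have -> : (0 : R) = (1 - 1) * (1 - 1) * sqc (f x) by rewrite subrr !mul0r.
  under eq_fun do rewrite expr2.
  by apply: cvgM; [apply: cvgM; (apply: cvgB; [exact: cvg_cst|exact: bump_cvg])|exact: cvg_cst].
Qed.

(** A positive weight that compensates multiplication by xi and is integrable. *)
Definition lorentz xi : R := (1 + xi ^+ 2)^-1.

Lemma lorentz_facts xi : [/\ 0 < lorentz xi, lorentz xi ^+ 2 <= 1 & lorentz xi ^+ 2 * xi ^+ 2 <= 1].
Proof.
have p : 1 <= 1 + xi ^+ 2 by rewrite lerDl sqr_ge0.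
have p0 : 0 < 1 + xi ^+ 2 by exact: lt_le_trans p.
have l0 : 0 < lorentz xi by rewrite invr_gt0.
have l1 : lorentz xi <= 1 by rewrite invf_le1.
split => //; first by rewrite exprn_ile1// ltW.
have : lorentz xi * (1 + xi ^+ 2) = 1 by rewrite mulVf// gt_eqF.
have := sqr_ge0 xi; nra.
Qed.

Lemma measurable_lorentz : measurable_fun setT lorentz.
Proof. exact: continuous_measurable_fun (@continuous_oneDsqrV R). Qed.

(** In the identity [Fhat_bump_deriv] the cutoff is removed in L^2: the term with
bump' is O(1/n).  Multiplication by xi is not bounded on L^2, so the error is
estimated with the weight 1/(1 + xi^2). *)
Lemma fourier_deriv f g fh gh : L2 g -> weak_deriv f g ->
  is_fourier f fh -> is_fourier g gh -> aeeq gh (fun xi => (0 +i* xi) * fh xi).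
Proof.
move=> lg wd ff fg; have [lf lfh _] := ff; have [_ lgh _] := fg.
pose E xi := gh xi - (0 +i* xi) * fh xi.
have mi : cmeas (fun xi : R => 0 +i* xi) by split; [exact: measurable_cst|exact: measurable_id].
have mE : cmeas E.
  apply: cmeasD; first exact: L2_cmeas.
  by apply: cmeasN; apply: cmeasM => //; exact: L2_cmeas.
pose Ew := mulc lorentz E.
have mEw : cmeas Ew by apply: cmeas_mulc => //; exact: measurable_lorentz.
pose A n := mulc (bump n) g; pose B n := mulc (bump n) f; pose D n := mulc (bump' n) f.
have fA n := cutoff_fourier (measurable_bump n) (bump_leK n) lg.
have fB n := cutoff_fourier (measurable_bump n) (bump_leK n) lf.
have fD n := cutoff_fourier (measurable_bump' n) (@bump'_le n) lf.
have lA n : L2 (fun xi => Fhat (A n) xi - gh xi) by apply: L2B => //; have [] := fA n.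
have lB n : L2 (fun xi => Fhat (B n) xi - fh xi) by apply: L2B => //; have [] := fB n.
have lD n : L2 (Fhat (D n)) by have [] := fD n.
have bnd n : L2 Ew /\ L2sq Ew <= 4 * (L2sq (fun xi => Fhat (A n) xi - gh xi) + L2sq (fun xi => Fhat (B n) xi - fh xi))
   + 2 * L2sq (Fhat (D n)).
  pose b xi := 4 * (sqc (Fhat (A n) xi - gh xi) + sqc (Fhat (B n) xi - fh xi)) + 2 * sqc (Fhat (D n) xi).
  have i1 : L1 (fun xi => sqc (Fhat (A n) xi - gh xi)) := L2_int (lA n).
  have i2 : L1 (fun xi => sqc (Fhat (B n) xi - fh xi)) := L2_int (lB n).
  have i3 : L1 (fun xi => sqc (Fhat (D n) xi)) := L2_int (lD n).
  have i12 := integrable_scale 4 (L1D i1 i2); have i4 := integrable_scale 2 i3.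
  have -> : 4 * (L2sq (fun xi => Fhat (A n) xi - gh xi) + L2sq (fun xi => Fhat (B n) xi - fh xi))
     + 2 * L2sq (Fhat (D n)) = \int[mu]_xi b xi.
    by rewrite /b (RintD i12 i4) (RintZ _ (L1D i1 i2)) (RintZ _ i3) (RintD i1 i2).
  apply: L2_le => //; first exact: L1D i12 i4.
  apply: aeW => xi; rewrite sqc_mulc.
  have -> : E xi = - (Fhat (A n) xi - gh xi) + (0 +i* xi) * (Fhat (B n) xi - fh xi) - Fhat (D n) xi.
    by rewrite /E /A (Fhat_bump_deriv n xi lf lg wd) -/(B n) -/(D n); ring.
  have [l0 l1 l2] := lorentz_facts xi.
  apply: (@le_trans _ _ (lorentz xi ^+ 2 * (4 * sqc (Fhat (A n) xi - gh xi) + 4 * xi ^+ 2 * sqc (Fhat (B n) xi - fh xi)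
    + 2 * sqc (Fhat (D n) xi)))).
    rewrite ler_wpM2l ?sqr_ge0//.
    apply: le_trans (sqcD_le _ _) _; rewrite sqcN lerD2r.
    have := sqcD_le (- (Fhat (A n) xi - gh xi)) ((0 +i* xi) * (Fhat (B n) xi - fh xi)).
    by rewrite sqcN sqcM sqc_imag; lra.
  have := sqc_ge0 (Fhat (A n) xi - gh xi); have := sqc_ge0 (Fhat (B n) xi - fh xi).
  have := sqc_ge0 (Fhat (D n) xi); rewrite /b.
  move: (sqc _) (sqc _) (sqc _) (lorentz xi ^+ 2) (xi ^+ 2) (sqr_ge0 xi) (sqr_ge0 (lorentz xi)) l1 l2 => s1 s2 s3 W X X0 W0 l1 l2 h1 h2 h3.
  have := ler_wpM2r h1 l1; have := ler_wpM2r h2 l2; have := ler_wpM2r h3 l1; nra.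
have lEw : L2 Ew := (bnd 0%N).1.
have z : L2sq Ew = 0.
  apply/eqP; rewrite eq_le L2sq_ge0 andbT.
  have h : (4 * (L2sq (fun xi => Fhat (A n) xi - gh xi) + L2sq (fun xi => Fhat (B n) xi - fh xi))
   + 2 * L2sq (Fhat (D n))) @[n --> \oo] --> (0 : R).
    have -> : (0 : R) = 4 * (2 * kappa * 0 + 2 * kappa * 0) + 2 * 0 by rewrite !mulr0 !addr0 mulr0.
    apply: cvgD; last first.
      apply: cvgM; first exact: cvg_cst.
      have hh : (2 * kappa * ((4 * n.+1%:R^-1) * (4 * n.+1%:R^-1) * L2sq f)) @[n --> \oo] --> (0 : R).
        have -> : (0 : R) = 2 * kappa * ((4 * 0) * (4 * 0) * L2sq f) by rewrite !(mulr0, mul0r).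
        apply: cvgM; first exact: cvg_cst.
        apply: cvgM; last exact: cvg_cst.
        by apply: cvgM; (apply: cvgM; [exact: cvg_cst|exact: cvg_harmonic]).
      apply: (squeeze_cvgr _ (cvg_cst 0) hh); apply: nearW => n; rewrite L2sq_ge0 /=.
      rewrite (fourier_isometry (fD n)); apply: ler_wpM2l.
        by rewrite mulr_ge0// ltW// kappa_gt0.
      by have [_ [_]] := cutoff_mul (measurable_bump' n) (@bump'_le n) lf; rewrite expr2.
    apply: cvgM; first exact: cvg_cst.
    apply: cvgD.
      under eq_fun do rewrite (fourier_isometryB fg (fA _)).
      by apply: cvgM; [exact: cvg_cst|exact: bump_mul_cvg].
    under eq_fun do rewrite (fourier_isometryB ff (fB _)).
    by apply: cvgM; [exact: cvg_cst|exact: bump_mul_cvg].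
  have -> : L2sq Ew = lim ((L2sq Ew) @[n --> \oo]) by rewrite lim_cst.
  rewrite -(cvg_lim _ h)//; apply: ler_lim; first exact: is_cvg_cst.
    by apply/cvg_ex; exists 0.
  by apply: nearW => n; have [] := bnd n.
have := L2sq_eq0 lEw z; apply: ae_imp => xi /eqP.
rewrite /Ew /mulc mulf_eq0 => /orP[/eqP h|/eqP h].
  have [l0 _ _] := lorentz_facts xi.
  by move: l0; rewrite (_ : lorentz xi = complex.Re (lorentz xi)%:C)// h ltxx.
by apply/eqP; rewrite -subr_eq0; apply/eqP; exact: h.
Qed.
End WeakFourier.

(** * Calculus of weak derivatives *)

Section WeakDerivatives.
Context {R : realType}.
Local Notation mu := (@lebesgue_measure R).
Implicit Types (p u v a k phi w : R -> R) (x y xi e : R) (f g h : cfun R) (z : R[i]).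

(** Test functions are supported in some [-n, n], so local integrability amounts to
integrability on these intervals. *)
Lemma locintP u : locally_integrable setT u <->
  measurable_fun setT u /\ forall n, L1 (fun x => ind n x * u x).
Proof.
split=> [[mu_ _ h]|[mu_ h]].
  split => // n; apply/integrableP; split.
    by apply/measurable_EFinP; apply: measurable_funM => //; exact: measurable_ind.
  have := h `[- n%:R, n%:R]%classic (@subsetT _ _) (@segment_compact R _ _).
  rewrite integral_mkcond; congr (_ < _)%E; apply: eq_integral => x _ /=.
  rewrite patchE /ind indicE; case: ifPn => xi; first by rewrite mul1r.
  by rewrite mul0r normr0.
split => //; first exact: openT.
move=> K _ cK; have [M [_ hM]] := compact_bounded cK.
have {}hM x : K x -> `|x| <= `|M| + 1.
  by move=> Kx; apply: (hM (`|M| + 1)) => //; have := ler_norm M; lra.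
have [n hn] : exists n : nat, `|M| + 1 <= n%:R.
  by exists (Num.bound (`|M| + 1)); rewrite ltW// archi_boundP// addr_ge0.
have mK := compact_measurable cK.
have in_ x : K x -> ind n x = 1.
  by move=> Kx; apply: ind_in; exact: le_trans (hM x Kx) hn.
have -> : (\int[mu]_(x in K) `|u x|%:E = \int[mu]_(x in K) `|(ind n x * u x)%:E|)%E.
  by apply: eq_integral => x; rewrite inE => Kx; rewrite in_// mul1r.
have /integrableP[mi fi] := h n; apply: le_lt_trans fi.
by apply: ge0_subset_integral => //; apply: measurableT_comp.
Qed.

Lemma locint_lin (b1 b2 : R) u v : locally_integrable setT u -> locally_integrable setT v ->
  locally_integrable setT (fun x => b1 * u x + b2 * v x).
Proof.
move=> /locintP[mu1 hu] /locintP[mv hv]; apply/locintP; split.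
  by apply: measurable_funD; apply: measurable_funM.
move=> n; apply: eq_integrable (L1D (integrable_scale b1 (hu n)) (integrable_scale b2 (hv n))) => //.
by move=> x _ /=; congr EFin; ring.
Qed.

Lemma continuous_bounded k n : continuous k -> exists B : R, forall x, `|ind n x * k x| <= B * ind n x.
Proof.
move=> ck.
have n0 : - n%:R <= n%:R :> R by rewrite (@le_trans _ _ 0) ?oppr_le0.
have c1 : {within `[- n%:R, n%:R], continuous (fun x => `|k x|)}.
  apply: continuous_subspaceT => x; apply: cvg_norm; exact: ck.
have [c _ hc] := EVT_max n0 c1; exists `|k c| => x.
rewrite normrM mulrC /ind indicE; case: (boolP (_ \in _)) => xi /=; last by rewrite normr0 !mulr0.
by rewrite normr1 !mulr1; apply: hc; rewrite inE in xi.
Qed.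

Lemma locint_mul k u : continuous k -> locally_integrable setT u ->
  locally_integrable setT (fun x => k x * u x).
Proof.
move=> ck /locintP[m hu]; have mk : measurable_fun setT k by exact: continuous_measurable_fun.
apply/locintP; split; first exact: measurable_funM.
move=> n; have [B hB] := continuous_bounded n ck.
apply: (@ae_le_integrable _ _ (fun x => B * `|ind n x * u x|)).
- by apply: measurable_funM; [exact: measurable_ind|exact: measurable_funM].
- by apply: integrable_scale; have /integrable_norm := hu n.
- apply: aeW => x; rewrite mulrA !normrM; have := hB x; rewrite normrM => h.
  have /andP[i0 _] := ind01 n x; rewrite (ger0_norm i0) in h *.
  by rewrite mulrA ler_wpM2r.
Qed.

Lemma locint_bounded k (K : R) : measurable_fun setT k -> (forall x, `|k x| <= K) ->
  locally_integrable setT k.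
Proof.
move=> mk hk; apply/locintP; split => // n.
apply: (@ae_le_integrable _ _ (fun x => K * ind n x)).
- by apply: measurable_funM => //; exact: measurable_ind.
- by apply: integrable_scale; exact: L1_ind.
- apply: aeW => x; rewrite normrM mulrC; have /andP[i0 _] := ind01 n x.
  by rewrite (ger0_norm i0) ler_wpM2r.
Qed.

Lemma locint_continuous k : continuous k -> locally_integrable setT k.
Proof.
move=> ck; have := locint_mul ck (locint_bounded (measurable_cst (1 : R)) (fun=> lexx `|1|)).
by congr locally_integrable; apply/funext => x; rewrite mulr1.
Qed.

Lemma locint_test u phi (M : R) : continuous phi -> (forall x, M < `|x| -> phi x = 0) ->
  locally_integrable setT u -> L1 (fun x => u x * phi x).
Proof.
move=> cp h lu; have /locintP[_ /(_ (Num.bound `|M|))] := locint_mul cp lu.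
apply: eq_integrable => // x _ /=; congr EFin; set n := Num.bound _.
have hn : M < n%:R by rewrite (le_lt_trans (ler_norm M))// archi_boundP.
have [xn|xn] := leP `|x| n%:R; first by rewrite ind_in// mul1r mulrC.
by rewrite h ?(lt_trans hn)// mul0r !mulr0.
Qed.

Lemma derive1_out phi (M : R) x : (forall x, M < `|x| -> phi x = 0) -> M < `|x| -> derive1 phi x = 0.
Proof.
move=> h hx; apply: derive1_is; apply: near_eq_is_derive (is_derive_cst (0 : R) x 1).
have c : `|y| @[y --> x] --> `|x| by apply: cvg_norm; exact: cvg_id.
near=> y; rewrite h//; near: y; exact: (cvgr_gt _ c _ hx).
Unshelve. all: by end_near.
Qed.

Lemma test_L1 u phi : test_fun phi -> locally_integrable setT u ->
  L1 (fun x => u x * phi x) /\ L1 (fun x => u x * derive1 phi x).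
Proof.
move=> /test_funP[C [M hM]] lu; have [_ cd] := C; split.
  exact: locint_test (C1_continuous C) hM lu.
by apply: (@locint_test _ _ M) => // x; exact: derive1_out.
Qed.

Lemma real_weak_deriv_lin (b1 b2 : R) u u' v v' :
  locally_integrable setT u -> locally_integrable setT u' ->
  locally_integrable setT v -> locally_integrable setT v' ->
  real_weak_deriv u u' -> real_weak_deriv v v' ->
  real_weak_deriv (fun x => b1 * u x + b2 * v x) (fun x => b1 * u' x + b2 * v' x).
Proof.
move=> lu lu' lv lv' hu hv phi t.
have [_ iu] := test_L1 t lu; have [iu' _] := test_L1 t lu'.
have [_ iv] := test_L1 t lv; have [iv' _] := test_L1 t lv'.
have e1 : \int[mu]_x ((b1 * u x + b2 * v x) * derive1 phi x) =
   \int[mu]_x (b1 * (u x * derive1 phi x) + b2 * (v x * derive1 phi x)).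
  by apply: eq_Rintegral => x _; ring.
have e2 : \int[mu]_x ((b1 * u' x + b2 * v' x) * phi x) =
   \int[mu]_x (b1 * (u' x * phi x) + b2 * (v' x * phi x)).
  by apply: eq_Rintegral => x _; ring.
rewrite e1 e2 (RintD (integrable_scale b1 iu) (integrable_scale b2 iv)) (RintZ _ iu) (RintZ _ iv).
rewrite (RintD (integrable_scale b1 iu') (integrable_scale b2 iv')) (RintZ _ iu') (RintZ _ iv').
by rewrite (hu _ t) (hv _ t); ring.
Qed.

(** The integral of the derivative of a test function vanishes, by the fundamental
theorem of calculus on an interval beyond its support. *)
Lemma real_weak_deriv_cst : real_weak_deriv (fun=> 1) (fun=> 0 : R).
Proof.
move=> phi t; have /test_funP[C [M hM]] := t; have [dphi cd] := C.
have i1 := locint_continuous (@cst_continuous R R 1).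
have [_ id] := test_L1 t i1.
have -> : \int[mu]_x (0 * phi x) = 0.
  by under eq_Rintegral do rewrite mul0r; rewrite Rintegral_cst// mul0r.
rewrite oppr0; pose N := `|M| + 1.
have N0 : 0 < N by rewrite ltr_wpDl.
have hN x : N <= `|x| -> M < `|x|.
  by apply: lt_le_trans; rewrite (le_lt_trans (ler_norm M))// ltrDl.
have -> : \int[mu]_x (1 * derive1 phi x) = \int[mu]_(x in `[- N, N]) derive1 phi x.
  rewrite [RHS]Rintegral_mkcond; apply: eq_Rintegral => x _.
  rewrite patchE mul1r; case: ifPn => // /negP xN.
  apply: derive1_out hM _; apply: hN; rewrite leNgt; apply/negP => h; apply: xN.
  by rewrite inE /= in_itv /= -ler_norml ltW.
have NN : - N < N by lra.
have cphi := C1_continuous C.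
rewrite /Rintegral (@continuous_FTC2 _ (derive1 phi) phi _ _ NN) //.
- have a1 : phi N = 0 by apply/hM/hN; rewrite ger0_norm// ltW.
  have a2 : phi (- N) = 0 by apply/hM/hN; rewrite normrN ger0_norm// ltW.
  by rewrite a1 a2 /= subrr.
- by apply: continuous_subspaceT.
- split; first by move=> x _; apply: ex_derive; exact: dphi.
    by apply: cvg_at_right_filter; exact: cphi.
  by apply: cvg_at_left_filter; exact: cphi.
Qed.

(** If phi is a test function then so is a phi, and a' phi + a phi' is its
derivative. *)
Lemma real_weak_deriv_mul a a' u v : C1 a a' -> locally_integrable setT u -> locally_integrable setT v ->
  real_weak_deriv u v -> real_weak_deriv (fun x => a x * u x) (fun x => a' x * u x + a x * v x).
Proof.
move=> C lu lv h phi t; have [_ ca'] := C; have ca := C1_continuous C.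
have /test_funP[Cp [M hM]] := t; have Cm := C1M C Cp.
have tm : test_fun (fun x => a x * phi x).
  by apply: C1_test Cm _; exists M => x /hM ->; rewrite mulr0.
have := h _ tm; rewrite (_ : derive1 _ = (fun x => a' x * phi x + a x * derive1 phi x)); last first.
  by apply/funext => x; exact: C1_derive Cm.
have [i1 _] := test_L1 t (locint_mul ca' lu).
have [_ i2] := test_L1 t (locint_mul ca lu).
have [i3 _] := test_L1 t (locint_mul ca lv).
have -> : \int[mu]_x (u x * (a' x * phi x + a x * derive1 phi x)) =
   \int[mu]_x (a' x * u x * phi x + a x * u x * derive1 phi x).
  by apply: eq_Rintegral => x _; ring.
have -> : \int[mu]_x (v x * (a x * phi x)) = \int[mu]_x (a x * v x * phi x).
  by apply: eq_Rintegral => x _; ring.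
have -> : \int[mu]_x ((a' x * u x + a x * v x) * phi x) =
   \int[mu]_x (a' x * u x * phi x + a x * v x * phi x).
  by apply: eq_Rintegral => x _; ring.
rewrite (RintD i1 i2) (RintD i1 i3); lra.
Qed.

(** The product rule applied to a times the constant 1. *)
Lemma real_weak_deriv_C1 a a' : C1 a a' -> real_weak_deriv a a'.
Proof.
move=> C; have l1 := locint_continuous (@cst_continuous R R 1).
have l0 := locint_continuous (@cst_continuous R R 0).
have := real_weak_deriv_mul C l1 l0 real_weak_deriv_cst.
by congr real_weak_deriv; apply/funext => x; ring.
Qed.

Lemma weak_deriv_lin z f f' g g' : weak_deriv f f' -> weak_deriv g g' ->
  weak_deriv (fun x => z * f x + g x) (fun x => z * f' x + g' x).
Proof.
have loc h1 h2 : cloc_integrable h1 -> cloc_integrable h2 -> cloc_integrable (fun x => z * h1 x + h2 x).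
  move=> [r1 i1] [r2 i2]; split.
    have := locint_lin 1 1 (locint_lin (complex.Re z) (- complex.Im z) r1 i1) r2.
    by congr locally_integrable; apply/funext => x; rewrite !ReImE; ring.
  have := locint_lin 1 1 (locint_lin (complex.Re z) (complex.Im z) i1 r1) i2.
  by congr locally_integrable; apply/funext => x; rewrite !ReImE; ring.
move=> /weak_derivP[cf cf' rf if_] /weak_derivP[cg cg' rg ig].
apply/weak_derivP; split; [exact: loc|exact: loc| |];
  case: cf cf' cg cg' => [a1 b1] [a2 b2] [a3 b3] [a4 b4].
  have := real_weak_deriv_lin 1 1 (locint_lin (complex.Re z) (- complex.Im z) a1 b1)
    (locint_lin (complex.Re z) (- complex.Im z) a2 b2) a3 a4
    (real_weak_deriv_lin (complex.Re z) (- complex.Im z) a1 a2 b1 b2 rf if_) rg.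
  by congr real_weak_deriv; apply/funext => x; rewrite !ReImE; ring.
have := real_weak_deriv_lin 1 1 (locint_lin (complex.Re z) (complex.Im z) b1 a1)
    (locint_lin (complex.Re z) (complex.Im z) b2 a2) b3 b4
    (real_weak_deriv_lin (complex.Re z) (complex.Im z) b1 b2 a1 a2 if_ rf) ig.
by congr real_weak_deriv; apply/funext => x; rewrite !ReImE; ring.
Qed.

Lemma cloc_mulc k f : continuous k -> cloc_integrable f -> cloc_integrable (mulc k f).
Proof.
move=> ck [r i]; split.
  by have := locint_mul ck r; congr locally_integrable; apply/funext => x; rewrite mulc_Re.
by have := locint_mul ck i; congr locally_integrable; apply/funext => x; rewrite mulc_Im.
Qed.

Lemma cloc_add f g : cloc_integrable f -> cloc_integrable g -> cloc_integrable (fun x => f x + g x).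
Proof.
move=> [r1 i1] [r2 i2]; split.
  by have := locint_lin 1 1 r1 r2; congr locally_integrable; apply/funext => x; rewrite ReD; ring.
by have := locint_lin 1 1 i1 i2; congr locally_integrable; apply/funext => x; rewrite ImD; ring.
Qed.

Lemma weak_deriv_mul a a' f g : C1 a a' -> weak_deriv f g ->
  weak_deriv (mulc a f) (fun x => mulc a' f x + mulc a g x).
Proof.
move=> C /weak_derivP[cf cg hr hi]; have [_ ca'] := C; have ca := C1_continuous C.
apply/weak_derivP; split; [exact: cloc_mulc|by apply: cloc_add; exact: cloc_mulc| |];
  case: cf cg => [a1 b1] [a2 b2].
  have := real_weak_deriv_mul C a1 a2 hr.
  by congr real_weak_deriv; apply/funext => x; rewrite ?ReD !mulc_Re.
have := real_weak_deriv_mul C b1 b2 hi.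
by congr real_weak_deriv; apply/funext => x; rewrite ?ImD !mulc_Im.
Qed.

Lemma weak_deriv_C1 a a' : C1 a a' -> weak_deriv (of_real a) (of_real a').
Proof.
move=> C; have [_ ca'] := C; have ca := C1_continuous C.
apply/weak_derivP; split.
- by split; apply: locint_continuous => // x; exact: cvg_cst.
- by split; apply: locint_continuous => // x; exact: cvg_cst.
- exact: real_weak_deriv_C1.
- move=> phi t /=; have z k : \int[mu]_x (0 * k x) = 0 :> R.
    by under eq_Rintegral do rewrite mul0r; rewrite Rintegral_cst// mul0r.
  by rewrite !z oppr0.
Qed.

(** The difference h is a weak derivative of 0, hence orthogonal to the cutoff
function times any cosine or sine.  So bump h, which is integrable and in L^2,
has vanishing Fourier transform. *)
Lemma weak_deriv_unique f g1 g2 : weak_deriv f g1 -> weak_deriv f g2 -> L2 g1 -> L2 g2 ->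
  aeeq g1 g2.
Proof.
move=> d1 d2 l1 l2; have lh := L2B l1 l2.
pose h : cfun R := fun x => g1 x - g2 x.
have [rh ih] : real_weak_deriv (fun=> 0) (fun x => complex.Re (h x)) /\ real_weak_deriv (fun=> 0) (fun x => complex.Im (h x)).
  have /weak_derivP[_ _ r i] := weak_deriv_lin (-1) d2 d1; split.
    by move: r; congr real_weak_deriv; apply/funext => x; rewrite /h ?ReImE; ring.
  by move: i; congr real_weak_deriv; apply/funext => x; rewrite /h ?ReImE; ring.
have z0 n : L2sq (mulc (bump n) h) = 0.
  have [c1 [c2 _]] := cutoff_mul (measurable_bump n) (@bump_leK R n) lh.
  have [_ pl] := plancherel_L1 c1 c2.
  have F0 xi : Fhat (mulc (bump n) h) xi = 0.
    have [ir ii] := c1.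
    have ir' : L1 (fun x => bump n x * complex.Re (h x)).
      by apply: eq_integrable ir => // x _ /=; rewrite mulc_Re.
    have ii' : L1 (fun x => bump n x * complex.Im (h x)).
      by apply: eq_integrable ii => // x _ /=; rewrite mulc_Im.
    have L0 k : L1 (fun x => k x * 0 : R).
      by apply: eq_integrable (integrable0 _ _) => // x _ /=; rewrite mulr0.
    have [a1 a2] := real_weak_deriv_bump xi rh (L0 _) ir' (L0 _).
    have [b1 b2] := real_weak_deriv_bump xi ih (L0 _) ii' (L0 _).
    have Z k : Ct (fun x => k x * 0) xi = 0 /\ St (fun x => k x * 0) xi = 0.
      by rewrite /Ct /St; split; under eq_Rintegral do rewrite mulr0 mul0r; rewrite Rintegral_cst// mul0r.
    have [[Z1 Z2] [Z3 Z4]] := (Z (bump n), Z (bump' n)).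
    rewrite Z1 Z2 Z3 Z4 !mulr0 !subr0 in a1 a2 b1 b2.
    apply: complex_ext; rewrite ?Fhat_Re ?Fhat_Im.
      under [in X in X + _]eq_fun do rewrite mulc_Re.
      under [in X in _ + X]eq_fun do rewrite mulc_Im.
      by rewrite a1 b2 addr0.
    under [in X in X - _]eq_fun do rewrite mulc_Im.
    under [in X in _ - X]eq_fun do rewrite mulc_Re.
    by rewrite b1 a2 subr0.
  have : L2sq (Fhat (mulc (bump n) h)) = 0.
    by rewrite (_ : Fhat _ = fun=> 0) ?L2sq0//; apply/funext.
  rewrite pl => /eqP; rewrite !mulf_eq0 pnatr_eq0/= (gt_eqF (@kappa_gt0 R))/= => /eqP.
  by [].
have := bump_mul_cvg lh.
have cE n : L2sq (fun x => mulc (bump n) h x - h x) = L2sq h.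
  have [_ [c2 _]] := cutoff_mul (measurable_bump n) (@bump_leK R n) lh.
  have ae0 := L2sq_eq0 c2 (z0 n).
  rewrite -(L2sqN h); apply: L2sq_ae.
  - exact: L2_cmeas (L2B c2 lh).
  - exact: L2_cmeas (L2N lh).
  - by apply: ae_imp ae0 => x ->; rewrite sub0r.
rewrite -/h; under eq_fun do rewrite cE.
move=> c0; have c1 : L2sq h @[_ --> \oo] --> L2sq h by exact: cvg_cst.
have : L2sq h = 0 by exact: (cvg_unique _ c1 c0).
exact: L2sqB_eq0.
Qed.

(** By uniqueness the value chosen in the definition of [wD] agrees almost everywhere
with any weak derivative in L^2. *)
Lemma wD_spec f g : weak_deriv f g -> L2 g ->
  [/\ L2 (wD f), weak_deriv f (wD f) & aeeq (wD f) g].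
Proof.
move=> d l.
have [l' d'] : (L2 (wD f) /\ weak_deriv f (wD f)).
  by apply: (@xgetPex _ (fun=> 0) [set g | L2 g /\ weak_deriv f g]); exists g.
by split => //; exact: weak_deriv_unique d' d l' l.
Qed.

Lemma weak_deriv_ae f f1 g g1 : cmeas f1 -> cmeas g1 -> aeeq f f1 -> aeeq g g1 ->
  weak_deriv f g -> weak_deriv f1 g1.
Proof.
have loc u v : measurable_fun setT v -> {ae mu, forall x, u x = v x} ->
    locally_integrable setT u -> locally_integrable setT v.
  move=> mv e /locintP[m1 h]; apply/locintP; split => // n.
  apply: (@ae_le_integrable _ _ (fun x => `|ind n x * u x|)).
  - by apply: measurable_funM => //; exact: measurable_ind.
  - by have /integrable_norm := h n.
  - by apply: ae_imp e => x ->.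
have rw u v u1 v1 : locally_integrable setT u -> locally_integrable setT v ->
    locally_integrable setT u1 -> locally_integrable setT v1 ->
    {ae mu, forall x, u x = u1 x} -> {ae mu, forall x, v x = v1 x} -> real_weak_deriv u v -> real_weak_deriv u1 v1.
  move=> lu lv lu1 lv1 eu ev h phi t.
  have [_ iu] := test_L1 t lu; have [iv _] := test_L1 t lv.
  have [_ iu1] := test_L1 t lu1; have [iv1 _] := test_L1 t lv1.
  have -> : \int[mu]_x (u1 x * derive1 phi x) = \int[mu]_x (u x * derive1 phi x).
    congr fine; apply: ae_eq_integral => //; [exact: measurable_int iu1|exact: measurable_int iu|].
    by apply: ae_imp eu => x -> _.
  have -> : \int[mu]_x (v1 x * phi x) = \int[mu]_x (v x * phi x).
    congr fine; apply: ae_eq_integral => //; [exact: measurable_int iv1|exact: measurable_int iv|].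
    by apply: ae_imp ev => x -> _.
  exact: h.
move=> [mf1 mf2] [mg1 mg2] ef eg /weak_derivP[[a1 b1] [a2 b2] hr hi].
have er : {ae mu, forall x, complex.Re (f x) = complex.Re (f1 x)} by apply: ae_imp ef => x ->.
have ei : {ae mu, forall x, complex.Im (f x) = complex.Im (f1 x)} by apply: ae_imp ef => x ->.
have gr : {ae mu, forall x, complex.Re (g x) = complex.Re (g1 x)} by apply: ae_imp eg => x ->.
have gi : {ae mu, forall x, complex.Im (g x) = complex.Im (g1 x)} by apply: ae_imp eg => x ->.
have l1 := loc _ _ mf1 er a1; have l2 := loc _ _ mf2 ei b1.
have l3 := loc _ _ mg1 gr a2; have l4 := loc _ _ mg2 gi b2.
apply/weak_derivP; split; [by split|by split| |].
  exact: rw er gr hr.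
exact: rw ei gi hi.
Qed.
End WeakDerivatives.

(** * The half Laplacian on H^1 and Fourier inversion *)

Section HalfLaplacian.
Context {R : realType}.
Local Notation mu := (@lebesgue_measure R).
Implicit Types (p u v a phi w : R -> R) (x y xi e : R) (f g h : cfun R) (z : R[i]).

Lemma multiplier_unique m f (w1 w2 : cfun R) : is_multiplier m f w1 -> is_multiplier m f w2 ->
  aeeq w1 w2.
Proof.
move=> [f1 [h1 [ff1 fw1 e1]]] [f2 [h2 [ff2 fw2 e2]]].
apply: fourier_inj fw1 fw2 _; apply: aeeq_trans e1 _; apply: aeeq_trans (aeeq_sym e2).
by apply: ae_imp (fourier_unique ff1 ff2) => x ->.
Qed.

Lemma multiplier_lin m z f g (w1 w2 : cfun R) : is_multiplier m f w1 -> is_multiplier m g w2 ->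
  is_multiplier m (fun x => z * f x + g x) (fun x => z * w1 x + w2 x).
Proof.
move=> [f1 [h1 [ff1 fw1 e1]]] [f2 [h2 [ff2 fw2 e2]]].
exists (fun x => z * f1 x + f2 x), (fun x => z * h1 x + h2 x).
split; [exact: fourier_lin|exact: fourier_lin|].
by apply: ae_imp2 e1 e2 => x -> ->; ring.
Qed.

Lemma multiplier_ae m f f' (w1 : cfun R) : cmeas f' -> aeeq f f' -> is_multiplier m f w1 ->
  is_multiplier m f' w1.
Proof.
move=> mf ff [f1 [h1 [ff1 fw1 e1]]]; exists f1, h1; split => //.
have [_ l1 _] := ff1.
apply: fourier_ae ff1 mf ff _ _; [exact: L2_cmeas|exact: aeeq_refl].
Qed.

Definition H1 f g := [/\ L2 f, L2 g & weak_deriv f g].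

(** The function |xi| fh has the modulus of the transform of g, so it is in L^2 and
therefore a transform. *)
Lemma half_laplacian_spec f g : H1 f g -> is_multiplier (fun xi => `|xi|) f (half_laplacian f).
Proof.
move=> [lf lg wd]; apply: (@xgetPex _ (fun=> 0) [set w | is_multiplier (fun xi => `|xi|) f w]).
have [fh ff] := fourier_exists lf; have [gh fg] := fourier_exists lg.
have e := fourier_deriv lg wd ff fg; have [_ lfh _] := ff; have [_ lgh _] := fg.
have [|wv fw] := @fourier_surj R (fun xi => (`|xi|)%:C * fh xi).
  apply: proj1 (@L2_leK _ _ gh 1 _ lgh _).
    by apply: cmeasM; [apply: (@cmeas_real _ (fun xi => `|xi|)); exact: normr_measurable|exact: L2_cmeas].
  apply: ae_imp e => xi ->; rewrite mul1r !sqcM sqc_real sqc_imag.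
  by rewrite real_normK ?num_real.
by exists wv, fh, (fun xi => (`|xi|)%:C * fh xi); split => //; exact: aeeq_refl.
Qed.

(** |xi| and i xi have the same modulus. *)
Lemma half_laplacian_H1 f g : H1 f g ->
  L2 (half_laplacian f) /\ L2sq (half_laplacian f) = L2sq g.
Proof.
move=> H; have [lf lg wd] := H.
have [fh [wh [ff fw e1]]] := half_laplacian_spec H.
have [gh fg] := fourier_exists lg; have e := fourier_deriv lg wd ff fg.
have [lorentz _ _] := fw; split => //.
have k0 : 2 * kappa != 0 :> R by rewrite gt_eqF// mulr_gt0// kappa_gt0.
apply: (mulfI k0); rewrite -(fourier_isometry fw) -(fourier_isometry fg).
have [_ lwh _] := fw; have [_ lgh _] := fg.
congr fine; apply: ae_eq_integral => //.
- by apply/measurable_EFinP; apply: cmeas_sqc; exact: L2_cmeas.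
- by apply/measurable_EFinP; apply: cmeas_sqc; exact: L2_cmeas.
apply: ae_imp2 e e1 => xi -> -> _; rewrite !sqcM sqc_real sqc_imag.
by rewrite real_normK ?num_real.
Qed.

Lemma H1_lin z f f' g g' : H1 f f' -> H1 g g' ->
  H1 (fun x => z * f x + g x) (fun x => z * f' x + g' x).
Proof.
move=> Hf Hg; have [lf lf' _] := Hf; have [lg lg' _] := Hg.
have [_ _ df] := Hf; have [_ _ dg] := Hg.
by split; [exact: L2D (L2Z _ _) _|exact: L2D (L2Z _ _) _|exact: weak_deriv_lin].
Qed.

Lemma half_laplacian_lin z f f' g g' : H1 f f' -> H1 g g' ->
  aeeq (half_laplacian (fun x => z * f x + g x))
       (fun x => z * half_laplacian f x + half_laplacian g x).
Proof.
move=> Hf Hg; apply: multiplier_unique (half_laplacian_spec (H1_lin z Hf Hg)) _.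
by apply: multiplier_lin; [exact: half_laplacian_spec Hf|exact: half_laplacian_spec Hg].
Qed.

Lemma half_laplacian_ae f g h : H1 f g -> cmeas h -> aeeq f h ->
  aeeq (half_laplacian f) (half_laplacian h).
Proof.
move=> Hf mh fh; have s := multiplier_ae mh fh (half_laplacian_spec Hf).
apply: multiplier_unique s _.
by apply: (@xgetPex _ (fun=> 0) [set w | is_multiplier (fun xi => `|xi|) h w]); exists (half_laplacian f); exact: multiplier_ae mh fh (half_laplacian_spec Hf).
Qed.

Lemma lorentz_L1 : L1 (@lorentz R).
Proof. exact: lorentz_int. Qed.

(** Young's inequality |r| <= lorentz/d + d (1 + xi^2) r^2, for every d > 0.  The
free parameter makes the bound homogeneous in r once d is adapted to the
integral of b. *)
Lemma weighted_L1 (r b : R -> R) : measurable_fun setT r -> L1 b ->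
  {ae mu, forall xi, (1 + xi ^+ 2) * r xi ^+ 2 <= b xi} ->
  L1 r /\ (forall d : R, 0 < d -> \int[mu]_xi `|r xi| <= (\int[mu]_xi lorentz xi) / d + d * \int[mu]_xi b xi).
Proof.
move=> mr ib rb.
have key (d : R) : 0 < d -> {ae mu, forall xi, `|r xi| <= d^-1 * lorentz xi + d * b xi}.
  move=> d0; apply: ae_imp rb => xi h.
  have [l0 _ _] := lorentz_facts xi.
  have p : 1 + xi ^+ 2 = (lorentz xi)^-1 by rewrite /lorentz invrK.
  rewrite p in h; have := real_normK (num_real (r xi)).
  have := normr_ge0 (r xi); move: (`|r xi| : R) => s s0 sE; rewrite -sE in h.
  have h' : s ^+ 2 <= lorentz xi * b xi.
    by move: h; rewrite mulrC ler_pdivrMr// mulrC.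
  have q : 0 < d^-1 * lorentz xi by apply: mulr_gt0 => //; rewrite invr_gt0.
  have h2 : s ^+ 2 <= (d^-1 * lorentz xi) * (d * b xi).
    by rewrite mulrACA mulVf ?mul1r// gt_eqF.
  move: h2 q; set A := d^-1 * _; set B := d * _ => h2 q.
  have B0 : 0 <= B by rewrite -(pmulr_rge0 _ q); exact: le_trans (sqr_ge0 s) h2.
  rewrite leNgt; apply/negP => h3; have : (A + B) ^+ 2 < s ^+ 2.
    by rewrite ltr_pXn2r// nnegrE// addr_ge0// ltW.
  by have := sqr_ge0 A; have := sqr_ge0 B; nra.
have ibd (d : R) : L1 (fun xi => d^-1 * lorentz xi + d * b xi).
  by apply: L1D; apply: integrable_scale => //; exact: lorentz_L1.
have ir : L1 r by exact: ae_le_integrable mr (ibd 1) (key 1 ltr01).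
split => // d d0; rewrite mulrC -(RintZ d^-1 lorentz_L1) -(RintZ d ib).
rewrite -(RintD (integrable_scale d^-1 lorentz_L1) (integrable_scale d ib)).
apply: ae_le_Rintegral => //; [by have /integrable_norm := ir|exact: ibd|exact: key].
Qed.

(** The bound of [weighted_L1] at d = 1/sqrt S. *)
Lemma scaled_amgm (X L S : R) : 0 <= X -> 0 <= L -> 0 <= S ->
  (forall d : R, 0 < d -> X <= L / d + d * S) -> X ^+ 2 <= (L + 1) ^+ 2 * S.
Proof.
move=> X0 L0 S0 h; have [S_0|Sn] := eqVneq S 0.
  rewrite S_0 mulr0; have [->|Xn] := eqVneq X 0; first by rewrite expr0n.
  have Xp : 0 < X by rewrite lt_neqAle eq_sym Xn.
  have := h ((L + 1) / X); rewrite divr_gt0 ?ltr_wpDl// => /(_ isT).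
  rewrite S_0 mulr0 addr0 invf_div mulrA ler_pdivlMr ?ltr_wpDl//; nra.
have Sp : 0 < S by rewrite lt_neqAle eq_sym Sn.
pose s := Num.sqrt S; have s0 : 0 < s by rewrite sqrtr_gt0.
have sE : s ^+ 2 = S by rewrite sqr_sqrtr.
have := h s^-1; rewrite invr_gt0 => /(_ s0); rewrite invrK -sE expr2 mulKf ?gt_eqF// => h2.
rewrite -expr2 -exprMn lerXn2r ?nnegrE//; first by rewrite mulr_ge0 ?addr_ge0// ltW.
by rewrite mulrDl mul1r.
Qed.

Lemma Ct_norm_le p xi : L1 p -> `|Ct p xi| <= \int[mu]_x `|p x|.
Proof.
move=> ip; apply: le_trans (le_normr_Rintegral measurableT (L1_cos xi ip)) _.
apply: le_Rintegral => //; [by have /integrable_norm := L1_cos xi ip|by have /integrable_norm := ip|].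
by move=> y _; rewrite normrM ler_piMr// cos_max.
Qed.

Lemma St_norm_le p xi : L1 p -> `|St p xi| <= \int[mu]_x `|p x|.
Proof.
move=> ip; apply: le_trans (le_normr_Rintegral measurableT (L1_sin xi ip)) _.
apply: le_Rintegral => //; [by have /integrable_norm := L1_sin xi ip|by have /integrable_norm := ip|].
by move=> y _; rewrite normrM ler_piMr// sin_max.
Qed.

(** The truncated transforms converge to k in mean and to the Fourier integral
pointwise, so Fatou's lemma identifies the two. *)
Lemma fourier_L1 f k : cL1 f -> is_fourier f k -> aeeq k (Fhat f).
Proof.
move=> [ir ii] /is_fourierP[lf lk c]; have [_ ct lF _] := trunc_L2_cvg lf.
have mF : cmeas (Fhat f) by exact: cmeas_Fhat.
have pw (u k0 : R -> R) : L1 (fun x => u x * k0 x) ->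
   \int[mu]_x (ind n x * u x * k0 x) @[n --> \oo] --> \int[mu]_x (u x * k0 x).
  move=> iu; apply: (@cvg_Rint_dct _ _ _ (fun x => `|u x * k0 x|)).
  - move=> n; under eq_fun do rewrite -mulrA.
    by apply: measurable_funM; [exact: measurable_ind|exact: L1_meas].
  - exact: L1_meas.
  - by have /integrable_norm := iu.
  - apply: aeW => x; apply: cvg_near_cst.
    by apply: filterS (ind_near x) => n ->; rewrite mul1r.
  - move=> n; apply: aeW => x; rewrite -mulrA normrM ler_piMl//.
    by have /andP[i0 i1] := ind01 n x; rewrite ger0_norm.
have reE n : (fun x => complex.Re (trunc n f x)) = (fun x => ind n x * complex.Re (f x)).
  by apply/funext => x; rewrite trunc_Re.
have imE n : (fun x => complex.Im (trunc n f x)) = (fun x => ind n x * complex.Im (f x)).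
  by apply/funext => x; rewrite trunc_Im.
have cF xi : sqc (Fhat (trunc n f) xi - k xi) @[n --> \oo] --> sqc (Fhat f xi - k xi).
  apply: (@cvg_sqc _ (fun n => Fhat (trunc n f) xi - k xi)).
    under eq_fun do rewrite ReD Fhat_Re reE imE.
    rewrite ReD Fhat_Re; apply: cvgD; last exact: cvg_cst.
    by apply: cvgD; apply: pw; [exact: L1_cos|exact: L1_sin].
  under eq_fun do rewrite ImD Fhat_Im reE imE.
  rewrite ImD Fhat_Im; apply: cvgD; last exact: cvg_cst.
  by apply: cvgB; apply: pw; [exact: L1_cos|exact: L1_sin].
have mk := L2_cmeas lk.
have lFk n : L2 (fun xi => Fhat (trunc n f) xi - k xi) by exact: L2B.
have mFk : cmeas (fun xi => Fhat f xi - k xi) by apply: cmeasD => //; exact: cmeasN.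
have i0 : (\int[mu]_xi (sqc (Fhat f xi - k xi))%:E <= 0)%E.
  apply/lee_addgt0Pr => e e0; rewrite add0e.
  apply: (@fatou_bound _ (fun n xi => sqc (Fhat (trunc n f) xi - k xi))).
  - by move=> n; apply: cmeas_sqc; exact: L2_cmeas.
  - exact: cmeas_sqc.
  - by move=> *; exact: sqc_ge0.
  - by move=> *; exact: sqc_ge0.
  - exact: aeW.
  - move/cvgrPdist_lt : c => /(_ _ e0); apply: filterS => n.
    rewrite sub0r normrN ger0_norm ?L2sq_ge0// => h.
    rewrite -(EFin_Rint (L2_int (lFk n))) lee_fin; exact: ltW.
have lf0 : L2 (fun xi => Fhat f xi - k xi).
  by apply/L2P; split => //; rewrite (le_lt_trans i0)// ltry.
have : L2sq (fun xi => Fhat f xi - k xi) = 0.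
  apply/eqP; rewrite eq_le L2sq_ge0 andbT -lee_fin /L2sq (EFin_Rint (L2_int lf0)); exact: i0.
move/(L2sq_eq0 lf0); apply: ae_imp => xi /eqP.
by rewrite subr_eq0 => /eqP.
Qed.

(** The transform of u0 is integrable because (1 + xi^2) times its squared modulus
is.  Inverting it by the absolutely convergent integral gives a
bound at every point. *)
Lemma inversion_L1 (u0 u1 uh : cfun R) : H1 u0 u1 -> is_fourier u0 uh ->
  let f := fun x => ((2 * kappa)^-1)%:C * conjf uh x in
  [/\ cL1 f, aeeq (conjf u0) (Fhat f) &
    forall xi, sqc (Fhat f xi) <= 8 * ((\int[mu]_xi lorentz xi) + 1) ^+ 2 * (2 * kappa)^-1 * (L2sq u0 + L2sq u1)].
Proof.
move=> [l0 l1 wd] fu f.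
have cjK : conjf (conjf u0) = u0 by apply/funext => x; rewrite /conjf /= opprK; case: (u0 x).
have [_ luh _] := fu.
have [gh fg] := fourier_exists l1; have e := fourier_deriv l1 wd fu fg.
have [_ lgh _] := fg.
have finv : is_fourier f (conjf u0).
  by apply: fourier_inverse; [exact: L2_conjf|rewrite cjK].
have [lf _ _] := finv; have [mr mi] := L2_cmeas lf.
pose b xi := (2 * kappa)^-1 ^+ 2 * (sqc (uh xi) + sqc (gh xi)).
have ib0 : L1 (fun xi => sqc (uh xi) + sqc (gh xi)) := L1D (L2_int luh) (L2_int lgh).
have ib : L1 b by exact: integrable_scale.
have fb : {ae mu, forall xi, (1 + xi ^+ 2) * sqc (f xi) <= b xi}.
  apply: ae_imp e => xi h; rewrite /b h /f !sqcM sqc_real sqc_imag sqc_conjf.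
  by rewrite le_eqVlt; apply/orP; left; apply/eqP; ring.
have k0 := @kappa_gt0 R.
have Ib : \int[mu]_xi b xi = (2 * kappa)^-1 * (L2sq u0 + L2sq u1).
  rewrite (RintZ _ ib0) (RintD (L2_int luh) (L2_int lgh)) -/(L2sq uh) -/(L2sq gh).
  rewrite (fourier_isometry fu) (fourier_isometry fg).
  by move: (L2sq u0) (L2sq u1) (@kappa R) k0 => c1 c2 k k0 /=; clear -k0; field; lra.
have [ir br] : L1 (fun xi => complex.Re (f xi)) /\ (forall d : R, 0 < d ->
   \int[mu]_xi `|complex.Re (f xi)| <= (\int[mu]_xi lorentz xi) / d + d * \int[mu]_xi b xi).
  apply: weighted_L1 => //; apply: ae_imp fb => xi; apply: le_trans.
  by rewrite ler_wpM2l ?addr_ge0 ?sqr_ge0// lerDl sqr_ge0.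
have [ii bi] : L1 (fun xi => complex.Im (f xi)) /\ (forall d : R, 0 < d ->
   \int[mu]_xi `|complex.Im (f xi)| <= (\int[mu]_xi lorentz xi) / d + d * \int[mu]_xi b xi).
  apply: weighted_L1 => //; apply: ae_imp fb => xi; apply: le_trans.
  by rewrite ler_wpM2l ?addr_ge0 ?sqr_ge0// lerDr sqr_ge0.
have L0 : 0 <= \int[mu]_xi lorentz xi.
  by apply: Rintegral_ge0 => x _; have [/ltW] := lorentz_facts x.
have S0 : 0 <= (2 * kappa)^-1 * (L2sq u0 + L2sq u1).
  by rewrite mulr_ge0 ?addr_ge0 ?L2sq_ge0// invr_ge0 mulr_ge0// ltW.
have n0 (r : R -> R) : 0 <= \int[mu]_xi `|r xi| by apply: Rintegral_ge0.
have ar := scaled_amgm (n0 _) L0 S0; have ai := ar (fun x => complex.Im (f x)).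
rewrite Ib in br bi; have {ar}ar := ar _ br; have {ai}ai := ai bi.
split; [by split|exact: fourier_L1 finv|move=> xi].
have h1 := Ct_norm_le xi ir; have h2 := St_norm_le xi ii.
have h3 := Ct_norm_le xi ii; have h4 := St_norm_le xi ir.
have sq (s t : R) : `|s| <= t -> s ^+ 2 <= t ^+ 2.
  move=> st; rewrite -(real_normK (num_real s)) lerXn2r// nnegrE//.
  exact: le_trans st.
have {}h1 := sq _ _ h1; have {}h2 := sq _ _ h2; have {}h3 := sq _ _ h3; have {}h4 := sq _ _ h4.
rewrite /sqc Fhat_Re Fhat_Im.
move: (Ct _ _) (St _ _) (Ct _ _) (St _ _) h1 h2 h3 h4 => c1 s1 c2 s2 h1 h2 h3 h4.
move: ar ai; set Q := _ ^+ 2 * ((2 * kappa)^-1 * _) => ar ai.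
have -> : 8 * ((\int[mu]_xi0 lorentz xi0) + 1) ^+ 2 * (2 * kappa)^-1 * (L2sq u0 + L2sq u1) = 8 * Q.
  by rewrite /Q !mulrA.
have k1 := le_trans h1 ar; have k2 := le_trans h2 ai.
have k3 := le_trans h3 ai; have k4 := le_trans h4 ar.
have := sqr_ge0 (c1 - s1); have := sqr_ge0 (c1 + s1); have := sqr_ge0 (c2 + s2).
have := sqr_ge0 (c2 - s2); nra.
Qed.
End HalfLaplacian.

(** * The Sobolev embedding on the line *)

Section Sobolev.
Context {R : realType}.
Local Notation mu := (@lebesgue_measure R).
Implicit Types (p u v a k phi w : R -> R) (x y xi e : R) (f g h : cfun R) (z : R[i]).

Definition sobolev_cst : R := 8 * ((\int[mu]_xi lorentz xi) + 1) ^+ 2 * (2 * kappa)^-1.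

Lemma sobolev_cst_ge0 : 0 <= sobolev_cst.
Proof. have k0 := @kappa_gt0 R; rewrite /sobolev_cst; apply: mulr_ge0; first by apply: mulr_ge0 => //; exact: sqr_ge0.
by rewrite invr_ge0 mulr_ge0// ltW. Qed.

Lemma sobolev_sup f g : H1 f g -> {ae mu, forall x, sqc (f x) <= sobolev_cst * (L2sq f + L2sq g)}.
Proof.
move=> H; have [lf _ _] := H; have [fh ff] := fourier_exists lf.
have [_ e b] := inversion_L1 H ff.
by apply: ae_imp e => x ex; rewrite -sqc_conjf ex; exact: b.
Qed.

(** Differentiation under the integral sign, for a derivative with an integrable
bound that is uniform in the parameter. *)
Lemma derive_under (F F' : R -> R -> R) (G : R -> R) :
  (forall x, L1 (F x)) -> (forall x y, is_derive x 1 (F ^~ y) (F' x y)) ->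
  L1 G -> (forall x y, `|F' x y| <= G y) ->
  forall x, is_derive x 1 (fun x => \int[mu]_y F x y) (\int[mu]_y F' x y).
Proof.
move=> iF dF iG hG x.
have Ia : `](x - 1), (x + 1)[%classic x by rewrite /= in_itv /=; lra.
have G0 y : 0 <= G y by exact: le_trans (normr_ge0 _) (hG x y).
have d1 t y : derive1 (F ^~ y) t = F' t y by apply: derive1_is; exact: dF.
have hd : forall t y, `](x - 1), (x + 1)[%classic t -> [set: R] y -> derivable (F ^~ y) t 1.
  by move=> t y _ _; apply: ex_derive; exact: dF.
have hb : forall t y, `](x - 1), (x + 1)[%classic t -> [set: R] y -> `|partial1of2 F t y| <= G y.
  by move=> t y _ _; rewrite /partial1of2 d1.
have dv := derivable_under_integral measurableT Ia (fun t _ => iF t) hd G0 iG hb.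
have e := differentiation_under_integral measurableT Ia (fun t _ => iF t) hd G0 iG hb.
apply: DeriveDef; first exact: dv.
rewrite -derive1E e; apply: eq_Rintegral => y _; exact: d1.
Qed.

Lemma is_derive_cosM xi y : is_derive xi 1 (fun t : R => cos (y * t)) (- sin (y * xi) * y).
Proof.
have [h _] := C1_cos y; have := h xi; under eq_fun do rewrite mulrC.
by move=> h'; apply: is_derive_eq h' _; rewrite (mulrC xi); ring.
Qed.

Lemma is_derive_sinM xi y : is_derive xi 1 (fun t : R => sin (y * t)) (cos (y * xi) * y).
Proof.
have [h _] := C1_sin y; have := h xi; under eq_fun do rewrite mulrC.
by move=> h'; apply: is_derive_eq h' _; rewrite (mulrC xi); ring.
Qed.

Lemma C1_Ct a : L1 a -> L1 (fun x => x * a x) -> C1 (Ct a) (fun xi => - St (fun x => x * a x) xi).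
Proof.
move=> ia ib; split; last by move=> x; apply: cvgN; exact: continuous_St.
move=> xi; rewrite (_ : - _ = \int[mu]_y (a y * (- sin (y * xi) * y))).
  apply: (@derive_under (fun xi y => a y * cos (y * xi)) (fun xi y => a y * (- sin (y * xi) * y)) (fun y => `|y * a y|)).
  - by move=> t; exact: L1_cos.
  - move=> t y; have := is_derive_cosM t y => h; exact: is_deriveZ.
  - by have /integrable_norm := ib.
  - move=> t y; rewrite (_ : _ * _ = y * a y * - sin (y * t)); last by ring.
    by rewrite normrM normrN ler_piMr// sin_max.
rewrite /St -mulN1r -RintZ; last exact: L1_sin.
by apply: eq_Rintegral => y _; ring.
Qed.

Lemma C1_St a : L1 a -> L1 (fun x => x * a x) -> C1 (St a) (fun xi => Ct (fun x => x * a x) xi).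
Proof.
move=> ia ib; split; last by move=> x; exact: continuous_Ct.
move=> xi; rewrite (_ : Ct _ _ = \int[mu]_y (a y * (cos (y * xi) * y))).
  apply: (@derive_under (fun xi y => a y * sin (y * xi)) (fun xi y => a y * (cos (y * xi) * y)) (fun y => `|y * a y|)).
  - by move=> t; exact: L1_sin.
  - move=> t y; have := is_derive_sinM t y => h; exact: is_deriveZ.
  - by have /integrable_norm := ib.
  - move=> t y; rewrite (_ : _ * _ = y * a y * cos (y * t)); last by ring.
    by rewrite normrM ler_piMr// cos_max.
by rewrite /Ct; apply: eq_Rintegral => y _; ring.
Qed.

Lemma C1D a a' b b' : C1 a a' -> C1 b b' -> C1 (fun x => a x + b x) (fun x => a' x + b' x).
Proof.
move=> [ha ca] [hb cb]; split; first by move=> x; have := ha x; have := hb x => *; exact: is_deriveD.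
by move=> x; apply: cvgD; [exact: ca|exact: cb].
Qed.

Lemma CtSt_ae a b xi : L1 a -> L1 b -> {ae mu, forall x, a x = b x} ->
  Ct a xi = Ct b xi /\ St a xi = St b xi.
Proof.
move=> ia ib e; split; congr fine; apply: ae_eq_integral => //;
  try (by apply: ae_imp e => x -> _).
- exact: measurable_int (L1_cos xi ia).
- exact: measurable_int (L1_cos xi ib).
- exact: measurable_int (L1_sin xi ia).
- exact: measurable_int (L1_sin xi ib).
Qed.

(** The integral of inversion may be differentiated because xi times the transform
of eta is integrable, being up to a constant the transform of g, to which
[weighted_L1] applies as well.  The derivative of the integral is then the
inversion integral of g. *)
Lemma H2_C1_rep (eta : R -> R) g h : H1 (of_real eta) g -> H1 g h ->
  exists eta1 eta1', [/\ C1 eta1 eta1', {ae mu, forall x, eta x = eta1 x} &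
    {ae mu, forall x, complex.Re (g x) = eta1' x}].
Proof.
move=> Hu Hg; have [lu lg du] := Hu; have [_ lh dg] := Hg.
have [uh fu] := fourier_exists lu; have [gh fg] := fourier_exists lg.
have [hh fh] := fourier_exists lh.
have eg := fourier_deriv lg du fu fg; have eh := fourier_deriv lh dg fg fh.
have [[ir ii] e _] := inversion_L1 Hu fu.
set f : cfun R := fun x => _ in ir ii e.
have [_ lgh _] := fg; have [_ lhh _] := fh.
pose b xi := (2 * kappa)^-1 ^+ 2 * (sqc (gh xi) + sqc (hh xi)).
have ib : L1 b by apply: integrable_scale; exact: L1D (L2_int lgh) (L2_int lhh).
have fb : {ae mu, forall xi, (1 + xi ^+ 2) * (xi ^+ 2 * sqc (f xi)) <= b xi}.
  apply: ae_imp2 eg eh => xi h1 h2; rewrite /b h2 h1 /f !sqcM sqc_real sqc_imag sqc_conjf.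
  by rewrite le_eqVlt; apply/orP; left; apply/eqP; ring.
have mid : measurable_fun setT (fun x : R => x) by exact: measurable_id.
have ir' : L1 (fun xi => xi * complex.Re (f xi)).
  refine (proj1 (weighted_L1 _ ib _)); first by apply: measurable_funM => //; exact: L1_meas.
  apply: ae_imp fb => xi; apply: le_trans.
  by rewrite ler_wpM2l ?addr_ge0 ?sqr_ge0// exprMn ler_wpM2l ?sqr_ge0// lerDl sqr_ge0.
have ii' : L1 (fun xi => xi * complex.Im (f xi)).
  refine (proj1 (weighted_L1 _ ib _)); first by apply: measurable_funM => //; exact: L1_meas.
  apply: ae_imp fb => xi; apply: le_trans.
  by rewrite ler_wpM2l ?addr_ge0 ?sqr_ge0// exprMn ler_wpM2l ?sqr_ge0// lerDr sqr_ge0.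
have C := C1D (C1_Ct ir ir') (C1_St ii ii').
eexists; eexists; split; first exact: C.
  by apply: ae_imp e => x ex; rewrite -[LHS]/(complex.Re (conjf (of_real eta) x)) ex Fhat_Re.
have [[jr ji] e2 _] := inversion_L1 Hg fg.
apply: ae_imp e2 => x ex; rewrite -[LHS]/(complex.Re (conjf g x)) ex Fhat_Re.
have reE : {ae mu, forall t, complex.Re (((2 * kappa)^-1)%:C * conjf gh t) = t * complex.Im (f t)}.
  by apply: ae_imp eg => t et; rewrite /f /conjf et; case: (uh t) => a1 a2 /=; ring.
have imE : {ae mu, forall t, complex.Im (((2 * kappa)^-1)%:C * conjf gh t) = -1 * (t * complex.Re (f t))}.
  by apply: ae_imp eg => t et; rewrite /f /conjf et; case: (uh t) => a1 a2 /=; ring.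
have [-> _] := CtSt_ae x jr ii' reE.
have [_ ->] := CtSt_ae x ji (integrable_scale (-1) ir') imE.
by rewrite (StZ _ _ ir') mulN1r addrC.
Qed.
End Sobolev.

(** * Products in H^1 *)

Section Multipliers.
Context {R : realType}.
Local Notation mu := (@lebesgue_measure R).
Implicit Types (p u v a k phi w : R -> R) (x y xi e : R) (f g h : cfun R) (z : R[i]).

Lemma sobolev0 (n : nat) f : sobolev n f -> L2 f.
Proof. by case: n => [|n] //= []. Qed.

Lemma sobolev1P f : sobolev 1 f <-> H1 f (wD f).
Proof.
split=> [[lf [g [d lg]]]|[lf lg d]]; last by split => //; exists (wD f).
by have [l' d' _] := wD_spec d lg.
Qed.

Lemma H1_sobolev f g : H1 f g -> sobolev 1 f.
Proof. by move=> [lf lg d]; split => //; exists g. Qed.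

Lemma H1_wD f g : H1 f g -> H1 f (wD f) /\ aeeq (wD f) g.
Proof. by move=> [lf lg d]; have [l' d' e] := wD_spec d lg. Qed.

Lemma H1_ae f f1 g g1 : H1 f g -> cmeas f1 -> cmeas g1 -> aeeq f f1 -> aeeq g g1 -> H1 f1 g1.
Proof.
move=> [lf lg d] m1 m2 e1 e2; split; [exact: L2_ae e1 lf|exact: L2_ae e2 lg|].
exact: weak_deriv_ae e1 e2 d.
Qed.

Lemma sobolev2P f : sobolev 2 f <-> H1 f (wD f) /\ H1 (wD f) (wD (wD f)).
Proof.
split=> [[lf [g [d [lg [h [d' lh]]]]]]|[[lf lg d] [_ lh d']]].
  have [l1 d1 e1] := wD_spec d lg; have H : H1 f (wD f) by [].
  have H' : H1 (wD f) h.
    exact: H1_ae (And3 lg lh d') (L2_cmeas l1) (L2_cmeas lh) (aeeq_sym e1) (@aeeq_refl R h).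
  by split; [exact: H|exact: (proj1 (H1_wD H'))].
by split => //; exists (wD f); split => //; split => //; exists (wD (wD f)).
Qed.

Lemma sobolev_norm1_sqr f : sobolev_norm 1 f ^+ 2 = L2sq f + L2sq (wD f).
Proof.
rewrite /sobolev_norm sqr_sqrtr; last by apply: sumr_ge0 => i _; exact: sqr_ge0.
by rewrite !big_ord_recr big_ord0 /= add0r !L2norm_sqr.
Qed.

Lemma H1L2norm_sqr (U : state R) : H1L2norm U ^+ 2 = L2sq U.1 + L2sq (wD U.1) + L2sq U.2.
Proof.
by rewrite sqr_sqrtr ?addr_ge0 ?sqr_ge0// sobolev_norm1_sqr L2norm_sqr.
Qed.

Lemma H1L2norm_ge0 (U : state R) : 0 <= H1L2norm U.
Proof. exact: sqrtr_ge0. Qed.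

Lemma calT_H1 f g : H1 f g -> L2 (calT f) /\ L2sq (calT f) <= 2 * (L2sq f + L2sq g).
Proof.
move=> H; have [lf _ _] := H; have [lh e] := half_laplacian_H1 H.
by split; [exact: L2D|rewrite mulrDr -e; exact: L2sqD].
Qed.

Lemma calT_lin z f f' g g' : H1 f f' -> H1 g g' ->
  aeeq (calT (fun x => z * f x + g x)) (fun x => z * calT f x + calT g x).
Proof.
move=> Hf Hg; apply: ae_imp (half_laplacian_lin z Hf Hg) => x e; rewrite /calT e.
by rewrite mulrDr addrACA.
Qed.

Lemma calT_ae f g h : H1 f g -> cmeas h -> aeeq f h -> aeeq (calT f) (calT h).
Proof.
by move=> H m e; apply: ae_imp2 e (half_laplacian_ae H m e) => x; rewrite /calT => -> ->.
Qed.

Lemma L2_mul_H1 f g h : H1 f g -> L2 h ->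
  L2 (fun x => h x * f x) /\ L2sq (fun x => h x * f x) <= sobolev_cst * (L2sq f + L2sq g) * L2sq h.
Proof.
move=> H lh; have [lf _ _] := H; apply: L2_leK => //.
  by apply: cmeasM; exact: L2_cmeas.
by apply: ae_imp (sobolev_sup H) => x e; rewrite sqcM mulrC ler_wpM2r ?sqc_ge0.
Qed.

Lemma L2_mulr_le a f (M : R) : measurable_fun setT a -> {ae mu, forall x, a x ^+ 2 <= M} ->
  L2 f -> L2 (mulc a f) /\ L2sq (mulc a f) <= M * L2sq f.
Proof.
move=> ma h lf; apply: L2_leK => //; first exact: cmeas_mulc (L2_cmeas lf).
by apply: ae_imp h => x h; rewrite sqc_mulc ler_wpM2r ?sqc_ge0.
Qed.

(** A wall is only known up to a null set, while the chain rule needs pointwise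
derivatives; hence the representative a1.  Its derivative is taken in L^2
because it will multiply bounded functions. *)
Definition C1rep a a1 (a1' : R -> R) := [/\ measurable_fun setT a, {ae mu, forall x, a x = a1 x},
  C1 a1 a1' & L2 (of_real a1')].

(** In a1' f the factor a1' is in L^2 and f is bounded, in a1 g it is the other
way round. *)
Lemma H1_mulc a a1 a1' f g (M : R) : 0 <= M -> C1rep a a1 a1' -> {ae mu, forall x, a x ^+ 2 <= M} -> H1 f g ->
  H1 (mulc a f) (fun x => mulc a1' f x + mulc a1 g x) /\
  L2sq (mulc a f) + L2sq (fun x => mulc a1' f x + mulc a1 g x) <=
    2 * (M + sobolev_cst * L2sq (of_real a1')) * (L2sq f + L2sq g).
Proof.
move=> M0 [ma ea C la'] hM H; have [lf lg d] := H.
have m1 : measurable_fun setT a1 by apply: continuous_measurable_fun; exact: C1_continuous C.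
have [l1 c1] := L2_mulr_le ma hM lf.
have hM1 : {ae mu, forall x, a1 x ^+ 2 <= M} by apply: ae_imp2 ea hM => x ->.
have [l2 c2] := L2_mulr_le m1 hM1 lg.
have [l3 c3] := L2_mul_H1 H la'.
have lD : L2 (fun x => mulc a1' f x + mulc a1 g x) by exact: L2D l3 l2.
split.
  split => //; apply: weak_deriv_ae (weak_deriv_mul C d).
  - exact: L2_cmeas.
  - exact: L2_cmeas.
  - by apply: ae_imp ea => x; rewrite /mulc => ->.
  - exact: aeeq_refl.
have := L2sqD l3 l2; have := L2sq_ge0 f; have := L2sq_ge0 g; have := L2sq_ge0 (of_real a1').
have := @sobolev_cst_ge0 R.
have -> : L2sq (fun x => of_real a1' x * f x + mulc a1 g x) = L2sq (fun x => mulc a1' f x + mulc a1 g x) by [].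
move: c1 c2 c3; rewrite -/(mulc a1' f).
move: (L2sq (mulc a f)) (L2sq (fun x => _ + _)) (L2sq _) (L2sq _) (L2sq _) (L2sq _) (L2sq _) => t1 t2 t3 t4 t5 t6 t7.
nra.
Qed.
End Multipliers.

(** * Linearity of the generators *)

Section Operators.
Context {R : realType}.
Local Notation mu := (@lebesgue_measure R).
Implicit Types (p a F k phi w psi : R -> R) (x y xi e : R) (f g h u v : cfun R) (z : R[i]).

(** The common properties of sine and cosine, so that the two parts of the
nonlocal term are estimated together. *)
Definition trig_pair (F F' : R -> R) := [/\ C1 F F', forall x, F x ^+ 2 <= 1 /\ F' x ^+ 2 <= 1,
  forall x y, (F x - F y) ^+ 2 <= (x - y) ^+ 2 & forall x y, (F' x - F' y) ^+ 2 <= (x - y) ^+ 2].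

Lemma sin_sqr_le x : sin x ^+ 2 <= 1.
Proof. by have := sin2cos2 x; have := sqr_ge0 (cos x) => h1 h2; rewrite h2; lra. Qed.

Lemma cos_sqr_le x : cos x ^+ 2 <= 1.
Proof. by have := cos2sin2 x; have := sqr_ge0 (sin x) => h1 h2; rewrite h2; lra. Qed.

(** The form taken by a difference of sines or cosines when written as a product. *)
Lemma half_lip (b d : R) : b ^+ 2 <= 1 -> (2 * b * sin (d / 2)) ^+ 2 <= d ^+ 2.
Proof.
move=> hb; have h : sin (d / 2) ^+ 2 <= (d / 2) ^+ 2.
  rewrite -(real_normK (num_real (sin _))) -(real_normK (num_real (d / 2))).
  by rewrite lerXn2r ?nnegrE// sin_abs_le.
have -> : (2 * b * sin (d / 2)) ^+ 2 = b ^+ 2 * (4 * sin (d / 2) ^+ 2) by ring.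
have h4 : 4 * sin (d / 2) ^+ 2 <= d ^+ 2 by move: h; nra.
rewrite -[leRHS]mul1r; apply: ler_pM => //; rewrite ?sqr_ge0//.
by apply: mulr_ge0 => //; exact: sqr_ge0.
Qed.

Lemma sin_lip x y : (sin x - sin y) ^+ 2 <= (x - y) ^+ 2.
Proof.
apply: le_trans (half_lip (x - y) (cos_sqr_le ((x + y) / 2))).
rewrite (_ : sin x - sin y = 2 * cos ((x + y) / 2) * sin ((x - y) / 2)) //.
have ex : x = (x + y) / 2 + (x - y) / 2 by field.
have ey : y = (x + y) / 2 - (x - y) / 2 by field.
rewrite {1}ex {3}ey.
by move: ((x + y) / 2) ((x - y) / 2) => p q; rewrite sinD sinB; ring.
Qed.

Lemma cos_lip x y : (cos x - cos y) ^+ 2 <= (x - y) ^+ 2.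
Proof.
apply: le_trans (half_lip (x - y) (sin_sqr_le ((x + y) / 2))).
rewrite (_ : cos x - cos y = - (2 * sin ((x + y) / 2) * sin ((x - y) / 2))) ?sqrrN //.
have ex : x = (x + y) / 2 + (x - y) / 2 by field.
have ey : y = (x + y) / 2 - (x - y) / 2 by field.
rewrite {1}ex {3}ey.
by move: ((x + y) / 2) ((x - y) / 2) => p q; rewrite cosD cosB; ring.
Qed.

Lemma trig_sin : trig_pair (@sin R) (@cos R).
Proof.
split; [|by move=> x; split; [exact: sin_sqr_le|exact: cos_sqr_le]|exact: sin_lip|exact: cos_lip].
by split; [move=> x; exact: is_derive_sin|exact: continuous_cos].
Qed.

Lemma trig_cos : trig_pair (@cos R) (fun x => - sin x).
Proof.
split; first by split; [move=> x; exact: is_derive_cos|move=> x; apply: cvgN; exact: continuous_sin].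
- by move=> x; rewrite sqrrN; split; [exact: cos_sqr_le|exact: sin_sqr_le].
- exact: cos_lip.
- by move=> x y; rewrite -opprB opprK sqrrN addrC sin_lip.
Qed.

Lemma C1_comp F (F' : R -> R) a (a' : R -> R) : C1 F F' -> C1 a a' -> C1 (fun x => F (a x)) (fun x => F' (a x) * a' x).
Proof.
move=> CF C; have [hF cF'] := CF; have [h ca'] := C; have ca := C1_continuous C; split.
  move=> x; have hx := h x; have := is_derive1_comp (hF (a x)) hx.
  by move=> h'; apply: is_derive_eq h' _; rewrite mulrC.
move=> x; apply: cvgM; last exact: ca'.
apply: continuous_comp; [exact: ca|exact: cF'].
Qed.

Lemma C1_continuous_meas a a' : C1 a a' -> measurable_fun setT a /\ measurable_fun setT a'.
Proof.
move=> C; have [_ c'] := C; split; apply: continuous_measurable_fun => //.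
exact: C1_continuous C.
Qed.

Lemma L2_realM_le a k : measurable_fun setT a -> (forall x, a x ^+ 2 <= 1) -> L2 (of_real k) ->
  L2 (of_real (fun x => a x * k x)) /\ L2sq (of_real (fun x => a x * k x)) <= L2sq (of_real k).
Proof.
move=> ma h lk; have [lm cm] := L2_mulr_le ma (@aeW _ _ _ mu _ h) lk.
have e : of_real (fun x => a x * k x) = mulc a (of_real k).
  by apply/funext => x; rewrite /mulc /of_real rmorphM.
by rewrite e; split => //; rewrite mul1r in cm.
Qed.

Lemma C1rep_comp F (F' : R -> R) psi psi1 (psi1' : R -> R) : trig_pair F F' -> C1rep psi psi1 psi1' ->
  C1rep (fun x => F (psi x)) (fun x => F (psi1 x)) (fun x => F' (psi1 x) * psi1' x) /\
  L2sq (of_real (fun x => F' (psi1 x) * psi1' x)) <= L2sq (of_real psi1').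
Proof.
move=> [CF hF _ _] [m e C l]; have [m1 m1'] := C1_continuous_meas C.
have [mF mF'] := C1_continuous_meas CF.
have [lk ck] := L2_realM_le (measurableT_comp mF' m1) (fun x => proj2 (hF (psi1 x))) l.
split=> //; split => //; [exact: (measurableT_comp mF m)|by apply: ae_imp e => x ->|exact: C1_comp CF C].
Qed.

Lemma of_realB a k : of_real (fun x => a x - k x) = (fun x => of_real a x - of_real k x).
Proof. by apply/funext => x; rewrite /of_real rmorphB. Qed.

Lemma C1repB a a1 a1' k k1 k1' : C1rep a a1 a1' -> C1rep k k1 k1' ->
  C1rep (fun x => a x - k x) (fun x => a1 x - k1 x) (fun x => a1' x - k1' x).
Proof.
move=> [m e [C1a C1b] l] [m2 e2 [C2a C2b] l2]; split.
- exact: measurable_funB.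
- by apply: ae_imp2 e e2 => x -> ->.
- split; first by move=> x; have := C1a x; have := C2a x => *; exact: is_deriveB.
  by move=> x; apply: cvgB; [exact: C1b|exact: C2b].
- by rewrite of_realB; exact: L2B.
Qed.

Lemma C1rep_H1 a a1 a1' : C1rep a a1 a1' -> L2 (of_real a) -> H1 (of_real a) (of_real a1').
Proof.
move=> [m e C l] la; split => //; apply: weak_deriv_ae (weak_deriv_C1 C).
- exact: L2_cmeas.
- exact: L2_cmeas.
- by apply: ae_imp e => x; rewrite /of_real => ->.
- exact: aeeq_refl.
Qed.

Lemma wD_ae f g h : H1 f g -> cmeas h -> aeeq f h -> aeeq (wD h) (wD f).
Proof.
move=> H m e; have [lf lg d] := H; have [_ ew] := H1_wD H.
have Hh : H1 h g by exact: H1_ae H m (L2_cmeas lg) e (@aeeq_refl R g).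
have [_ ew'] := H1_wD Hh; exact: aeeq_trans ew' (aeeq_sym ew).
Qed.

Lemma wD_lin z f f' g g' : H1 f f' -> H1 g g' ->
  aeeq (wD (fun x => z * f x + g x)) (fun x => z * wD f x + wD g x).
Proof.
move=> Hf Hg; have [Hf' _] := H1_wD Hf; have [Hg' _] := H1_wD Hg.
by have [] := H1_wD (H1_lin z Hf' Hg').
Qed.

Lemma sobolev1_lin z f g : sobolev 1 f -> sobolev 1 g -> sobolev 1 (fun x => z * f x + g x).
Proof. by move=> /sobolev1P hf /sobolev1P hg; apply: H1_sobolev (H1_lin z hf hg). Qed.

Lemma sobolev2_lin z f g : sobolev 2 f -> sobolev 2 g -> sobolev 2 (fun x => z * f x + g x) /\
  aeeq (wD (wD (fun x => z * f x + g x))) (fun x => z * wD (wD f) x + wD (wD g) x).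
Proof.
move=> /sobolev2P[f1 f2] /sobolev2P[g1 g2].
have [l1 l2 d1] := H1_lin z f1 g1; have h2 := H1_lin z f2 g2; have [_ l3 d2] := h2.
split; first by split => //; exists (fun x => z * wD f x + wD g x); split => //; split => //; exists (fun x => z * wD (wD f) x + wD (wD g) x).
have e := wD_lin z f1 g1; have [hw _] := H1_wD (And3 l1 l2 d1); have [_ lorentz _] := hw.
apply: aeeq_trans (wD_lin z f2 g2).
exact: wD_ae h2 (L2_cmeas lorentz) (aeeq_sym e).
Qed.

Lemma wall_terms psi psi1 psi1' u g : C1rep psi psi1 psi1' -> L2 (cos_ psi) -> H1 u g ->
  [/\ H1 (fun x => s_ psi x * u x) (wD (fun x => s_ psi x * u x)),
      L2 (fun x => s_ psi x * u x),
      L2 (fun x => s_ psi x * calT (fun y => s_ psi y * u y) x) &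
      L2 (fun x => c_ psi x * u x)].
Proof.
move=> Cp lc H; have [ms _ _ _] := Cp.
have [Cs _] := C1rep_comp trig_sin Cp; have [Cc _] := C1rep_comp trig_cos Cp.
have [msin _ _ _] := Cs; have [mcos _ _ _] := Cc.
have sb : {ae mu, forall x, sin (psi x) ^+ 2 <= 1} by apply: aeW => x; exact: sin_sqr_le.
have cb : {ae mu, forall x, cos (psi x) ^+ 2 <= 1} by apply: aeW => x; exact: cos_sqr_le.
have [Hs _] := H1_mulc ler01 Cs sb H.
have [Hw _] := H1_wD Hs; have [ls _ _] := Hs.
have [lT _] := calT_H1 Hs.
have [l2 _] := L2_mulr_le msin sb lT.
have Hc := C1rep_H1 Cc lc; have [lTc _] := calT_H1 Hc.
have [l3 _] := L2_mul_H1 H lTc.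
have [l4 _] := L2_mulr_le mcos cb l3.
split => //.
rewrite (_ : (fun x => c_ psi x * u x) = mulc (fun x => cos (psi x)) (fun x => calT (cos_ psi) x * u x)) //.
by apply/funext => x; rewrite /c_ /mulc /cos_ /of_real mulrA.
Qed.

(** The second component as a sum of terms that are separately in L^2. *)
Lemma opAc2E nu c H psi (U : state R) : (op_fun (opAc nu c H psi) U).2 = fun x =>
  ((1 - c ^+ 2)%:C * wD (wD U.1) x - s_ psi x * calT (fun y => s_ psi y * U.1 y) x) +
  ((c * nu)%:C * wD U.1 x + (c_ psi x * U.1 x - H%:C * (s_ psi x * U.1 x))) +
  ((2 * c)%:C * wD U.2 x - nu%:C * U.2 x).
Proof. by apply/funext => x /=; rewrite /opLc; ring. Qed.

(** Each term is linear on almost-everywhere classes: weak derivatives by uniqueness,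
T by linearity of the Fourier transform. *)
Lemma linear_opAc nu c H psi psi1 psi1' : C1rep psi psi1 psi1' -> L2 (cos_ psi) ->
  linear_op (opAc nu c H psi).
Proof.
move=> Cp lc; split.
- move=> U [/sobolev2P[h1 _] /sobolev0 l2]; split => //; exact: H1_sobolev h1.
- move=> U [/sobolev2P[h1 h2] s2]; split; first exact: s2.
  have [s l s1 l2] := wall_terms Cp lc h1; rewrite opAc2E.
  have [_ lu' _] := h1; have [_ lu'' _] := h2; have /sobolev1P[lv lv' _] := s2.
  apply: L2D; [apply: L2D; [|apply: L2D]|].
  + by apply: L2B => //; exact: L2Z.
  + exact: L2Z.
  + by apply: L2B => //; exact: L2Z.
  + by apply: L2B; exact: L2Z.
- move=> U V [/sobolev2P[h1 h2] s2] [/sobolev2P[k1 k2] r2] [e1 e2]; split; first exact: e2.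
  rewrite !opAc2E.
  have [s _ _ _] := wall_terms Cp lc h1; have [_ ls _ _] := wall_terms Cp lc k1.
  have [l1 l1' _] := k1; have [l2 l2' _] := k2.
  have d1 := wD_ae h1 (L2_cmeas l1) e1.
  have d2 := wD_ae h2 (L2_cmeas l2) (aeeq_sym d1).
  have d3 := wD_ae (iffLR (sobolev1P _) s2) (L2_cmeas (sobolev0 r2)) e2.
  have es : aeeq (fun x => s_ psi x * U.1 x) (fun x => s_ psi x * V.1 x).
    by apply: ae_imp e1 => x ->.
  have eT := calT_ae s (L2_cmeas ls) es.
  have d123 : {ae mu, forall x, [/\ wD V.1 x = wD U.1 x, wD (wD V.1) x = wD (wD U.1) x & wD V.2 x = wD U.2 x]}.
    apply: ae_imp3 d1 d2 d3 => x a1 a2 a3; exact: And3 a1 a2 a3.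
  have d456 : {ae mu, forall x, [/\ U.1 x = V.1 x, U.2 x = V.2 x &
    calT (fun x => s_ psi x * U.1 x) x = calT (fun x => s_ psi x * V.1 x) x]}.
    apply: ae_imp3 e1 e2 eT => x a1 a2 a3; exact: And3 a1 a2 a3.
  apply: ae_imp2 d123 d456 => x [-> -> ->] [-> -> ->]; reflexivity.
- move=> z U V [p1 s2] [q1 r2].
  have /sobolev2P[h1 h2] := p1; have /sobolev2P[k1 k2] := q1.
  have [s _ _ _] := wall_terms Cp lc h1; have [r _ _ _] := wall_terms Cp lc k1.
  have [S2 d2] := sobolev2_lin z p1 q1; split.
    by split => //; exact: sobolev1_lin.
  split; first exact: aeeq_refl.
  rewrite (opAc2E nu c H psi (state_lin z U V)) /state_lin !opAc2E /=.
  have d1 := wD_lin z h1 k1.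
  have d3 := wD_lin z (iffLR (sobolev1P _) s2) (iffLR (sobolev1P _) r2).
  have eT := calT_lin z s r.
  have E : (fun y => s_ psi y * (z * U.1 y + V.1 y)) = (fun y => z * (s_ psi y * U.1 y) + s_ psi y * V.1 y).
    by apply/funext => y; ring.
  rewrite E.
  have d123 : {ae mu, forall x, [/\ wD (fun x => z * U.1 x + V.1 x) x = z * wD U.1 x + wD V.1 x,
    wD (wD (fun x => z * U.1 x + V.1 x)) x = z * wD (wD U.1) x + wD (wD V.1) x &
    wD (fun x => z * U.2 x + V.2 x) x = z * wD U.2 x + wD V.2 x]}.
    apply: ae_imp3 d1 d2 d3 => x a1 a2 a3; exact: And3 a1 a2 a3.
  apply: ae_imp2 d123 eT => x [-> -> ->] ->.
  move: (wD (wD U.1) x) (wD (wD V.1) x) (wD U.1 x) (wD V.1 x) (wD U.2 x) (wD V.2 x).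
  move: (calT (fun y => s_ psi y * U.1 y) x) (calT (fun y => s_ psi y * V.1 y) x).
  move: (U.1 x) (V.1 x) (U.2 x) (V.2 x) (c_ psi x) (s_ psi x).
  move: (1 - c ^+ 2)%:C (c * nu)%:C (H%:C) (2 * c)%:C (nu%:C) => *; ring.
Qed.

(** So that linearity has to be proved only once. *)
Lemma opA_opAc (nu : R) (theta : R -> R) : opA nu theta = opAc nu 0 0 theta.
Proof.
rewrite /opA /opAc; congr UnboundedOp; apply/funext => U; congr pair; apply/funext => x.
rewrite /opL /opLc expr0n subr0 mul0r mulr0 rmorph1 rmorph0; ring.
Qed.

Lemma linear_op_sub (P S : unbounded_op R) : linear_op P -> linear_op S -> linear_op (op_sub P S).
Proof.
move=> [p1 p2 p3 p4] [s1 s2 s3 s4]; split.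
- by move=> U [/p1].
- move=> U [/p2[a1 a2] /s2[b1 b2]]; split; first exact: sobolev1_lin.
  by apply: L2D => //; exact: L2Z.
- move=> U V [u1 u2] [v1 v2] e; have [a1 a2] := p3 _ _ u1 v1 e; have [b1 b2] := s3 _ _ u2 v2 e.
  by split; [apply: ae_imp2 a1 b1|apply: ae_imp2 a2 b2] => x /= -> ->.
- move=> z U V [u1 u2] [v1 v2].
  have [a1 [a2 a3]] := p4 z _ _ u1 v1; have [b1 [b2 b3]] := s4 z _ _ u2 v2.
  split; first by split.
  by split; [apply: ae_imp2 a2 b2|apply: ae_imp2 a3 b3] => x /= -> ->; rewrite /=; ring.
Qed.
End Operators.

(** * Dependence of the nonlocal term on the wall *)

Section Perturbation.
Context {R : realType}.
Local Notation mu := (@lebesgue_measure R).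
Implicit Types (p a F k phi w psi theta : R -> R) (x y xi : R) (f g h u v : cfun R) (z : R[i]).

Definition H1sqr f : R := L2sq f + L2sq (wD f).

Lemma H1sqr_ge0 f : 0 <= H1sqr f.
Proof. by rewrite addr_ge0 ?L2sq_ge0. Qed.

Lemma H1sqrE f g : H1 f g -> L2sq f + L2sq g = H1sqr f.
Proof.
move=> H; have [[_ l' _] e] := H1_wD H; have [_ lg _] := H.
by rewrite /H1sqr (L2sq_ae (L2_cmeas l') (L2_cmeas lg) e).
Qed.

Lemma of_realD a k : of_real (fun x => a x + k x) = (fun x => of_real a x + of_real k x).
Proof. by apply/funext => x; rewrite /of_real rmorphD. Qed.

Section Wall.
Variables (theta theta' psi : R -> R).
Hypothesis Ct : C1rep theta theta theta'.
Hypothesis lc : L2 (cos_ theta).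
Hypothesis s2 : sobolev 2 (of_real (psi \- theta)).
Let E := H1sqr (of_real (psi \- theta)).
Let N := L2sq (of_real theta').

(** The representative of psi is theta plus the C^1 representative of psi - theta.
The uniform bound on psi - theta is the Sobolev inequality. *)
Lemma wall_rep : exists psi1 psi1', [/\ C1rep psi psi1 psi1',
  L2 (of_real (fun x => psi1' x - theta' x)),
  L2sq (of_real (fun x => psi1' x - theta' x)) <= E &
  {ae mu, forall x, (psi x - theta x) ^+ 2 <= sobolev_cst * E}].
Proof.
have [h1 h2] := iffLR (sobolev2P _) s2.
have [eta1 [eta1' [C e1 e2]]] := H2_C1_rep h1 h2.
have [l1 l2 _] := h1; have [mt et Ctt lt] := Ct.
have [[mr _] [_ m1']] := (L2_cmeas l1, C1_continuous_meas C).
set g := wD _ in h2 e2 l2.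
have [le ce] : L2 (of_real eta1') /\ L2sq (of_real eta1') <= 1 * L2sq g.
  apply: (L2_leK (cmeas_real m1') l2).
  by apply: ae_imp e2 => x ex; rewrite mul1r /of_real sqc_real -ex /sqc lerDl sqr_ge0.
have dE : (fun x => (theta' x + eta1' x) - theta' x) = eta1'.
  by apply/funext => x; rewrite addrC addKr.
exists (fun x => theta x + eta1 x), (fun x => theta' x + eta1' x); split.
- split.
  + rewrite (_ : psi = fun x => theta x + (psi x - theta x)); last by apply/funext => x; ring.
    exact: measurable_funD.
  + by apply: ae_imp e1 => x /= h; rewrite -h; ring.
  + exact: C1D.
  + by rewrite of_realD; exact: L2D.
- by rewrite dE.
- by rewrite dE; apply: le_trans ce _; rewrite mul1r /E /H1sqr lerDr L2sq_ge0.
- by apply: ae_imp (sobolev_sup h1) => x; rewrite sqc_real.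
Qed.

(** The difference of the derivatives is
F'(psi) (psi' - theta') + (F'(psi) - F'(theta)) theta',
where the first factor of each product is bounded, in the second one by the
Sobolev bound on psi - theta, and the second factor is in L^2. *)
Lemma trig_perturbation F (F' : R -> R) : trig_pair F F' -> exists a1 a1',
  [/\ C1rep (fun x => F (psi x) - F (theta x)) a1 a1',
      {ae mu, forall x, (F (psi x) - F (theta x)) ^+ 2 <= sobolev_cst * E},
      L2 (of_real (fun x => F (psi x) - F (theta x))),
      L2sq (of_real (fun x => F (psi x) - F (theta x))) <= E &
      L2sq (of_real a1') <= 2 * E + 2 * sobolev_cst * E * N].
Proof.
move=> T; have [CF hF lF lF'] := T; have [psi1 [psi1' [Cp ld cd hb]]] := wall_rep.
have [C1a _] := C1rep_comp T Cp; have [C1b _] := C1rep_comp T Ct.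
have C := C1repB C1a C1b.
have [mF mF'] := C1_continuous_meas CF.
have [h1 _] := iffLR (sobolev2P _) s2; have [lpsi _ _] := h1.
have [mt _ Ctt lt] := Ct; have [mpsi e1 C1p _] := Cp.
have [mp1 _] := C1_continuous_meas C1p; have [mC _ _ _] := C.
eexists; eexists; split; first exact: C.
- by apply: ae_imp hb => x; apply: le_trans; exact: lF.
- apply: proj1 (L2_leK (K := 1) (cmeas_real mC) lpsi _).
  by apply: aeW => x; rewrite mul1r !sqc_real; exact: lF.
- have [_] : L2 (of_real (fun x => F (psi x) - F (theta x))) /\
      L2sq (of_real (fun x => F (psi x) - F (theta x))) <= 1 * L2sq (of_real (psi \- theta)).
    apply: (L2_leK (cmeas_real mC) lpsi).
    by apply: aeW => x; rewrite mul1r !sqc_real; exact: lF.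
  by rewrite mul1r => /le_trans; apply; rewrite /E /H1sqr lerDl L2sq_ge0.
have [l1 c1] := L2_realM_le (measurableT_comp mF' mp1) (fun x => proj2 (hF (psi1 x))) ld.
have mD : measurable_fun setT (fun x => F' (psi1 x) - F' (theta x)).
  by apply: measurable_funB; [exact: (measurableT_comp mF' mp1)|exact: (measurableT_comp mF' mt)].
have hD : {ae mu, forall x, (F' (psi1 x) - F' (theta x)) ^+ 2 <= sobolev_cst * E}.
  by apply: ae_imp2 hb e1 => x h ex; apply: le_trans h; rewrite ex; exact: lF'.
have [l2 c2] := L2_mulr_le mD hD lt.
rewrite (_ : of_real _ = fun x => of_real (fun x => F' (psi1 x) * (psi1' x - theta' x)) x +
  mulc (fun x => F' (psi1 x) - F' (theta x)) (of_real theta') x); last first.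
  by apply/funext => x; rewrite /mulc /of_real -rmorphM -rmorphD; congr (_%:C); ring.
have := L2sqD l1 l2; move: c1 c2; rewrite -/N; have := cd.
move: (L2sq _) (L2sq _) (L2sq _) (L2sq _) => c3 c4 c5 c6; lra.
Qed.

Lemma cos_L2 : L2 (cos_ psi) /\ L2sq (cos_ psi) <= 2 * L2sq (cos_ theta) + 2 * E.
Proof.
have [a1 [a1' [_ _ l c _]]] := trig_perturbation trig_cos.
have e : cos_ psi = (fun x => cos_ theta x + of_real (fun x => cos (psi x) - cos (theta x)) x).
  by apply/funext => x; rewrite /cos_ /of_real -rmorphD; congr (_%:C); ring.
rewrite e; split; first exact: L2D.
have := L2sqD lc l; lra.
Qed.

(** The part of the linearized operator in which the wall enters nonlocally. *)
Definition wall_op psi u : cfun R := fun x => s_ psi x * calT (fun y => s_ psi y * u y) x - c_ psi x * u x.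

(** T maps H^1 to L^2, and multiplication by a maps H^1 to itself. *)
Lemma calT_mulc a a1 (a1' : R -> R) (M : R) u g : 0 <= M -> C1rep a a1 a1' ->
  {ae mu, forall x, a x ^+ 2 <= M} -> H1 u g ->
  [/\ H1 (mulc a u) (fun x => mulc a1' u x + mulc a1 g x), L2 (calT (mulc a u)) &
  L2sq (calT (mulc a u)) <= 4 * (M + sobolev_cst * L2sq (of_real a1')) * (L2sq u + L2sq g)].
Proof.
move=> M0 C h H; have [Ha ca] := H1_mulc M0 C h H; have [l c] := calT_H1 Ha.
split => //; apply: le_trans c _; lra.
Qed.

(** T(a) is only in L^2, but u is bounded. *)
Lemma mul_calT a a1 (a1' : R -> R) u g : C1rep a a1 a1' -> L2 (of_real a) -> H1 u g ->
  L2 (fun x => calT (of_real a) x * u x) /\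
  L2sq (fun x => calT (of_real a) x * u x) <=
    2 * sobolev_cst * (L2sq (of_real a) + L2sq (of_real a1')) * (L2sq u + L2sq g).
Proof.
move=> C la H; have [l c] := calT_H1 (C1rep_H1 C la); have [l2 c2] := L2_mul_H1 H l.
split => //; apply: le_trans c2 _.
have k0 := @sobolev_cst_ge0 R; have s0 : 0 <= L2sq u + L2sq g by rewrite addr_ge0 ?L2sq_ge0.
have := ler_wpM2l (mulr_ge0 k0 s0) c; lra.
Qed.

Definition wall_op_cst (M P : R) : R := 8 * (1 + sobolev_cst * M) + 4 * sobolev_cst * (P + M).

Lemma wall_op_bound u g : H1 u g -> L2 (wall_op theta u) /\
  L2sq (wall_op theta u) <= wall_op_cst N (L2sq (cos_ theta)) * (L2sq u + L2sq g).
Proof.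
rewrite /wall_op_cst => H; have [Cs ns] := C1rep_comp trig_sin Ct; have [Cc nc] := C1rep_comp trig_cos Ct.
have [ms _ _ _] := Cs; have [mc _ _ _] := Cc.
have sb : {ae mu, forall x, sin (theta x) ^+ 2 <= 1} by apply: aeW => x; exact: sin_sqr_le.
have cb : {ae mu, forall x, cos (theta x) ^+ 2 <= 1} by apply: aeW => x; exact: cos_sqr_le.
have [_ l1 c1] := calT_mulc ler01 Cs sb H; have [l2 c2] := L2_mulr_le ms sb l1.
have [l3 c3] := mul_calT Cc lc H; have [l4 c4] := L2_mulr_le mc cb l3.
have -> : wall_op theta u = fun x => mulc (fun x => sin (theta x)) (calT (mulc (fun x => sin (theta x)) u)) x -
    mulc (fun x => cos (theta x)) (fun x => calT (cos_ theta) x * u x) x.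
  by apply/funext => x; rewrite /wall_op /c_ /mulc -mulrA.
split; first exact: L2B.
apply: le_trans (L2sqB l2 l4) _.
have k0 := @sobolev_cst_ge0 R; have s0 : 0 <= L2sq u + L2sq g by rewrite addr_ge0 ?L2sq_ge0.
move: ns nc c1 c2 c3 c4 => ns nc c1 c2 c3 c4.
have := ler_wpM2l (mulr_ge0 k0 s0) ns; have := ler_wpM2l (mulr_ge0 k0 s0) nc.
rewrite -/N; rewrite !mul1r in c2 c4; rewrite -/(cos_ theta) in c3 c4.
have := le_trans c2 c1; have := le_trans c4 c3.
move: (L2sq u + L2sq g) (@sobolev_cst R) N (L2sq (cos_ theta)) k0 s0 => S k N0 P k0 s0.
move: (L2sq _) (L2sq _) (L2sq _) (L2sq _) => p1 p2 p3 p4; lra.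
Qed.

Definition perturbation_cst (M P : R) : R :=
  4 * sobolev_cst * (4 * (1 + sobolev_cst * (2 * M + 2))) + 4 * (4 * (sobolev_cst + sobolev_cst * (2 + 2 * sobolev_cst * M))) +
  4 * sobolev_cst * (sobolev_cst * (2 * ((2 * P + 2) + (2 * M + 2)))) + 4 * sobolev_cst * (2 * (1 + (2 + 2 * sobolev_cst * M))).

(** The telescoping of two differences of products; 1 * A comes from the form in
which linearity of T is stated. *)
Lemma product_difference (p q r t X A B Y C D w : R[i]) : X = 1 * A + B -> Y = 1 * C + D ->
  (p - q) * X + q * A - ((r - t) * (Y * w) + t * (C * w)) = p * X - r * Y * w - (q * B - t * D * w).
Proof. by move=> -> ->; ring. Qed.

Lemma perturbation_arith (q0 q1 q2 p1 p2 p3 p4 S M P e : R) :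
  q0 <= 2 * q1 + 2 * q2 -> q1 <= 2 * p1 + 2 * p2 -> q2 <= 2 * p3 + 2 * p4 ->
  p1 <= sobolev_cst * e * (4 * (1 + sobolev_cst * (2 * M + 2)) * S) ->
  p2 <= 4 * (sobolev_cst * e + sobolev_cst * (2 * e + 2 * sobolev_cst * e * M)) * S ->
  p3 <= sobolev_cst * e * (2 * sobolev_cst * (2 * P + 2 + (2 * M + 2)) * S) ->
  p4 <= 2 * sobolev_cst * (e + (2 * e + 2 * sobolev_cst * e * M)) * S ->
  q0 <= perturbation_cst M P * e * S.
Proof.
rewrite /perturbation_cst; move: (@sobolev_cst R) => k h0 h1 h2 b1 b2 b3 b4.
apply: (@le_trans _ _ (4 * (p1 + p2 + p3 + p4))); first lra.
apply: (@le_trans _ _ (4 * (k * e * (4 * (1 + k * (2 * M + 2)) * S) + 4 * (k * e + k * (2 * e + 2 * k * e * M)) * S +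
  k * e * (2 * k * (2 * P + 2 + (2 * M + 2)) * S) + 2 * k * (e + (2 * e + 2 * k * e * M)) * S))); first lra.
by rewrite le_eqVlt; apply/orP; left; apply/eqP; ring.
Qed.

(** Each of the four products in the difference has a factor
sin psi - sin theta or cos psi - cos theta, which is O(c) both uniformly and
in H^1. *)
Lemma wall_op_perturbation u g : H1 u g -> E <= 1 ->
  L2 (fun x => wall_op psi u x - wall_op theta u x) /\
  L2sq (fun x => wall_op psi u x - wall_op theta u x) <= perturbation_cst N (L2sq (cos_ theta)) * E * (L2sq u + L2sq g).
Proof.
move=> H E1; have [psi1 [psi1' [Cp ld cd _]]] := wall_rep.
have [mt _ Ctt lt] := Ct.
have [Cs ns] := C1rep_comp trig_sin Cp; have [Cc nc] := C1rep_comp trig_cos Cp.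
have [Cst _] := C1rep_comp trig_sin Ct; have [Cct _] := C1rep_comp trig_cos Ct.
have [a1 [a1' [Ca ha la ca ca']]] := trig_perturbation trig_sin.
have [b1 [b1' [Cb hb lb cb cb']]] := trig_perturbation trig_cos.
have [lcp ccp] := cos_L2.
have n1 : L2sq (of_real psi1') <= 2 * N + 2.
  rewrite (_ : of_real psi1' = fun x => of_real (fun x => psi1' x - theta' x) x + of_real theta' x); last first.
    by apply/funext => x; rewrite /of_real -rmorphD; congr (_%:C); ring.
  have := L2sqD ld lt; rewrite -/N; lra.
have sb (phi : R -> R) : {ae mu, forall x, sin (phi x) ^+ 2 <= 1} by apply: aeW => x; exact: sin_sqr_le.
have cb1 : {ae mu, forall x, cos (theta x) ^+ 2 <= 1} by apply: aeW => x; exact: cos_sqr_le.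
have k0 := @sobolev_cst_ge0 R; have E0 : 0 <= E by exact: H1sqr_ge0.
have kE : 0 <= sobolev_cst * E by exact: mulr_ge0.
have [ms _ _ _] := Cst; have [mc _ _ _] := Cct; have [ma _ _ _] := Ca; have [mb _ _ _] := Cb.
have [_ l1 c1] := calT_mulc ler01 Cs (sb psi) H; have [l1' c1'] := L2_mulr_le ma ha l1.
have [Hs2 l2 c2] := calT_mulc kE Ca ha H; have [l2' c2'] := L2_mulr_le ms (sb theta) l2.
have [l3 c3] := mul_calT Cc lcp H; have [l3' c3'] := L2_mulr_le mb hb l3.
have [l4 c4] := mul_calT Cb lb H; have [l4' c4'] := L2_mulr_le mc cb1 l4.
set d1 := mulc _ _ in l1' c1'; set d2 := mulc _ _ in l2' c2'.
set d3 := mulc _ _ in l3' c3'; set d4 := mulc _ _ in l4' c4'.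
have l12 := L2D l1' l2'; have l34 := L2D l3' l4'.
have ld' := L2B l12 l34.
have [Hst _ _] := calT_mulc ler01 Cst (sb theta) H.
have eT1 := calT_lin 1 Hs2 Hst.
have eT2 := calT_lin 1 (C1rep_H1 Cb lb) (C1rep_H1 Cct lc).
have s1E : (fun y => s_ psi y * u y) = (fun x => 1 * mulc (fun x => sin (psi x) - sin (theta x)) u x + mulc (fun x => sin (theta x)) u x).
  by apply/funext => x; rewrite /mulc /s_ /of_real rmorphB; ring.
have c1E : cos_ psi = (fun x => 1 * of_real (fun x => cos (psi x) - cos (theta x)) x + of_real (fun x => cos (theta x)) x).
  by apply/funext => x; rewrite /cos_ /of_real rmorphB; ring.
rewrite -s1E in eT1; rewrite -c1E in eT2.
have d1E x : d1 x = ((sin (psi x))%:C - (sin (theta x))%:C) * calT (fun y => s_ psi y * u y) x.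
  by rewrite -rmorphB.
have d3E x : d3 x = ((cos (psi x))%:C - (cos (theta x))%:C) * (calT (cos_ psi) x * u x).
  by rewrite -rmorphB.
have ae0 : aeeq (fun x => d1 x + d2 x - (d3 x + d4 x)) (fun x => wall_op psi u x - wall_op theta u x).
  by apply: ae_imp2 eT1 eT2 => x e1 e2; rewrite d1E d3E; exact: product_difference e1 e2.
have mp : cmeas (fun x => wall_op psi u x - wall_op theta u x).
  have [lp _] := wall_op_bound H; have [_ _ p1 p2] := wall_terms Cp lcp H.
  by apply: L2_cmeas; apply: L2B lp; exact: L2B.
split; first exact: L2_ae mp ae0 ld'.
rewrite -(L2sq_ae (L2_cmeas ld') mp ae0).
have S0 : 0 <= L2sq u + L2sq g by rewrite addr_ge0 ?L2sq_ge0.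
have N0 : 0 <= N by exact: L2sq_ge0.
have P0 : 0 <= L2sq (cos_ theta) by exact: L2sq_ge0.
have kS := mulr_ge0 k0 S0; have kSE := mulr_ge0 kS E0; have kkSE := mulr_ge0 k0 kSE.
have SE := mulr_ge0 S0 E0.
have B1 : L2sq d1 <= sobolev_cst * E * (4 * (1 + sobolev_cst * (2 * N + 2)) * (L2sq u + L2sq g)).
  apply: le_trans c1' _; apply: ler_wpM2l => //; apply: le_trans c1 _.
  apply: ler_wpM2r => //; apply: ler_wpM2l => //; rewrite lerD2l ler_wpM2l//.
  exact: le_trans ns n1.
have B2 : L2sq d2 <= 4 * (sobolev_cst * E + sobolev_cst * (2 * E + 2 * sobolev_cst * E * N)) * (L2sq u + L2sq g).
  apply: le_trans c2' _; rewrite mul1r; apply: le_trans c2 _.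
  by apply: ler_wpM2r => //; apply: ler_wpM2l => //; rewrite lerD2l ler_wpM2l.
have B3 : L2sq d3 <= sobolev_cst * E * (2 * sobolev_cst * ((2 * L2sq (cos_ theta) + 2) + (2 * N + 2)) * (L2sq u + L2sq g)).
  apply: le_trans c3' _; apply: ler_wpM2l => //; apply: le_trans c3 _.
  apply: ler_wpM2r => //; apply: ler_wpM2l => //; first by rewrite mulr_ge0.
  apply: lerD; last exact: le_trans nc n1.
  by apply: le_trans ccp _; rewrite lerD2l -[leRHS]mulr1 ler_wpM2l.
have B4 : L2sq d4 <= 2 * sobolev_cst * (E + (2 * E + 2 * sobolev_cst * E * N)) * (L2sq u + L2sq g).
  apply: le_trans c4' _; rewrite mul1r; apply: le_trans c4 _.
  apply: ler_wpM2r => //; apply: ler_wpM2l => //; first by rewrite mulr_ge0.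
  exact: lerD.
have h0 := L2sqB l12 l34; have h1 := L2sqD l1' l2'; have h2 := L2sqD l3' l4'.
exact: perturbation_arith h0 h1 h2 B1 B2 B3 B4.
Qed.
End Wall.
End Perturbation.

(** * The relative bound *)

Section Main.
Context {R : realType}.
Local Notation mu := (@lebesgue_measure R).
Implicit Types (p a F k phi w psi theta : R -> R) (x y xi nu c H : R) (f g h u v : cfun R) (z : R[i]) (U : state R).

Lemma static_wall_C1rep theta : static_neel_wall theta ->
  C1rep theta theta (derive1 theta) /\ L2 (cos_ theta).
Proof.
move=> W; have d0 x : derivable theta x 1 := @wall_smooth _ _ W 0%N x.
have d1 x : derivable (derive1 theta) x 1 := @wall_smooth _ _ W 1%N x.
have C : C1 theta (derive1 theta).
  split; first by move=> x; rewrite derive1E; exact: derivableP.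
  by move=> x; apply: differentiable_continuous; apply/derivable1_diffP; exact: d1.
split; last exact: sobolev0 (wall_cos_sobolev W).
split; [by have [] := C1_continuous_meas C|exact: aeW|exact: C|].
exact: (wall_deriv_sobolev W 0%N).
Qed.

Lemma opA2E nu theta U : (op_fun (opA nu theta) U).2 =
  fun x => wD (wD U.1) x - wall_op theta U.1 x - nu%:C * U.2 x.
Proof.
apply/funext => x /=; rewrite /opL /wall_op.
by congr (_ - _); rewrite !opprD !opprK addrA.
Qed.

Lemma op_sub2E nu c H theta psi U :
  (op_fun (op_sub (opAc nu c H psi) (opA nu theta)) U).2 = fun x =>
    (- (c ^+ 2)%:C * wD (wD U.1) x - (wall_op psi U.1 x - wall_op theta U.1 x)) +
    ((c * nu)%:C * wD U.1 x - H%:C * (s_ psi x * U.1 x)) + (2 * c)%:C * wD U.2 x.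
Proof.
apply/funext => x /=; rewrite /opL /opLc /wall_op.
have -> : (1 - c ^+ 2)%:C = 1 - (c ^+ 2)%:C by rewrite rmorphB rmorph1.
move: (wD (wD U.1) x) (wD U.1 x) (wD U.2 x) (calT (fun y => s_ psi y * U.1 y) x).
move: (calT (fun y => s_ theta y * U.1 y) x) (U.1 x) (U.2 x) (s_ psi x) (s_ theta x) (c_ psi x) (c_ theta x).
by move: (c ^+ 2)%:C (c * nu)%:C (H%:C) (2 * c)%:C (nu%:C) => *; ring.
Qed.

Lemma graph_arith (q0 q1 p w v K0 S m : R) : q0 <= 2 * q1 + 2 * (m * v) ->
  q1 <= 2 * w + 2 * p -> p <= K0 * S -> q0 <= 4 * w + 4 * K0 * S + 2 * m * v.
Proof. by move=> *; lra. Qed.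

(** The equation for the second component is solved for u''. *)
Lemma graph_bound nu theta theta' U : C1rep theta theta theta' -> L2 (cos_ theta) -> H2H1 U ->
  L2sq (wD (wD U.1)) <= 4 * L2sq (op_fun (opA nu theta) U).2 +
    4 * wall_op_cst (L2sq (of_real theta')) (L2sq (cos_ theta)) * H1sqr U.1 +
    2 * nu ^+ 2 * L2sq U.2.
Proof.
move=> Ct lc [/sobolev2P[h1 h2] /sobolev0 lv]; have [lp cp] := wall_op_bound Ct lc h1.
have [_ l2 _] := h2; set w := (op_fun _ _).2; have wE : w = _ := opA2E nu theta U.
have lorentz : L2 w.
  by rewrite wE; apply: L2B (L2B l2 lp) _; exact: L2Z.
have -> : wD (wD U.1) = fun x => (w x + wall_op theta U.1 x) + nu%:C * U.2 x.
  by apply/funext => x; rewrite wE addrAC subrK subrK.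
have i1 := L2sqD (L2D lorentz lp) (L2Z nu%:C lv); have i2 := L2sqD lorentz lp.
rewrite (L2sqZ nu%:C lv) sqc_real in i1; rewrite /H1sqr.
exact: graph_arith i1 i2 cp.
Qed.

Lemma sub_arith (q0 q1 q2 q3 a b d e f S X nu c H : R) :
  q0 <= 2 * q1 + 2 * ((2 * c) ^+ 2 * f) -> q1 <= 2 * q2 + 2 * q3 ->
  q2 <= 2 * ((c ^+ 2) ^+ 2 * a) + 2 * b -> q3 <= 2 * ((c * nu) ^+ 2 * d) + 2 * (H ^+ 2 * e) ->
  b <= X * S -> d <= S -> e <= S ->
  q0 <= 8 * c ^+ 4 * a + 8 * (X + c ^+ 2 * nu ^+ 2 + H ^+ 2) * S + 8 * c ^+ 2 * f.
Proof.
move=> h0 h1 h2 h3 hb hd he; have := ler_wpM2l (sqr_ge0 (c * nu)) hd.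
have := ler_wpM2l (sqr_ge0 H) he; lra.
Qed.

Lemma sub_bound nu c H theta theta' psi U : C1rep theta theta theta' -> L2 (cos_ theta) ->
  sobolev 2 (of_real (psi \- theta)) -> H1sqr (of_real (psi \- theta)) <= 1 -> H2H1 U ->
  L2sq (op_fun (op_sub (opAc nu c H psi) (opA nu theta)) U).2 <= 8 * c ^+ 4 * L2sq (wD (wD U.1)) +
    8 * (perturbation_cst (L2sq (of_real theta')) (L2sq (cos_ theta)) * H1sqr (of_real (psi \- theta)) + c ^+ 2 * nu ^+ 2 + H ^+ 2) * H1sqr U.1 +
    8 * c ^+ 2 * L2sq (wD U.2).
Proof.
move=> Ct lc s2 E1 [/sobolev2P[h1 h2] s1].
have [lp cp] := wall_op_perturbation Ct lc s2 h1 E1.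
have /sobolev1P[_ lv' _] := s1; have [lu lu' _] := h1; have [_ lu'' _] := h2.
have [psi1 [psi1' [Cp _ _ _]]] := wall_rep Ct s2.
have [[ms _ _ _] _] := C1rep_comp trig_sin Cp.
have sb : {ae mu, forall x, sin (psi x) ^+ 2 <= 1} by apply: aeW => x; exact: sin_sqr_le.
have [ls cs] := L2_mulr_le ms sb lu.
rewrite op_sub2E.
have la := L2Z (- (c ^+ 2)%:C) lu''; have ld := L2Z (c * nu)%:C lu'.
have le := L2Z H%:C ls; have lf := L2Z (2 * c)%:C lv'.
have i0 := L2sqD (L2D (L2B la lp) (L2B ld le)) lf.
have i1 := L2sqD (L2B la lp) (L2B ld le).
have i2 := L2sqB la lp; have i3 := L2sqB ld le.
rewrite (L2sqZ _ lu'') sqcN sqc_real in i2.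
rewrite (L2sqZ _ lu') (L2sqZ _ ls) !sqc_real in i3.
rewrite (L2sqZ _ lv') sqc_real in i0.
have s0 : L2sq (wD U.1) <= H1sqr U.1 by rewrite /H1sqr lerDr L2sq_ge0.
have s3 : L2sq (mulc (fun x => sin (psi x)) U.1) <= H1sqr U.1.
  by apply: le_trans cs _; rewrite mul1r /H1sqr lerDl L2sq_ge0.
exact: sub_arith i0 i1 i2 i3 cp s0 s3.
Qed.

Lemma perturbation_cst_ge0 (M P : R) : 0 <= M -> 0 <= P -> 0 <= perturbation_cst M P.
Proof.
move=> M0 P0; have k0 := @sobolev_cst_ge0 R; rewrite /perturbation_cst; move: (@sobolev_cst R) k0 => k k0.
by rewrite !(addr_ge0, mulr_ge0).
Qed.

Lemma wall_op_cst_ge0 (M P : R) : 0 <= M -> 0 <= P -> 0 <= wall_op_cst M P.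
Proof.
move=> M0 P0; have k0 := @sobolev_cst_ge0 R; rewrite /wall_op_cst; move: (@sobolev_cst R) k0 => k k0.
by rewrite !(addr_ge0, mulr_ge0).
Qed.

Lemma coefficient_ge0 (nu K1 K2 K0 Kp : R) : 0 <= K0 -> 0 <= Kp ->
  0 <= 40 + 32 * K0 + 24 * nu ^+ 2 + 8 * Kp * K2 ^+ 2 + 8 * K1 ^+ 2.
Proof.
move=> k0 kp; have := sqr_ge0 nu; have := sqr_ge0 K1; have := mulr_ge0 kp (sqr_ge0 K2).
move: (nu ^+ 2) (K1 ^+ 2) (K2 ^+ 2) => *; lra.
Qed.

(** Collects the estimates, using c^2 <= 1 to absorb the higher powers of c. *)
Lemma final_arith (q A S v V w K0 Kp E c nu H K1 K2 : R) :
  q <= 8 * c ^+ 4 * A + 8 * (Kp * E + c ^+ 2 * nu ^+ 2 + H ^+ 2) * S + 8 * c ^+ 2 * V ->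
  A <= 4 * w + 4 * K0 * S + 2 * nu ^+ 2 * v ->
  E <= K2 ^+ 2 * c ^+ 2 -> H ^+ 2 <= K1 ^+ 2 * c ^+ 2 -> c ^+ 2 <= 1 ->
  0 <= A -> 0 <= S -> 0 <= v -> 0 <= V -> 0 <= w -> 0 <= K0 -> 0 <= Kp ->
  q <= c ^+ 2 * (40 + 32 * K0 + 24 * nu ^+ 2 + 8 * Kp * K2 ^+ 2 + 8 * K1 ^+ 2) *
    (S + v + (v + V + w)).
Proof.
move=> hq hA hE hH c1 A0 S0 v0 V0 w0 K00 Kp0.
have c20 := sqr_ge0 c; have nu0 := sqr_ge0 nu; have k1 := sqr_ge0 K1; have k2 := sqr_ge0 K2.
have e1 : c ^+ 4 * A <= c ^+ 2 * (4 * w + 4 * K0 * S + 2 * nu ^+ 2 * v).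
  rewrite (_ : c ^+ 4 = c ^+ 2 * c ^+ 2); last by ring.
  rewrite -mulrA ler_wpM2l//; apply: le_trans hA; rewrite -[leRHS]mul1r.
  exact: ler_wpM2r.
have e2 : Kp * E * S <= Kp * (K2 ^+ 2 * c ^+ 2) * S.
  by rewrite ler_wpM2r// ler_wpM2l.
have e3 : H ^+ 2 * S <= K1 ^+ 2 * c ^+ 2 * S by rewrite ler_wpM2r.
apply: (@le_trans _ _ (c ^+ 2 * (32 * w + (32 * K0 + 8 * Kp * K2 ^+ 2 + 8 * nu ^+ 2 + 8 * K1 ^+ 2) * S + 16 * nu ^+ 2 * v + 8 * V))).
  by move: hq e1 e2 e3; move: (c ^+ 2) (c ^+ 4) (K2 ^+ 2) (K1 ^+ 2) (nu ^+ 2) (H ^+ 2) => *; lra.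
rewrite -[leRHS]mulrA ler_wpM2l//.
have KK := mulr_ge0 Kp0 k2.
move: (nu ^+ 2) (K1 ^+ 2) (K2 ^+ 2) nu0 k1 k2 KK => n m1 m2 nu0 k1 k2 KK.
have tt : 0 <= 2 * v + V + w by lra.
have p1 := mulr_ge0 K00 tt; have p2 := mulr_ge0 nu0 tt.
have p3 := mulr_ge0 KK tt; have p4 := mulr_ge0 k1 tt.
have p5 := mulr_ge0 nu0 S0; have p6 := mulr_ge0 nu0 V0; have p7 := mulr_ge0 nu0 w0; have p8 := mulr_ge0 nu0 v0.
lra.
Qed.

(** From squared norms back to norms; K + 1 is an upper bound for the square root
of K. *)
Lemma sqr_bound (K t x y q : R) : 0 <= K -> 0 <= t -> 0 <= x -> 0 <= y -> 0 <= q ->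
  q ^+ 2 <= t ^+ 2 * K * (x ^+ 2 + y ^+ 2) -> q <= (K + 1) * t * x + (K + 1) * t * y.
Proof.
move=> K0 t0 x0 y0 q0 h; rewrite -mulrDr -(@ler_pXn2r _ 2%N) ?nnegrE//; last first.
  by rewrite !mulr_ge0 ?addr_ge0.
apply: le_trans h _.
have -> : ((K + 1) * t * (x + y)) ^+ 2 = t ^+ 2 * ((K + 1) ^+ 2 * (x + y) ^+ 2) by ring.
rewrite -mulrA ler_wpM2l ?sqr_ge0//; apply: ler_pM => //; rewrite ?addr_ge0 ?sqr_ge0//; first by nra.
by have := mulr_ge0 x0 y0; nra.
Qed.

Lemma small_linear (r K : R) : 0 < K -> small_coefficient r (fun x => K * x).
Proof.
move=> K0; have c : continuous (fun x : R => K * x) by move=> x; exact: mulrl_continuous.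
split.
- exact: continuous_subspaceT.
- by move=> x y _ _ xy; rewrite ltr_pM2l.
- by move=> x; rewrite in_itv /= => /andP[x0 _]; rewrite mulr_ge0// ltW.
- by rewrite -[X in _ --> X](mulr0 K); apply: cvg_at_right_filter; exact: c.
Qed.
End Main.

Theorem lemma4p3 (R : realType) (nu : R) (theta : R -> R) (delta : R)
    (psi : R -> R -> R) (speed field : R -> R)
    (hnu : 0 < nu)
    (htheta : static_neel_wall theta)
    (hfam : moving_wall_family nu theta delta psi speed field) :
  exists (c0 : R) (a b : R -> R),
    [/\ 0 < c0, small_coefficient c0 a, small_coefficient c0 b &
        forall c : R, `|c| < c0 ->
          rel_bounded (opA nu theta)
            (op_sub (opAc nu c (field c) (psi (field c))) (opA nu theta))
            (a `|c|) (b `|c|)].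
Proof.
have [Ct lc] := static_wall_C1rep htheta.
have [K1 n1] := mw_field_bigO hfam; have [K2 n2] := mw_psi_bigO hfam.
have n3 := mw_fieldK hfam.
have [e0 e00 he] : exists2 e : R, 0 < e & forall c : R, `|c| < e ->
    [/\ `|field c| <= K1 * `|c|, sobolev_norm 1 (of_real (psi (field c) \- theta)) <= K2 * `|c| &
        `|field c| < delta].
  have : \forall c \near (0 : R), [/\ `|field c| <= K1 * `|c|,
      sobolev_norm 1 (of_real (psi (field c) \- theta)) <= K2 * `|c| & `|field c| < delta].
    by near=> c; split; near: c => //; apply: filterS n3 => c [].
  move=> [e /= e0 h]; exists e => // c ce; apply: h => /=.
  by rewrite /ball_ sub0r normrN.
pose N := L2sq (of_real (derive1 theta)); pose P := L2sq (cos_ theta).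
pose M := 40 + 32 * wall_op_cst N P + 24 * nu ^+ 2 +
  8 * perturbation_cst N P * K2 ^+ 2 + 8 * K1 ^+ 2.
have k0 := @sobolev_cst_ge0 R; have N0 : 0 <= N by exact: L2sq_ge0.
have P0 : 0 <= P by exact: L2sq_ge0.
have p0 := perturbation_cst_ge0 N0 P0.
have q0 := wall_op_cst_ge0 N0 P0.
have M0 : 0 <= M := coefficient_ge0 nu K1 K2 q0 p0.
(* The last bound makes the squared H^1 distance of the walls at most 1. *)
pose c0 := Num.min e0 (Num.min 1 (`|K2| + 1)^-1).
have c00 : 0 < c0 by rewrite /c0 !lt_min e00 ltr01 invr_gt0 ltr_wpDl.
have M1 : 0 < M + 1 by rewrite ltr_wpDl.
exists c0, (fun x => (M + 1) * x), (fun x => (M + 1) * x).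
split; [exact: c00|exact: small_linear|exact: small_linear|move=> c].
rewrite !lt_min => /and3P[ce c1 cK].
have [f1 f2 f3] := he _ ce.
have [s2 _ _ _] := mw_wall hfam f3.
have EE : H1sqr (of_real (psi (field c) \- theta)) <= K2 ^+ 2 * c ^+ 2.
  rewrite /H1sqr -sobolev_norm1_sqr -(real_normK (num_real c)) -exprMn.
  by rewrite lerXn2r ?nnegrE ?sqrtr_ge0//; exact: le_trans (sqrtr_ge0 _) f2.
have E1 : H1sqr (of_real (psi (field c) \- theta)) <= 1.
  apply: le_trans EE _; rewrite -exprMn -(real_normK (num_real _)) normrM.
  apply: exprn_ile1; first by rewrite mulr_ge0.
  move: cK; rewrite -[ltRHS]mul1r ltr_pdivlMr ?ltr_wpDl// => /ltW; apply: le_trans.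
  by rewrite mulrC ler_wpM2l// lerDl.
have [psi1 [psi1' [Cp _ _ _]]] := wall_rep Ct s2.
have [lcp _] := cos_L2 Ct lc s2.
have LA : linear_op (opA nu theta) by rewrite opA_opAc; exact: linear_opAc Ct lc.
have LAc : linear_op (opAc nu c (field c) (psi (field c))) by exact: linear_opAc Cp lcp.
split; [exact: LA|exact: linear_op_sub|by rewrite mulr_ge0// ltW|by move=> U dU; split|].
move=> U dU; apply: sqr_bound => //; try exact: H1L2norm_ge0.
rewrite !H1L2norm_sqr real_normK ?num_real//.
have [_ /sobolev1P hv] := dU.
set D := op_fun _ U.
have z (f : cfun R) : (fun x => -1 * f x + f x) = fun=> 0.
  by apply/funext => x; rewrite mulN1r addNr.
have d0 : L2sq D.1 + L2sq (wD D.1) = 0.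
  by rewrite -/(H1sqr _) -(H1sqrE (H1_lin (-1) hv hv)) !z L2sq0 addr0.
rewrite d0 add0r.
have g := graph_bound nu Ct lc dU.
have b := sub_bound nu c (field c) Ct lc s2 E1 dU.
have H2 : field c ^+ 2 <= K1 ^+ 2 * c ^+ 2.
  rewrite -(real_normK (num_real (field c))) -(real_normK (num_real c)) -exprMn.
  by rewrite lerXn2r ?nnegrE//; exact: le_trans (normr_ge0 _) f1.
have c21 : c ^+ 2 <= 1.
  by rewrite -(real_normK (num_real c)) exprn_ile1// ltW.
apply: final_arith b g EE H2 c21 _ _ _ _ _ q0 p0; rewrite ?L2sq_ge0//; exact: H1sqr_ge0.
Unshelve. all: by end_near.
Qed.
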